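(* Let $(\Omega,\sigma)$ be a continuous global real flow on a compact metric space, $\omega\cdot t:=\sigma(t,\omega)$. Let $H=\begin{bmatrix}H_1 & H_3 \\ H_2 & -H_1^T\end{bmatrix}\colon\Omega\to\mathfrak{sp}(n,\mathbb{R})$ and $\Delta\colon\Omega\to\mathbb{S}_n(\mathbb{R})$ be continuous, and suppose that $\Delta$ takes positive definite values. For $\lambda\in\mathbb{C}$ let $(F^\lambda)$ denote the family $$\mathbf{z}'=\begin{bmatrix}H_1(\omega\cdot t) & H_3(\omega\cdot t)+\lambda\Delta(\omega\cdot t) \\ H_2(\omega\cdot t) & -H_1^T(\omega\cdot t)\end{bmatrix}\mathbf{z},\qquad\omega\in\Omega.$$ Then there are two dynamical possibilities: O1. There exists $\lambda_0\in\mathbb{C}$ such that $(F^{\lambda_0})$ has exponential dichotomy. In this case the families $(F^\lambda)$ have exponential dichotomy for (at least) all $\lambda\in\mathbb{C}-\mathbb{R}$, and the Weyl functions $M^\pm(\omega,\lambda)$ of $(F^\lambda)$ globally exist for all $\lambda\in\mathbb{C}-\mathbb{R}$ and (for each fixed $\omega\in\Omega$, as functions of $\lambda\in\mathbb{C}^+$ and of $\lambda\in\mathbb{C}^-$) are Herglotz functions. O2. The family $(F^\lambda)$ does not have exponential dichotomy for any $\lambda\in\mathbb{C}$. Equivalently, there exist a point $\omega\in\Omega$ and $\lambda_0\in\mathbb{C}$ such that the system of $(F^{\lambda_0})$ corresponding to $\omega$ admits a nonzero bounded solution (on $\mathbb{R}$) of the form $\mathbf{z}(t,\omega)=\begin{bmatrix}\mathbf{z}_1(t,\omega)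 \\ \mathbf{0}\end{bmatrix}$, in which case this function solves the system of $(F^\lambda)$ corresponding to $\omega$ for all $\lambda\in\mathbb{C}$.
   Context: Notation: $\mathbb{S}_n(\mathbb{R})$ is the set of real symmetric $n\times n$ matrices. $\operatorname{Im}M$ is the entrywise imaginary part. $\mathbb{C}^\pm=\{\lambda\in\mathbb{C} : \pm\operatorname{Im}\lambda>0\}$. $J=\begin{bmatrix}0_n & -I_n \\ I_n & 0_n\end{bmatrix}$ and $\mathfrak{sp}(n,\mathbb{K})=\{H\in\mathbb{M}_{2n\times2n}(\mathbb{K}) : H^TJ+JH=0\}$ for $\mathbb{K}=\mathbb{R}$ or $\mathbb{C}$ (so that $H_2,H_3$ are symmetric). For a family $\mathbf{z}'=H(\omega\cdot t)\mathbf{z}$, $\omega\in\Omega$, with continuous $H\colon\Omega\to\mathfrak{sp}(n,\mathbb{K})$, let $U(t,\omega)$ be the fundamental matrix with $U(0,\omega)=I_{2n}$. Exponential dichotomy: there exist $\eta\ge1$, $\beta>0$ and a splitting $\Omega\times\mathbb{K}^{2n}=L^+\oplus L^-$ into the Whitney sum of two closed subbundles, invariant under $(t,\omega,\mathbf{z})\mapsto(\omega\cdot t,U(t,\omega)\mathbf{z})$, with $\|U(t,\omega)\mathbf{z}\|\le\eta e^{-\beta t}\|\mathbf{z}\|$ for $t\ge0$, $(\omega,\mathbf{z})\in L^+$, and $\|U(t,\omega)\mathbf{z}\|\le\eta e^{\beta t}\|\mathbf{z}\|$ for $t\le0$, $(\omega,\mathbf{z})\in L^-$. The fibers $l^\pm(\omega)=\{\mathbf{z}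 : (\omega,\mathbf{z})\in L^\pm\}$ are then Lagrange planes ($n$-dimensional subspaces of $\mathbb{K}^{2n}$ on which $\mathbf{z}^TJ\mathbf{w}=0$). Weyl functions: in the presence of exponential dichotomy, $M^\pm$ globally exists if for every $\omega\in\Omega$ there is a (necessarily symmetric) matrix $M^\pm(\omega)$ such that the columns of $\begin{bmatrix}I_n \\ M^\pm(\omega)\end{bmatrix}$ form a basis of $l^\pm(\omega)$. Herglotz: a symmetric matrix-valued function $M$ on $\mathbb{C}^+$ or $\mathbb{C}^-$ is Herglotz if it is holomorphic and $\operatorname{Im}M(\lambda)$ is either positive semidefinite on the whole half-plane or negative semidefinite on the whole half-plane. *)

(* Defs.v *)
From HB Require Import structures.
From mathcomp Require Import all_boot all_order all_algebra.
From mathcomp Require Import complex.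
From mathcomp Require Import all_classical all_reals all_analysis.

Set Implicit Arguments.
Unset Strict Implicit.
Unset Printing Implicit Defensive.

Import Order.TTheory GRing.Theory Num.Theory.
Import numFieldNormedType.Exports.

Local Open Scope classical_set_scope.
Local Open Scope complex_scope.
Local Open Scope ring_scope.

(* MathComp-Analysis attaches the topology of a numFieldType to abstract fields
   only; this gives the concrete field R[i] the one of its norm, over itself. *)
HB.instance Definition _ (R : realType) := NormedModule.copy R[i] R[i]^o.

Section LinearFamilies.
Context {R : realType}.

Definition continuous_flow (Omega : topologicalType)
    (sigma : R -> Omega -> Omega) : Prop :=
  [/\ continuous (fun p : R * Omega => sigma p.1 p.2),
      forall w, sigma 0 w = w &
      forall s t w, sigma (s + t) w = sigma s (sigma t w)].

(* R[i] is a normed module over R[i], not over R, so the derivative of a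
   complex-valued function of a real variable is taken componentwise. *)
Definition has_derivative (f : R -> R[i]) (t : R) (d : R[i]) : Prop :=
  is_derive t 1 (fun s => complex.Re (f s)) (complex.Re d) /\
  is_derive t 1 (fun s => complex.Im (f s)) (complex.Im d).

Definition euclidean_norm m (z : 'cV[R[i]]_m) : R :=
  Num.sqrt (\sum_i (complex.Re (z i 0) ^+ 2 + complex.Im (z i 0) ^+ 2)).

Section Family.
Context {Omega : topologicalType} (sigma : R -> Omega -> Omega) {m : nat}.
Implicit Types (A : Omega -> 'M[R[i]]_m) (L : Omega -> {vspace 'cV[R[i]]_m}).

Definition solves A (w : Omega) p (Z : R -> 'M[R[i]]_(m, p)) : Prop :=
  forall t i j,
    has_derivative (fun s => Z s i j) t ((A (sigma t w) *m Z t) i j).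

Definition fundamental_matrix A (U : R -> Omega -> 'M[R[i]]_m) : Prop :=
  forall w, U 0 w = 1%:M /\ solves A w (U^~ w).

Definition closed_subbundle L : Prop :=
  closed [set p : Omega * 'cV[R[i]]_m | p.2 \in L p.1] /\
  forall w0 : Omega, exists (k : nat) (e : 'I_k -> Omega -> 'cV[R[i]]_m),
    \forall w \near w0, (forall i, {for w, continuous (e i)}) /\
                        basis_of (L w) [seq e i w | i : 'I_k].

Definition dichotomy_splitting A Lp Lm : Prop :=
  [/\ closed_subbundle Lp, closed_subbundle Lm,
      forall w, (Lp w + Lm w = fullv)%VS /\ (Lp w :&: Lm w = 0)%VS &
      exists U (eta beta : R),
        [/\ fundamental_matrix A U, 1 <= eta, 0 < beta,
            forall t w (z : 'cV[R[i]]_m),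
              (z \in Lp w -> U t w *m z \in Lp (sigma t w)) /\
              (z \in Lm w -> U t w *m z \in Lm (sigma t w)) &
            forall t w (z : 'cV[R[i]]_m),
              (0 <= t -> z \in Lp w -> euclidean_norm (U t w *m z) <=
                 eta * expR (- beta * t) * euclidean_norm z) /\
              (t <= 0 -> z \in Lm w -> euclidean_norm (U t w *m z) <=
                 eta * expR (beta * t) * euclidean_norm z)]].

Definition exponential_dichotomy A : Prop :=
  exists Lp Lm, dichotomy_splitting A Lp Lm.

End Family.

Definition graph_of n (l : {vspace 'cV[R[i]]_(n + n)}) (M : 'M[R[i]]_n) : Prop :=
  basis_of l [seq col j (col_mx 1%:M M) | j : 'I_n].

Definition weyl_functions (Omega : topologicalType)
    (sigma : R -> Omega -> Omega) n (A : Omega -> 'M[R[i]]_(n + n))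
    (Mp Mm : Omega -> 'M[R[i]]_n) : Prop :=
  exists Lp Lm, dichotomy_splitting sigma A Lp Lm /\
    forall w, graph_of (Lp w) (Mp w) /\ graph_of (Lm w) (Mm w).

Definition positive_definite n (M : 'M[R]_n) : Prop :=
  forall x : 'cV[R]_n, x != 0 -> 0 < (x^T *m M *m x) 0 0.

Definition positive_semidefinite n (M : 'M[R]_n) : Prop :=
  forall x : 'cV[R]_n, 0 <= (x^T *m M *m x) 0 0.

Definition upper_half_plane : set R[i] := [set l | 0 < complex.Im l].
Definition lower_half_plane : set R[i] := [set l | complex.Im l < 0].

Definition herglotz (D : set R[i]) n (M : R[i] -> 'M[R[i]]_n) : Prop :=
  let ImM l := map_mx (@complex.Im R) (M l) in
  [/\ forall l, D l -> (M l)^T = M l,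
      forall l, D l -> forall i j, derivable (fun z => M z i j) l 1 &
      (forall l, D l -> positive_semidefinite (ImM l)) \/
      (forall l, D l -> positive_semidefinite (- ImM l))].

Definition symplectic_J n : 'M[R]_(n + n) := block_mx 0 (- 1%:M) 1%:M 0.

Definition sp n (M : 'M[R]_(n + n)) : Prop :=
  M^T *m symplectic_J n + symplectic_J n *m M = 0.

Definition hamiltonian_mx (K : pzRingType) n (h1 h2 h3 : 'M[K]_n) : 'M[K]_(n + n) :=
  block_mx h1 h3 h2 (- h1^T).

(* the coefficient matrix of the family with complex parameter l *)
Definition spectral_family (Omega : Type) n (H1 H2 H3 Delta : Omega -> 'M[R]_n)
    (l : R[i]) (w : Omega) : 'M[R[i]]_(n + n) :=
  let toC := map_mx (fun x : R => x%:C) in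
  hamiltonian_mx (toC (H1 w)) (toC (H2 w)) (toC (H3 w) + l *: toC (Delta w)).

Definition bounded_on_line m (z : R -> 'cV[R[i]]_m) : Prop :=
  exists K : R, forall t, euclidean_norm (z t) <= K.

End LinearFamilies.

(* Main.v *)
(* Write z = (z1, z2). Along a solution of F^l the flux g(z) = Im (z1^* z2)
   satisfies g' = - Im l (z2^* Delta z2), so for nonreal l it is monotone, and it
   is constant only where z2 = 0. The limit points of a bounded solution have
   constant flux; if there is no nonzero bounded solution with z2 = 0, they must
   vanish. So the flux tends to 0 at both ends of a bounded solution, hence is 0
   identically, and the solution itself is 0. By compactness there is then T > 0
   such that every solution doubles its norm somewhere within time T of any given
   instant; consequently the solutions bounded on a half-line decay exponentially.

   On the plane of solutions that satisfy z2 = +-i z1 at time S the flux is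
   +-|z|^2 / 2, so by monotonicity these solutions stay controlled on [0, S]. Their
   initial values form the graph of a matrix, and letting S tend to infinity shows
   that for each a exactly one (a, b) has a bounded forward solution. This gives
   both Weyl matrices, and with them the splitting, without any a priori knowledge
   of the dimension of the bundles. Their continuity follows from compactness.

   For W(y, z) = y1^* z2 - y2^* z1, with y and z solving F^p and F^q, one has
   W' = (conj p - q) y2^* Delta z2. Integrating, for decaying solutions y_k of
   F^(p_k), the kernel W(y_i, y_j)(0) / (p_j - conj p_i) is semidefinite. One point
   gives the sign of Im M; the points conj l, mu, nu bound the difference of two
   difference quotients of M at l by a quantity that tends to 0 as mu and nu tend
   to l, which is the differentiability of M.

   Conversely a bounded solution vanishes under exponential dichotomy, while a
   solution with z2 = 0 does not see l. *)
Require Import Defs.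
From mathcomp Require Import all_boot all_order all_algebra.
From mathcomp Require Import complex.
From mathcomp Require Import all_classical all_reals all_analysis.
From mathcomp Require Import ring lra.
Import Order.TTheory GRing.Theory Num.Theory.
Import numFieldNormedType.Exports.
Local Open Scope classical_set_scope.
Local Open Scope ring_scope.

Set Implicit Arguments.
Unset Strict Implicit.
Unset Printing Implicit Defensive.

(** * Real functions and linear differential equations *)

(** The alternative is decided by whether a nonzero bounded solution with z2 = 0 exists. Its
    existence excludes a dichotomy for every parameter; its absence yields one for every nonreal
    parameter. The obstacle is that no dimension count for the bounded solutions is available in
    advance. Transversality to the plane z1 = 0 allows at most n dimensions, and the boundary value
    problem on [0, S] supplies n of them. Boundedness is not a closed condition by itself; it
    becomes one as soon as all bounded solutions obey a single decay estimate, and the later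
    compactness arguments rest on this. The point conj l enters the kernel because the form
    conjugates its left parameter: the off-diagonal denominator is then mu - l, and the entries are
    difference quotients of M. Since the coefficients are real, conjugating a solution at l provides
    one at conj l. Squared norms are used throughout, so that the estimates stay polynomial. *)

Section RealDerivatives.
Context {R : realType}.
Implicit Types f g : R -> R.

Lemma is_derive_continuous f (x d : R) :
  is_derive x 1 f d -> {for x, continuous f}.
Proof.
by move=> fd; apply/differentiable_continuous/derivable1_diffP; case: fd.
Qed.

Lemma derive_le0_nonincreasing f (df : R -> R) (a b : R) : a <= b ->
  (forall x : R, a <= x <= b -> is_derive x 1 f (df x)) ->
  (forall x, a <= x <= b -> df x <= 0) -> f b <= f a.
Proof.
move=> ab fd df0.
have [||c cab] := @MVT_segment R f df a b ab.
- by move=> x; rewrite in_itv/= => /andP[ax xb]; apply: fd; rewrite !ltW.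
- apply/continuous_in_subspaceT => x; rewrite inE/= in_itv/= => xab.
  exact: is_derive_continuous (fd x xab).
- move: cab; rewrite in_itv/= => cab fba.
  by rewrite -subr_le0 fba mulr_le0_ge0 ?df0 ?subr_ge0.
Qed.

Lemma derive_le_growth f g (df dg : R -> R) (a b : R) : a <= b ->
  (forall x : R, a <= x <= b -> is_derive x 1 f (df x)) ->
  (forall x : R, a <= x <= b -> is_derive x 1 g (dg x)) ->
  (forall x, a <= x <= b -> df x <= dg x) -> f b - f a <= g b - g a.
Proof.
move=> ab fd gd le_fg.
have := @derive_le0_nonincreasing (f - g) (fun x => df x - dg x) a b ab.
rewrite /= => H; have {H} : f b - g b <= f a - g a; last by lra.
apply: H => x xab; last by rewrite subr_le0 le_fg.
have := fd x xab; have := gd x xab => ? ?; exact: is_deriveB.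
Qed.

(** The integral [G a] from [a] is differentiated only at points above [a], so its base point has to
    lie below both x and 0 and moves with x. The increment [G a x - G a 0] does not depend on the
    base point, because two functions with the same derivative have the same increments. *)
Lemma exists_primitive f : continuous f ->
  exists2 F : R -> R, F 0 = 0 & forall x : R, is_derive x 1 F (f x).
Proof.
move=> fc.
pose G a x := (\int[@lebesgue_measure R]_(t in `[a, x]) f t)%R.
have dG (a x : R) : a < x -> is_derive x 1 (G a) (f x).
  move=> ax.
  have [||||dF F'] := @continuous_FTC1 R f (BLeft a) x (x + 1).
  - by rewrite ltrDl.
  - by apply: continuous_compact_integrable;
      [exact: segment_compact | exact: continuous_subspaceT].
  - by rewrite lte_fin.
  - exact: fc.
  by split; [exact: dF | rewrite -derive1E; exact: F'].
have GE (a b x : R) : a <= b -> b < x -> b < 0 -> G a x - G a 0 = G b x - G b 0.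
  move=> ab bx b0.
  have main y z : b < y -> y <= z -> G a z - G a y = G b z - G b y.
    move=> byy yz; apply/eqP; rewrite eq_le; apply/andP; split;
    apply: (@derive_le_growth _ _ f f) => // s /andP[ys _]; apply: dG;
    lra.
  by have [x0|x0] := leP 0 x; [exact: main|have := main _ _ bx (ltW x0); lra].
exists (fun x => let a := - `|x| - 1 in G a x - G a 0); first by rewrite /= subrr.
move=> x.
(* Below the base point [- |y| - 1] of every y at distance less than 1 from x. *)
pose a := - `|x| - 2.
apply: (@near_eq_is_derive _ _ _ (fun y => G a y - G a 0)).
  near=> y => /=.
  have xy : `|y - x| < 1.
    by rewrite distrC; near: y; exact: (@cvgr_dist_lt _ _ _ _ _ id).
  have := ler_norm y; have := ler_norm (- y); rewrite normrN => ? ?.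
  have := ler_normD (y - x) x; rewrite subrK => ?.
  by apply: GE; rewrite /a; [lra|lra|have := normr_ge0 y; lra].
have := @dG a x => H.
have {}H : is_derive x 1 (G a) (f x).
  by apply: H; rewrite /a; have := ler_norm (- x); rewrite normrN; lra.
rewrite -[f x]subr0; exact: is_deriveB.
Unshelve. all: by end_near. Qed.

Lemma is_derive_bigsum (I : Type) (r : seq I) (h : I -> R -> R) (dh : I -> R)
    (x : R) :
  (forall i, is_derive x 1 (h i) (dh i)) ->
  is_derive x 1 (fun s => \sum_(i <- r) h i s) (\sum_(i <- r) dh i).
Proof.
move=> hd; elim: r => [|i r IHr].
  rewrite big_nil (_ : (fun _ => _) = cst 0); first exact: is_derive_cst.
  by apply/funext => s; rewrite big_nil.
rewrite big_cons (_ : (fun _ => _) = h i + (fun s => \sum_(i <- r) h i s)).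
  exact: is_deriveD.
by apply/funext => s; rewrite big_cons.
Qed.

Lemma continuous_bigsum (T : topologicalType) (I : Type) (r : seq I)
    (h : I -> T -> R) (x : T) :
  (forall i, {for x, continuous (h i)}) ->
  {for x, continuous (fun s => \sum_(i <- r) h i s)}.
Proof.
move=> hc; elim: r => [|i r IHr].
  rewrite (_ : (fun _ => _) = cst 0); first exact: cvg_cst.
  by apply/funext => s; rewrite big_nil.
rewrite (_ : (fun _ => _) = (fun s => h i s + \sum_(i <- r) h i s)).
  by apply: continuousD.
by apply/funext => s; rewrite big_cons.
Qed.

Lemma is_derive_expMr (b x : R) :
  is_derive x 1 (fun s => expR (b * s)) (b * expR (b * x)).
Proof.
have H : is_derive x (1 : R) (fun s : R => b * s) b.
  have -> : b = b *: (1 : R) by rewrite /GRing.scale/= mulr1.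
  rewrite (_ : (fun s => _) = b *: (id : R -> R)).
    by apply: is_deriveZ.
  by apply/funext => s; rewrite /GRing.scale/= /GRing.scale/= mulr1.
rewrite mulrC.
exact: (@is_derive1_comp R expR (fun s => b * s)).
Qed.

Lemma is_derive_compN f (x d : R) :
  is_derive (- x) 1 f d -> is_derive x 1 (fun s => f (- s)) (- d).
Proof.
move=> fd; rewrite -mulrN1.
exact: (@is_derive1_comp R f -%R).
Qed.

(* The weight expR (b |x|) turns the Picard operator into a contraction, which
   makes the iteration in [linear_ode_exists] converge on the whole line. *)
Lemma exp_growth_bound f (df : R -> R) (K b : R) : 0 <= K -> 0 < b ->
  f 0 = 0 -> (forall x : R, is_derive x 1 f (df x)) ->
  (forall x, `|df x| <= K * expR (b * `|x|)) ->
  forall x, `|f x| <= K / b * expR (b * `|x|).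
Proof.
move=> K0 b0.
suff main (h dh : R -> R) : h 0 = 0 ->
    (forall x : R, is_derive x 1 h (dh x)) ->
    (forall x, `|dh x| <= K * expR (b * `|x|)) ->
    forall x, 0 <= x -> h x <= K / b * expR (b * `|x|).
  move=> f0 fd fK x.
  have fN (y : R) : is_derive y 1 (- f) (- df y) by exact: is_deriveN.
  have fC (y : R) := is_derive_compN (fd (- y)).
  have fNC (y : R) : is_derive y 1 (fun s => - f (- s)) (- - df (- y)).
    exact: (is_deriveN (is_derive_compN (fd (- y)))).
  rewrite ler_norml -lerNl; apply/andP.
  have [x0|x0] := leP 0 x.
    split; last exact: main x0.
    apply: (main (- f) (- df)) x0 => //.
      by rewrite fctE f0 oppr0.
    by move=> y; rewrite fctE normrN.
  have x0' : 0 <= - x by lra.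
  rewrite -(normrN x); split.
    have := main (fun s => - f (- s)) (fun s => - - df (- s)) _ fNC _ _ x0'.
    rewrite opprK; apply; first by rewrite oppr0 f0 oppr0.
    by move=> y; rewrite !normrN -(normrN y) fK.
  have := main (fun s => f (- s)) (fun s => - df (- s)) _ fC _ _ x0'.
  rewrite opprK; apply; first by rewrite oppr0 f0.
  by move=> y; rewrite normrN -(normrN y) fK.
move=> h0 hd hK x x0.
have gd (y : R) : is_derive y 1 (fun s => K / b * expR (b * s))
    (K * expR (b * y)).
  have -> : K * expR (b * y) = (K / b) *: (b * expR (b * y)).
    by rewrite /GRing.scale/= mulrA divfK// gt_eqF.
  exact: is_deriveZ (is_derive_expMr b y).
have /= := derive_le_growth x0 (fun y _ => hd y) (fun y _ => gd y).
rewrite h0 subr0 ger0_norm// => /(_ _)/le_trans; apply.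
  move=> y /andP[y0 _]; apply: le_trans (ler_norm _) _.
  by rewrite (le_trans (hK y))// ger0_norm.
by rewrite gerBl !mulr_ge0 ?expR_ge0// invr_ge0 ltW.
Qed.

End RealDerivatives.

(** The intervals of radius 2 C / 2^k around [u k] are nested; the limit is the supremum of their
    left ends. The explicit rate serves the uniform estimates of the Picard iteration. *)
Lemma geometric_steps_limit {R : realType} (u : nat -> R) (C : R) :
  (forall k, `|u k.+1 - u k| <= C / 2 ^+ k) ->
  exists l, forall k, `|l - u k| <= 2 * C / 2 ^+ k.
Proof.
move=> uC.
have step k : u k - 2 * C / 2 ^+ k <= u k.+1 - 2 * C / 2 ^+ k.+1 /\
              u k.+1 + 2 * C / 2 ^+ k.+1 <= u k + 2 * C / 2 ^+ k.
  have := uC k; rewrite ler_norml => /andP[].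
  have -> : 2 * C / 2 ^+ k.+1 = C / 2 ^+ k by rewrite exprS; field.
  rewrite -mulrA; lra.
have C0 k : 0 <= 2 * C / 2 ^+ k.
  by rewrite -mulrA mulr_ge0// (le_trans _ (uC k)).
have lo : {homo (fun k => u k - 2 * C / 2 ^+ k) : m n / (m <= n)%N >-> m <= n}.
  by apply: homo_leq => // [y x z|k]; [exact: le_trans|case: (step k)].
have hi : {homo (fun k => u k + 2 * C / 2 ^+ k) : m n / (m <= n)%N >-> n <= m}.
  by apply: homo_leq => // [y x z yx zy|k]; [exact: le_trans zy yx|case: (step k)].
pose E := range (fun k => u k - 2 * C / 2 ^+ k).
have lohi m k : u k - 2 * C / 2 ^+ k <= u m + 2 * C / 2 ^+ m.
  have := lo _ _ (leq_maxr m k); have := hi _ _ (leq_maxl m k) => /=.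
  have := C0 (maxn m k); lra.
have supE : has_sup E.
  split; first by exists (u 0 - 2 * C / 2 ^+ 0); exists 0%N.
  by exists (u 0 + 2 * C / 2 ^+ 0) => _ [k _ <-].
exists (sup E) => k; rewrite ler_distl; apply/andP; split.
  by apply: ub_le_sup; [case: supE | exists k].
by apply: ge_sup => [|_ [m _ <-]//]; case: supE.
Qed.

Lemma linear_ode_exists (R : realType) (I : finType) (a : R -> I -> I -> R)
    (L : R) (x0 : I -> R) :
  (forall i j, continuous (fun t => a t i j)) ->
  (forall t i j, `|a t i j| <= L) ->
  exists x : R -> I -> R, (forall i, x 0 i = x0 i) /\
    forall (t : R) i, is_derive t 1 (x^~ i) (\sum_j a t i j * x t j).
Proof.
move=> ac aL.
have [i0|nI] := pickP I; last first.
  by exists (fun _ => x0); split => [//|t i]; have := nI i.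
have L0 : 0 <= L by apply: le_trans (aL 0 i0 i0).
(* [P] is a total primitive operator; its value at a discontinuous function is arbitrary. *)
have /choice[P HP] : forall f : R -> R, exists F : R -> R,
    continuous f -> F 0 = 0 /\ forall x : R, is_derive x 1 F (f x).
  move=> f; have [fc|nfc] := pselect (continuous f); last by exists f.
  by have [F F0 F'] := exists_primitive fc; exists F.
pose rhs (y : R -> I -> R) i s := \sum_j a s i j * y s j.
pose X := fix X k : R -> I -> R :=
  if k is k'.+1 then fun t i => x0 i + P (rhs (X k') i) t else fun _ => x0.
have rhs_cont y i : (forall j, continuous (y^~ j)) -> continuous (rhs y i).
  move=> yc t; apply: continuous_bigsum => j.
  by apply: continuousM; [exact: ac | exact: yc].
have Xc k i : continuous (X k ^~ i).
  elim: k i => [i t|k IH i t]; first exact: cvg_cst.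
  apply: continuousD; first exact: cvg_cst.
  have [_ H] := HP _ (rhs_cont _ i IH).
  exact: is_derive_continuous (H t).
have XP k i := HP _ (rhs_cont _ i (Xc k)).
pose S := \sum_i `|x0 i|.
have S0 : 0 <= S by apply: sumr_ge0.
have x0S i : `|x0 i| <= S by rewrite /S (bigD1 i)//= lerDl sumr_ge0.
(* The rate [b], twice [c], exceeds twice the bound [#|I| * L] of the right-hand side, so in the
   weighted norm each iteration halves the error; the 1 keeps [b] positive. *)
pose c := #|I|%:R * L + L + 1.
have cardL : 0 <= #|I|%:R * L by rewrite mulr_ge0.
pose b := 2 * c.
have b0 : 0 < b by rewrite /b /c; lra.
have rhs_bound (y : R -> I -> R) t i (K : R) : (forall j, `|y t j| <= K) ->
    `|rhs y i t| <= #|I|%:R * L * K.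
  move=> yK; apply: le_trans (ler_norm_sum _ _ _) _.
  apply: le_trans (_ : \sum_(j : I) L * K <= _).
    by apply: ler_sum => j _; rewrite normrM ler_pM.
  by rewrite sumr_const -mulrA mulr_natl.
have halfb (K : R) : 0 <= K -> #|I|%:R * L * K / b <= K / 2.
  move=> K0; rewrite ler_pdivrMr// /b /c.
  by have := mulr_ge0 K0 L0; have := mulr_ge0 K0 cardL; lra.
have step k t i : `|X k.+1 t i - X k t i| <= S * expR (b * `|t|) / 2 ^+ k.
  elim: k t i => [|k IH] t i.
    rewrite expr0 divr1 /= addrAC subrr add0r.
    have [P0 PD] := XP 0%N i.
    have KK : 0 <= #|I|%:R * L * S by rewrite mulr_ge0.
    apply: le_trans (exp_growth_bound KK b0 P0 PD _ t) _.
      move=> s; apply: le_trans (rhs_bound (X 0%N) s i S x0S) _.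
      by rewrite ler_peMr// -expR0 ler_expR mulr_ge0// ltW.
    by rewrite ler_wpM2r ?expR_ge0// (le_trans (halfb _ S0))//; lra.
  rewrite (_ : X k.+2 t i - X k.+1 t i =
      P (rhs (X k.+1) i) t - P (rhs (X k) i) t); last by rewrite /=; ring.
  have [P0 PD] := XP k.+1 i; have [Q0 QD] := XP k i.
  pose K := S / 2 ^+ k.
  have K0 : 0 <= K by rewrite divr_ge0// exprn_ge0.
  have KK : 0 <= #|I|%:R * L * K by rewrite mulr_ge0.
  have D0 : (P (rhs (X k.+1) i) - P (rhs (X k) i)) 0 = 0.
    by apply/eqP; rewrite subr_eq0 P0 Q0.
  have DD (s : R) := is_deriveB (PD s) (QD s).
  apply: le_trans (exp_growth_bound KK b0 D0 DD _ t) _.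
    move=> s.
    have -> : rhs (X k.+1) i s - rhs (X k) i s =
        rhs (fun s j => X k.+1 s j - X k s j) i s.
      by rewrite /rhs -sumrB; apply: eq_bigr => j _; rewrite -mulrBr.
    rewrite -mulrA (mulrC K) mulrA.
    apply: le_trans (rhs_bound _ s i (K * expR (b * `|s|)) _) _.
      by move=> j; rewrite (le_trans (IH s j))// /K mulrAC.
    by rewrite mulrA mulrAC.
  rewrite (le_trans (ler_wpM2r _ (halfb _ K0))) ?expR_ge0// /K exprS.
  by rewrite le_eqVlt; apply/orP; left; apply/eqP; field.
have /choice[x xX] : forall t, exists xt : I -> R, forall i k,
    `|xt i - X k t i| <= 2 * (S * expR (b * `|t|)) / 2 ^+ k.
  move=> t; have /choice[f fP] := fun i =>
    geometric_steps_limit (u := fun k => X k t i) (fun k => step k t i).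
  by exists f.
have small (M e : R) : 0 <= M -> 0 < e -> exists k : nat, M / 2 ^+ k < e.
  move=> M0 e0; have e1 : 0 < e / (M + 1) by rewrite divr_gt0//; lra.
  have [k /=] := filter_ex (near_infty_natSinv_expn_lt (PosNum e1)).
  rewrite ltr_pdivlMr; last by lra.
  move=> H; exists k; apply: le_lt_trans H.
  have : 0 <= (2 ^+ k)^-1 :> R by rewrite invr_ge0 exprn_ge0.
  by lra.
(* On |s| <= |t| + 1 the weight is bounded, so the convergence is uniform there and the limit
   inherits continuity. *)
have xc i : continuous (x^~ i).
  move=> t; apply/cvgrPdist_lt => e e0.
  have [||k Hk] := small (2 * (S * expR (b * (`|t| + 1)))) (e / 3) _ _.
  - by rewrite mulr_ge0// mulr_ge0// expR_ge0.
  - by lra.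
  have kT s : `|s| <= `|t| + 1 -> `|x s i - X k s i| < e / 3.
    move=> sT; apply: le_lt_trans (xX s i k) (le_lt_trans _ Hk).
    rewrite ler_wpM2r ?invr_ge0 ?exprn_ge0// ler_wpM2l// ler_wpM2l//.
    by rewrite ler_expR ler_wpM2l// ltW.
  near=> s.
  have Hs : `|X k t i - X k s i| < e / 3.
    by near: s; apply: cvgr_dist_lt; [exact: Xc | lra].
  have st : `|s| <= `|t| + 1.
    have ts : `|t - s| < 1 by near: s; exact: (@cvgr_dist_lt _ _ _ _ _ id).
    by have := ler_distD t s 0; rewrite !subr0 distrC; lra.
  have -> : x t i - x s i = (x t i - X k t i) + (X k t i - X k s i)
     - (x s i - X k s i) by ring.
  apply: le_lt_trans (ler_normB _ _) _.
  apply: le_lt_trans (lerD (ler_normD _ _) (lexx _)) _.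
  by have := kT s st; have := kT t _; rewrite lerDl ler01 => /(_ isT); lra.
have XPx i := HP _ (rhs_cont _ i xc).
(* Both sides are compared with the iterate [X k.+1]; each comparison costs at most W / 2^k / 2. *)
have fix_x t i : x t i = x0 i + P (rhs x i) t.
  apply/eqP; rewrite -subr_eq0 -normr_le0; apply/ler_addgt0Pr => e e0.
  pose W := 2 * (S * expR (b * `|t|)).
  have W0 : 0 <= W by rewrite mulr_ge0// mulr_ge0// expR_ge0.
  have [k Hk] := small W e W0 e0.
  have [P0 PD] := XPx i; have [Q0 QD] := XP k i.
  pose K := 2 * S / 2 ^+ k.
  have K0 : 0 <= K by rewrite divr_ge0 ?mulr_ge0// exprn_ge0.
  have KK : 0 <= #|I|%:R * L * K by rewrite mulr_ge0.
  have D0 : (P (rhs x i) - P (rhs (X k) i)) 0 = 0.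
    by apply/eqP; rewrite subr_eq0 P0 Q0.
  have DD (s : R) := is_deriveB (PD s) (QD s).
  have : `|P (rhs x i) t - P (rhs (X k) i) t| <= #|I|%:R * L * K / b * expR (b * `|t|).
    apply: (exp_growth_bound KK b0 D0 DD) => s.
    have -> : rhs x i s - rhs (X k) i s =
        rhs (fun s j => x s j - X k s j) i s.
      by rewrite /rhs -sumrB; apply: eq_bigr => j _; rewrite -mulrBr.
    rewrite -mulrA; apply: rhs_bound => j.
    by rewrite (le_trans (xX s j k))// /K mulrA mulrAC.
  have := xX t i k.+1.
  have -> : 2 * (S * expR (b * `|t|)) / 2 ^+ k.+1 = W / 2 ^+ k / 2.
    by rewrite exprS /W; field.
  have : #|I|%:R * L * K / b * expR (b * `|t|) <= W / 2 ^+ k / 2.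
    apply: le_trans (ler_wpM2r _ (halfb _ K0)) _; first exact: expR_ge0.
    by rewrite /K /W le_eqVlt; apply/orP; left; apply/eqP; field.
  have -> : x t i - (x0 i + P (rhs x i) t) =
    (x t i - X k.+1 t i) - (P (rhs x i) t - P (rhs (X k) i) t) by rewrite /=; ring.
  have := ler_normB (x t i - X k.+1 t i) (P (rhs x i) t - P (rhs (X k) i) t).
  by lra.
exists x; split => [j|t j].
  by rewrite fix_x; have [-> _] := XPx j; rewrite addr0.
rewrite (_ : x^~ j = cst (x0 j) + P (rhs x j)); last first.
  by apply/funext => s; rewrite fctE fix_x.
rewrite -[X in is_derive _ _ _ X]add0r.
by have [_ H] := XPx j; apply: is_deriveD.
Unshelve. all: by end_near. Qed.

(** * Complex-valued functions *)

Local Notation cRe := complex.Re.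
Local Notation cIm := complex.Im.

Section ComplexParts.
Context {R : rcfType}.
Implicit Types x y : R[i].

Lemma cReD x y : cRe (x + y) = cRe x + cRe y.
Proof. by case: x y => [? ?] [? ?]. Qed.
Lemma cImD x y : cIm (x + y) = cIm x + cIm y.
Proof. by case: x y => [? ?] [? ?]. Qed.
Lemma cReN x : cRe (- x) = - cRe x.
Proof. by case: x. Qed.
Lemma cImN x : cIm (- x) = - cIm x.
Proof. by case: x. Qed.
Lemma cReB x y : cRe (x - y) = cRe x - cRe y.
Proof. by rewrite cReD cReN. Qed.
Lemma cImB x y : cIm (x - y) = cIm x - cIm y.
Proof. by rewrite cImD cImN. Qed.
Lemma cReM x y : cRe (x * y) = cRe x * cRe y - cIm x * cIm y.
Proof. by case: x y => [? ?] [? ?]. Qed.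
Lemma cImM x y : cIm (x * y) = cRe x * cIm y + cIm x * cRe y.
Proof. by case: x y => [? ?] [? ?]. Qed.
Lemma cReJ x : cRe (conjc x) = cRe x.
Proof. by case: x. Qed.
Lemma cImJ x : cIm (conjc x) = - cIm x.
Proof. by case: x. Qed.
Lemma cRe_sum I (r : seq I) (F : I -> R[i]) :
  cRe (\sum_(i <- r) F i) = \sum_(i <- r) cRe (F i).
Proof. exact: (big_morph (@cRe R) cReD (erefl _)). Qed.
Lemma cIm_sum I (r : seq I) (F : I -> R[i]) :
  cIm (\sum_(i <- r) F i) = \sum_(i <- r) cIm (F i).
Proof. exact: (big_morph (@cIm R) cImD (erefl _)). Qed.
Lemma complex_eqP x y : cRe x = cRe y -> cIm x = cIm y -> x = y.
Proof. by case: x y => [? ?] [? ?] /= -> ->. Qed.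

(** The norm of [R[i]] takes its values in [R[i]]; the squared modulus lives in [R], where order and
    polynomial arithmetic apply. *)
Definition abs2 x : R := cRe x ^+ 2 + cIm x ^+ 2.

Lemma abs2_ge0 x : 0 <= abs2 x.
Proof. by rewrite addr_ge0// sqr_ge0. Qed.

Lemma abs2_eq0 x : abs2 x = 0 -> x = 0.
Proof.
move/eqP; rewrite paddr_eq0 ?sqr_ge0// !sqrf_eq0 => /andP[/eqP a /eqP b].
exact: complex_eqP.
Qed.

Lemma abs2M x y : abs2 (x * y) = abs2 x * abs2 y.
Proof. rewrite /abs2 cReM cImM; ring. Qed.

End ComplexParts.

Section ComplexTopology.
Context {R : realType}.

Lemma normc_abs2 (z : R[i]) : `|z| = (Num.sqrt (abs2 z))%:C%C.
Proof. by rewrite normc_def. Qed.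

Lemma near_abs2_lt (z : R[i]) (e : R) : 0 < e ->
  \forall w \near z, abs2 (z - w) < e ^+ 2.
Proof.
move=> e0.
have /nbhs_ballP : exists2 d : R[i], 0 < d & ball z d `<=` [set w | `|z - w| < e%:C%C].
  by exists e%:C%C => //; rewrite ltcR.
apply: filterS => w /=.
rewrite normc_abs2 ltcR => H.
by rewrite -(@sqr_sqrtr _ (abs2 _)) ?abs2_ge0// ltrXn2r// nnegrE ?sqrtr_ge0// ltW.
Qed.

Lemma Re_continuous : continuous (fun z : R[i] => cRe z).
Proof.
move=> z; apply/(@cvgrPdist_lt _ _ _ (nbhs z)) => e e0.
apply: filterS (near_abs2_lt z e0) => w.
rewrite /abs2 -cReB => H; rewrite -sqrtr_sqr -(ger0_norm (ltW e0)) -(sqrtr_sqr e).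
rewrite ltr_sqrt ?exprn_gt0//; apply: le_lt_trans H.
by rewrite lerDl sqr_ge0.
Qed.

Lemma Im_continuous : continuous (fun z : R[i] => cIm z).
Proof.
move=> z; apply/(@cvgrPdist_lt _ _ _ (nbhs z)) => e e0.
apply: filterS (near_abs2_lt z e0) => w.
rewrite /abs2 -cImB => H; rewrite -sqrtr_sqr -(ger0_norm (ltW e0)) -(sqrtr_sqr e).
rewrite ltr_sqrt ?exprn_gt0//; apply: le_lt_trans H.
by rewrite lerDr sqr_ge0.
Qed.

Lemma cvg_complex (T : Type) (F : set_system T) (FF : Filter F)
    (f : T -> R[i]) (l : R[i]) :
  cRe (f t) @[t --> F] --> cRe l -> cIm (f t) @[t --> F] --> cIm l ->
  f t @[t --> F] --> l.
Proof.
move=> fR fI; apply/cvgrPdist_lt => e; rewrite ltcE/= => /andP[/eqP ei er].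
have -> : e = (cRe e)%:C%C by apply: complex_eqP.
near=> t.
rewrite normc_abs2 ltcR -(ger0_norm (ltW er)) -sqrtr_sqr ltr_sqrt ?exprn_gt0//.
have H1 : `|cRe l - cRe (f t)| < cRe e / 2.
  by near: t; apply: cvgr_dist_lt => //; lra.
have H2 : `|cIm l - cIm (f t)| < cRe e / 2.
  by near: t; apply: cvgr_dist_lt => //; lra.
rewrite /abs2 cReB cImB -(real_normK (num_real (cRe l - _)))
   -(real_normK (num_real (cIm l - _))).
have := normr_ge0 (cRe l - cRe (f t)); have := normr_ge0 (cIm l - cIm (f t)).
by nra.
Unshelve. all: by end_near. Qed.

Lemma cvg_mx (T : Type) (F : set_system T) (FF : Filter F) (V : topologicalType)
    m n (f : T -> 'M[V]_(m, n)) (l : 'M[V]_(m, n)) :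
  (forall i j, f t i j @[t --> F] --> l i j) -> f t @[t --> F] --> l.
Proof.
move=> fl A [P lP PA]; apply: (@filterS _ F FF [set t | forall i j, P i j (f t i j)]).
  by move=> t Pt; apply: PA.
by apply: filter_forall => i; apply: filter_forall => j; exact: fl (lP i j).
Qed.

Lemma Re_coord_continuous m n i j :
  continuous (fun M : 'M[R[i]]_(m, n) => cRe (M i j)).
Proof.
move=> M; apply: continuous_comp; last exact: Re_continuous.
exact: coord_continuous.
Qed.

Lemma Im_coord_continuous m n i j :
  continuous (fun M : 'M[R[i]]_(m, n) => cIm (M i j)).
Proof.
move=> M; apply: continuous_comp; last exact: Im_continuous.
exact: coord_continuous.
Qed.

Lemma compact_square (r : R) :
  compact [set z : R[i] | -r <= cRe z <= r /\ -r <= cIm z <= r].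
Proof.
pose f (p : R * R) := (p.1 +i* p.2)%C.
have -> : [set z : R[i] | -r <= cRe z <= r /\ -r <= cIm z <= r] =
    f @` (`[-r, r] `*` `[-r, r]).
  apply/seteqP; split => [z [zr zi]|_ [[a b] /= [+ +] <-]].
    by exists (cRe z, cIm z); rewrite /f/= ?in_itv//=; case: z {zr zi}.
  by rewrite !in_itv/=.
apply: continuous_compact; last by apply: compact_setX; exact: segment_compact.
apply: continuous_subspaceT => p.
apply: cvg_complex => /=; [exact: cvg_fst | exact: cvg_snd].
Qed.

Definition sqnorm m (z : 'cV[R[i]]_m) : R := \sum_i abs2 (z i 0).

Lemma sqnorm_ge0 m (z : 'cV[R[i]]_m) : 0 <= sqnorm z.
Proof. by apply: sumr_ge0 => i _; exact: abs2_ge0. Qed.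

Lemma euclidean_normE m (z : 'cV[R[i]]_m) : euclidean_norm z = Num.sqrt (sqnorm z).
Proof. by []. Qed.

Lemma sqnorm_continuous m : continuous (@sqnorm m).
Proof.
move=> z; apply: continuous_bigsum => i.
apply: continuousD; apply: continuousM;
by [exact: Re_coord_continuous | exact: Im_coord_continuous].
Qed.

(** A closed subset of a product of compact squares; the product theorem speaks of row vectors,
    hence the transposition. The half-width r + 1 avoids a square root: x^2 <= r implies |x| <= r +
    1. *)
Lemma compact_sqnorm_le m (r : R) : compact [set z : 'cV[R[i]]_m | sqnorm z <= r].
Proof.
have [r0|r0] := ltP r 0.
  rewrite (_ : mkset _ = set0); first exact: compact0.
  by apply/seteqP; split => // z /=; have := sqnorm_ge0 z; lra.
pose Q := [set v : 'rV[R[i]]_m | forall i, -(r + 1) <= cRe (v ord0 i) <= r + 1 /\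
   -(r + 1) <= cIm (v ord0 i) <= r + 1].
have Qc : compact Q.
  exact: (@rV_compact R[i] m (fun=> [set z | -(r + 1) <= cRe z <= r + 1 /\
   -(r + 1) <= cIm z <= r + 1]) (fun=> @compact_square _)).
have cT : compact (trmx @` Q).
  apply: continuous_compact Qc; apply: continuous_subspaceT => v.
  apply: (@cvg_mx _ (nbhs v) _) => i j; under eq_fun do rewrite mxE.
  by rewrite mxE; exact: coord_continuous.
apply: subclosed_compact cT _.
  by rewrite (_ : mkset _ = @sqnorm m @^-1` [set x | x <= r])//;
    apply: closed_comp; [move=> z _; exact: sqnorm_continuous | exact: closed_le].
move=> z /= zr; exists z^T; last by rewrite trmxK.
move=> i; rewrite mxE.
have : abs2 (z i ord0) <= r.
  apply: le_trans zr; rewrite /sqnorm (bigD1 i)//= lerDl.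
  by apply: sumr_ge0 => j _; exact: abs2_ge0.
rewrite /abs2 => H.
have := sqr_ge0 (cRe (z i ord0)); have := sqr_ge0 (cIm (z i ord0)).
by split; apply/andP; split; nra.
Qed.

End ComplexTopology.

(** * Differentiation of complex-valued functions of a real variable; Gronwall's inequality *)

Section ComplexDerivatives.
Context {R : realType}.
Implicit Types f g : R -> R[i].

Lemma has_derivativeD f g t df dg : has_derivative f t df ->
  has_derivative g t dg -> has_derivative (fun s => f s + g s) t (df + dg).
Proof.
move=> [fr fi] [gr gi]; split.
  rewrite cReD (_ : (fun _ => _) = (fun s => cRe (f s)) + (fun s => cRe (g s))).
    exact: is_deriveD.
  by apply/funext => s; rewrite cReD.
rewrite cImD (_ : (fun _ => _) = (fun s => cIm (f s)) + (fun s => cIm (g s))).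
  exact: is_deriveD.
by apply/funext => s; rewrite cImD.
Qed.

Lemma has_derivative_cst (c : R[i]) t : has_derivative (fun=> c) t 0.
Proof. by split; exact: is_derive_cst. Qed.

Lemma has_derivativeM f g t df dg : has_derivative f t df ->
  has_derivative g t dg ->
  has_derivative (fun s => f s * g s) t (df * g t + f t * dg).
Proof.
move=> [fr fi] [gr gi]; split.
  rewrite (_ : (fun _ => _) = (fun s => cRe (f s)) * (fun s => cRe (g s))
      - (fun s => cIm (f s)) * (fun s => cIm (g s))); last first.
    by apply/funext => s; rewrite cReM.
  have := is_deriveB (is_deriveM fr gr) (is_deriveM fi gi).
  rewrite /GRing.scale /= => /is_derive_eq; apply.
  rewrite cReD !cReM; ring.
rewrite (_ : (fun _ => _) = (fun s => cRe (f s)) * (fun s => cIm (g s))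
    + (fun s => cIm (f s)) * (fun s => cRe (g s))); last first.
  by apply/funext => s; rewrite cImM.
have := is_deriveD (is_deriveM fr gi) (is_deriveM fi gr).
rewrite /GRing.scale /= => /is_derive_eq; apply.
rewrite cImD !cImM; ring.
Qed.

Lemma has_derivativeZ (c : R[i]) f t df : has_derivative f t df ->
  has_derivative (fun s => c * f s) t (c * df).
Proof.
by move=> fd; have := has_derivativeM (has_derivative_cst c t) fd; rewrite mul0r add0r.
Qed.

Lemma has_derivativeN f t df : has_derivative f t df ->
  has_derivative (fun s => - f s) t (- df).
Proof.
move=> /(has_derivativeZ (-1)); rewrite mulN1r.
by under eq_fun do rewrite mulN1r.
Qed.

Lemma has_derivativeB f g t df dg : has_derivative f t df ->
  has_derivative g t dg -> has_derivative (fun s => f s - g s) t (df - dg).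
Proof. by move=> fd /has_derivativeN; exact: has_derivativeD. Qed.

Lemma has_derivativeJ f t df : has_derivative f t df ->
  has_derivative (fun s => conjc (f s)) t (conjc df).
Proof.
move=> [fr fi]; split.
  by rewrite cReJ; under eq_fun do rewrite cReJ.
by rewrite cImJ; under eq_fun do rewrite cImJ; exact: is_deriveN.
Qed.

Lemma has_derivative_sum (I : Type) (r : seq I) (h : I -> R -> R[i])
    (dh : I -> R[i]) t : (forall i, has_derivative (h i) t (dh i)) ->
  has_derivative (fun s => \sum_(i <- r) h i s) t (\sum_(i <- r) dh i).
Proof.
move=> hd; split.
  by rewrite cRe_sum; under eq_fun do rewrite cRe_sum;
    apply: is_derive_bigsum => i; case: (hd i).
by rewrite cIm_sum; under eq_fun do rewrite cIm_sum;
  apply: is_derive_bigsum => i; case: (hd i).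
Qed.

Lemma has_derivative_comp_shift f (s t : R) df : has_derivative f (t + s) df ->
  has_derivative (fun u => f (u + s)) t df.
Proof.
have idd : is_derive t (1 : R) (fun u : R => u + s) 1.
  rewrite -[X in is_derive _ _ _ X]addr0.
  by apply: is_deriveD.
move=> [fr fi]; split.
  rewrite -[cRe df]mulr1.
  exact: (@is_derive1_comp R (fun u => cRe (f u)) (fun u => u + s)).
rewrite -[cIm df]mulr1.
exact: (@is_derive1_comp R (fun u => cIm (f u)) (fun u => u + s)).
Qed.

Lemma is_derive_abs2 f t df : has_derivative f t df ->
  is_derive t 1 (fun s => abs2 (f s))
    (2 * (cRe (f t) * cRe df + cIm (f t) * cIm df)).
Proof.
move=> [fr fi].
rewrite (_ : (fun _ => _) = (fun s => cRe (f s)) * (fun s => cRe (f s))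
    + (fun s => cIm (f s)) * (fun s => cIm (f s))); last first.
  by apply/funext => s; rewrite /abs2 !expr2.
have := is_deriveD (is_deriveM fr fr) (is_deriveM fi fi).
by rewrite /GRing.scale /= => /is_derive_eq; apply; ring.
Qed.

(** Since e <= c e, the function (phi + e) exp (- c t) is nonincreasing for t >= 0. The derivative
    is bounded in absolute value so that reflection covers negative times. *)
Lemma gronwall (phi dphi : R -> R) (c e T : R) : 1 <= c -> 0 <= e ->
  (forall t : R, is_derive t 1 phi (dphi t)) ->
  (forall t, `|t| <= T -> `|dphi t| <= c * phi t + e) ->
  forall t, `|t| <= T -> phi t <= (phi 0 + e) * expR (c * `|t|).
Proof.
move=> c1 e0.
suff main (h dh : R -> R) : (forall t : R, is_derive t 1 h (dh t)) ->
    (forall t, `|t| <= T -> `|dh t| <= c * h t + e) ->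
    forall t, 0 <= t -> t <= T -> h t <= (h 0 + e) * expR (c * t).
  move=> pd pb t tT; have [t0|t0] := leP 0 t.
    by move: tT; rewrite ger0_norm// => tT; exact: (main _ _ pd pb).
  have := main (fun s => phi (- s)) (fun s => - dphi (- s)) _ _ (- t).
  rewrite opprK oppr0 ltr0_norm//; apply.
  - by move=> s; exact: is_derive_compN.
  - by move=> s sT; rewrite normrN pb// normrN.
  - lra.
  - by rewrite -ltr0_norm.
move=> hd hb t t0 tT.
have ed (x : R) : is_derive x 1 (fun s => expR (- c * s)) (- c * expR (- c * x)).
  exact: is_derive_expMr.
have kd (x : R) : is_derive x 1 (fun s => (h s + e) * expR (- c * s))
    ((dh x - c * (h x + e)) * expR (- c * x)).
  have he : is_derive x (1 : R) (fun s => h s + e) (dh x).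
    rewrite -[X in is_derive _ _ _ X]addr0.
    exact: (is_deriveD (hd x) (is_derive_cst e x 1)).
  have := is_deriveM he (ed x).
  by rewrite /GRing.scale /= => /is_derive_eq; apply; ring.
have := derive_le0_nonincreasing t0 (fun x _ => kd x).
rewrite mulr0 expR0 mulr1 => H.
have {}H : (h t + e) * expR (- c * t) <= h 0 + e.
  apply: H => x /andP[x0 xt]; rewrite pmulr_lle0 ?expR_gt0//.
  have xT : `|x| <= T by rewrite ger0_norm// (le_trans xt).
  have := hb x xT; have := ler_norm (dh x).
  have : 0 <= (c - 1) * e by rewrite mulr_ge0// subr_ge0.
  lra.
have : h t + e <= (h 0 + e) * expR (c * t).
  by rewrite -ler_pdivrMr ?expR_gt0// -expRN -mulNr.
lra.
Qed.

End ComplexDerivatives.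

Section EntrywiseContinuity.
Context {R : realType} {T : topologicalType}.

Lemma continuous_cadd (f g : T -> R[i]) (x : T) : {for x, continuous f} ->
  {for x, continuous g} -> {for x, continuous (fun s => f s + g s)}.
Proof. by move=> fc gc; exact: (cvgD fc gc). Qed.

Lemma continuous_csub (f g : T -> R[i]) (x : T) : {for x, continuous f} ->
  {for x, continuous g} -> {for x, continuous (fun s => f s - g s)}.
Proof. by move=> fc gc; exact: (cvgB fc gc). Qed.

Lemma continuous_cmul (f g : T -> R[i]) (x : T) : {for x, continuous f} ->
  {for x, continuous g} -> {for x, continuous (fun s => f s * g s)}.
Proof. by move=> fc gc; exact: (cvgM fc gc). Qed.

Lemma continuous_csum (I : Type) (r : seq I) (h : I -> T -> R[i]) (x : T) :
  (forall i, {for x, continuous (h i)}) ->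
  {for x, continuous (fun s => \sum_(i <- r) h i s)}.
Proof.
move=> hc; elim: r => [|i r IHr].
  rewrite (_ : (fun _ => _) = cst 0); first exact: cvg_cst.
  by apply/funext => s; rewrite big_nil.
rewrite (_ : (fun _ => _) = (fun s => h i s + \sum_(i <- r) h i s)).
  exact: (continuous_cadd (hc i) IHr).
by apply/funext => s; rewrite big_cons.
Qed.

(** Stated for the entries so that matrix products reduce to sums and products in [R[i]]; [cvg_mx]
    converts it into continuity of the matrix function. *)
Definition entrywise_continuous m n (f : T -> 'M[R[i]]_(m, n)) (x : T) : Prop :=
  forall i j, {for x, continuous (fun t => f t i j)}.

Lemma entrywise_mulmx m n p (f : T -> 'M[R[i]]_(m, n)) (g : T -> 'M[R[i]]_(n, p))
    x : entrywise_continuous f x -> entrywise_continuous g x ->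
  entrywise_continuous (fun t => f t *m g t) x.
Proof.
move=> fc gc i j.
have -> : (fun t => (f t *m g t) i j) = (fun t => \sum_k f t i k * g t k j).
  by apply/funext => t; rewrite mxE.
by apply: continuous_csum => k; exact: (continuous_cmul (fc i k) (gc k j)).
Qed.

Lemma entrywiseB m n (f g : T -> 'M[R[i]]_(m, n)) x :
  entrywise_continuous f x -> entrywise_continuous g x ->
  entrywise_continuous (fun t => f t - g t) x.
Proof.
move=> fc gc i j.
have -> : (fun t => (f t - g t) i j) = (fun t => f t i j - g t i j).
  by apply/funext => t; rewrite !mxE.
exact: (continuous_csub (fc i j) (gc i j)).
Qed.

Lemma entrywise_cst m n (A : 'M[R[i]]_(m, n)) x :
  entrywise_continuous (fun=> A) x.
Proof. by move=> i j; exact: cvg_cst. Qed.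

Lemma entrywise_sqnorm m (f : T -> 'cV[R[i]]_m) x :
  entrywise_continuous f x -> {for x, continuous (fun t => sqnorm (f t))}.
Proof.
move=> fc; apply: continuous_bigsum => i.
have fr := continuous_comp (fc i 0) (@Re_continuous R _).
have fi := continuous_comp (fc i 0) (@Im_continuous R _).
exact: (continuousD (continuousM fr fr) (continuousM fi fi)).
Qed.

End EntrywiseContinuity.

Lemma entrywise_comp {R : realType} (S T : topologicalType) m n (h : S -> T)
    (f : T -> 'M[R[i]]_(m, n)) (x : S) : {for x, continuous h} ->
  entrywise_continuous f (h x) -> entrywise_continuous (fun t => f (h t)) x.
Proof. by move=> hc fc i j; exact: (continuous_comp hc (fc i j)). Qed.

(** * Linear systems over a flow *)

Section EnergyEstimate.
Context {R : realType} {m : nat} (L : R).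

Lemma abs_re_conjM_le (x b y : R[i]) : `|cRe b| <= L -> `|cIm b| <= L ->
  `|2 * (cRe x * cRe (b * y) + cIm x * cIm (b * y))| <= 2 * L * (abs2 x + abs2 y).
Proof.
rewrite cReM cImM /abs2; move: (cRe x) (cIm x) (cRe y) (cIm y) => x1 x2 y1 y2.
move: (cRe b) (cIm b) => b1 b2 Hb1 Hb2.
have H (u v w : R) : `|w| <= L -> `|2 * (w * u * v)| <= L * (u ^+ 2 + v ^+ 2).
  move=> wL; rewrite -mulrA mulrCA normrM; apply: ler_pM => //.
  by rewrite ler_norml; have := sqr_ge0 (u - v); have := sqr_ge0 (u + v); nra.
rewrite (_ : 2 * _ = 2 * (b1 * x1 * y1) + 2 * ((- b2) * x1 * y2)
   + 2 * (b1 * x2 * y2) + 2 * (b2 * x2 * y1)); last by ring.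
have := H x1 y1 b1 Hb1; have := H x1 y2 (- b2); rewrite normrN => /(_ Hb2).
have := H x2 y2 b1 Hb1; have := H x2 y1 b2 Hb2.
set e1 := 2 * _; set e2 := 2 * _; set e3 := 2 * _; set e4 := 2 * _.
rewrite !ler_norml => /andP[? ?] /andP[? ?] /andP[? ?] /andP[? ?].
by apply/andP; split; lra.
Qed.

(** The forcing term [r] serves the comparison of two systems; it is 0 for plain growth. Summing 2 L
    (|z_i|^2 + |z_j|^2) over all i and j gives 4 L m, and 2 |z| |r| <= |z|^2 + |r|^2 gives the 1. *)
Lemma energy_derivative (B : R -> 'M[R[i]]_m) (z r : R -> 'cV[R[i]]_m) :
  (forall t i j, `|cRe (B t i j)| <= L) -> (forall t i j, `|cIm (B t i j)| <= L) ->
  (forall t i, has_derivative (fun s => z s i 0) t ((B t *m z t + r t) i 0)) ->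
  exists2 d : R -> R, forall t : R, is_derive t 1 (fun s => sqnorm (z s)) (d t) &
    forall t, `|d t| <= (4 * L * m%:R + 1) * sqnorm (z t) + sqnorm (r t).
Proof.
move=> BR BI zd.
exists (fun t => \sum_i 2 * (cRe (z t i 0) * cRe ((B t *m z t + r t) i 0)
    + cIm (z t i 0) * cIm ((B t *m z t + r t) i 0))) => [t|t].
  by apply: is_derive_bigsum => i; exact: is_derive_abs2.
apply: le_trans (ler_norm_sum _ _ _) _.
have step i : `|2 * (cRe (z t i 0) * cRe ((B t *m z t + r t) i 0)
    + cIm (z t i 0) * cIm ((B t *m z t + r t) i 0))| <=
    \sum_j 2 * L * (abs2 (z t i 0) + abs2 (z t j 0)) +
    (abs2 (z t i 0) + abs2 (r t i 0)).
  rewrite mxE cReD cImD mxE cRe_sum cIm_sum.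
  rewrite (_ : 2 * _ = \sum_j 2 * (cRe (z t i 0) * cRe (B t i j * z t j 0) +
      cIm (z t i 0) * cIm (B t i j * z t j 0)) + 2 * (cRe (z t i 0) * cRe (r t i 0) +
      cIm (z t i 0) * cIm (r t i 0))); last first.
    by rewrite -mulr_sumr big_split/= -!mulr_sumr; ring.
  apply: le_trans (ler_normD _ _) (lerD _ _).
    apply: le_trans (ler_norm_sum _ _ _) (ler_sum _ _) => j _.
    exact: abs_re_conjM_le.
  rewrite /abs2; move: (cRe (z t i 0)) (cIm (z t i 0)) => x1 x2.
  move: (cRe (r t i 0)) (cIm (r t i 0)) => y1 y2.
  have := sqr_ge0 (x1 - y1); have := sqr_ge0 (x1 + y1).
  have := sqr_ge0 (x2 - y2); have := sqr_ge0 (x2 + y2).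
  by rewrite ler_norml => *; apply/andP; split; nra.
apply: le_trans (ler_sum _ (fun i _ => step i)) _.
have dsum : \sum_i \sum_j 2 * L * (abs2 (z t i 0) + abs2 (z t j 0)) =
    4 * L * m%:R * sqnorm (z t).
  under eq_bigr => i _.
    rewrite -mulr_sumr big_split/= sumr_const card_ord -[X in _ + X]/(sqnorm (z t)).
    rewrite -(mulr_natl _ m); over.
  rewrite -mulr_sumr big_split/= sumr_const card_ord -mulr_sumr.
  by rewrite -[X in _ * X + _]/(sqnorm (z t)) -(mulr_natl (sqnorm _) m); ring.
have -> : (4 * L * m%:R + 1) * sqnorm (z t) + sqnorm (r t) = 4 * L * m%:R * sqnorm (z t) + (sqnorm (z t) + sqnorm (r t)) by ring.
by rewrite big_split/= dsum big_split.
Qed.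

End EnergyEstimate.

Section LinearSystems.
Context {R : realType} {Omega : topologicalType} (sigma : R -> Omega -> Omega).
Hypothesis flow : continuous_flow sigma.
Context {m : nat} (A : Omega -> 'M[R[i]]_m) (L : R).
Hypothesis Acont : forall w, entrywise_continuous A w.
Hypothesis ARe : forall w i j, `|cRe (A w i j)| <= L.
Hypothesis AIm : forall w i j, `|cIm (A w i j)| <= L.
Hypothesis L0 : 0 <= L.

Let c := 4 * L * m%:R + 1.

Let c1 : 1 <= c.
Proof. by rewrite lerDr mulr_ge0// mulr_ge0. Qed.

Lemma flow_orbit_continuous w : continuous (sigma^~ w).
Proof.
case: flow => sc _ _ t.
apply: (@continuous_comp _ _ _ (fun t => (t, w)) (fun p => sigma p.1 p.2)).
  exact: (cvg_pair (@cvg_id _ (nbhs t)) (@cvg_cst _ w _ (nbhs t) _)).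
exact: sc.
Qed.

Lemma solves_col p w (Z : R -> 'M[R[i]]_(m, p)) :
  solves sigma A w Z <-> forall j, solves sigma A w (fun t => col j (Z t)).
Proof.
have E j t i k : has_derivative (fun s => col j (Z s) i k) t
      ((A (sigma t w) *m col j (Z t)) i k) =
    has_derivative (fun s => Z s i j) t ((A (sigma t w) *m Z t) i j).
  congr has_derivative; first by apply/funext => s; rewrite mxE.
  by rewrite !mxE; apply: eq_bigr => l _; rewrite mxE.
split=> [Zs j t i k|Zs t i j]; first by rewrite E; exact: Zs.
by rewrite -(E j t i 0); exact: Zs.
Qed.

Lemma solvesB p w (Y Z : R -> 'M[R[i]]_(m, p)) : solves sigma A w Y ->
  solves sigma A w Z -> solves sigma A w (fun t => Y t - Z t).
Proof.
move=> Ys Zs t i j; rewrite mulmxBr mxE [X in _ + X]mxE.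
rewrite (_ : (fun _ => _) = (fun s => Y s i j - Z s i j)); last first.
  by apply/funext => s; rewrite !mxE.
exact: (has_derivativeB (Ys t i j) (Zs t i j)).
Qed.

Lemma solves_mulmxr p q w (Z : R -> 'M[R[i]]_(m, p)) (C : 'M[R[i]]_(p, q)) :
  solves sigma A w Z -> solves sigma A w (fun t => Z t *m C).
Proof.
move=> Zs t i j; rewrite mulmxA mxE.
rewrite (_ : (fun _ => _) = (fun s => \sum_k C k j * Z s i k)); last first.
  by apply/funext => s; rewrite mxE; apply: eq_bigr => k _; rewrite mulrC.
apply: has_derivative_sum => k; rewrite mulrC.
exact: (has_derivativeZ (C k j) (Zs t i k)).
Qed.

Lemma solves_shift p w (Z : R -> 'M[R[i]]_(m, p)) s : solves sigma A w Z ->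
  solves sigma A (sigma s w) (fun t => Z (t + s)).
Proof.
case: flow => _ _ sD Zs t i j; rewrite -sD.
exact: (@has_derivative_comp_shift R (fun u => Z u i j)).
Qed.

Lemma solution_growth w (z : R -> 'cV[R[i]]_m) : solves sigma A w z ->
  forall t, sqnorm (z t) <= sqnorm (z 0) * expR (c * `|t|).
Proof.
move=> zs t.
have [|||d dd db] := @energy_derivative R m L (fun t => A (sigma t w)) z (fun=> 0).
- by [].
- by [].
- by move=> s i; rewrite addr0; exact: zs.
have := gronwall c1 (lexx 0) dd (T := `|t|) _ (t := t) _.
rewrite addr0; apply => // s _; apply: le_trans (db s) _.
rewrite lerD// /sqnorm big1// => i _.
by rewrite mxE /abs2/= expr0n/= addr0.
Qed.

Lemma sqnorm_eq0 (z : 'cV[R[i]]_m) : sqnorm z = 0 -> z = 0.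
Proof.
move/eqP; rewrite psumr_eq0 => [/allP z0|i _]; last exact: abs2_ge0.
apply/matrixP => i j; rewrite ord1 mxE.
by apply: abs2_eq0; apply/eqP; apply: z0; rewrite mem_index_enum.
Qed.

Lemma solution_unique p w (Y Z : R -> 'M[R[i]]_(m, p)) : solves sigma A w Y ->
  solves sigma A w Z -> Y 0 = Z 0 -> forall t, Y t = Z t.
Proof.
move=> Ys Zs YZ0 t; apply/eqP; rewrite -subr_eq0; apply/eqP/matrixP => i j.
have /solves_col/(_ j)/solution_growth/(_ t) := solvesB Ys Zs.
have -> : sqnorm (col j (Y 0 - Z 0)) = 0.
  rewrite YZ0 subrr /sqnorm big1// => k _.
  by rewrite !mxE /abs2/= expr0n/= addr0.
rewrite mul0r => H; have : sqnorm (col j (Y t - Z t)) = 0.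
  by apply/eqP; rewrite eq_le H sqnorm_ge0.
by move/sqnorm_eq0/matrixP/(_ i 0); rewrite !mxE.
Qed.

Lemma fundamental_matrix_exists : exists U, fundamental_matrix sigma A U.
Proof.
suff /choice[U HU] : forall w, exists V : R -> 'M[R[i]]_m,
    V 0 = 1%:M /\ solves sigma A w V.
  by exists (fun t w => U w t) => w; exact: HU.
move=> w.
suff /choice[V HV] : forall j : 'I_m, exists v : R -> 'cV[R[i]]_m,
    v 0 = col j 1%:M /\ solves sigma A w v.
  exists (fun t => \matrix_(i, j) V j t i 0); split.
    by apply/matrixP => i j; rewrite mxE (HV j).1 mxE.
  apply/solves_col => j.
  rewrite (_ : (fun _ => _) = V j); first exact: (HV j).2.
  by apply/funext => t; apply/matrixP => i k; rewrite !mxE ord1.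
move=> j.
(* The real form of the complex system: [inl] indexes real parts, [inr] imaginary parts. *)
pose a (t : R) (p q : 'I_m + 'I_m) : R :=
  match p, q with
  | inl i, inl k => cRe (A (sigma t w) i k)
  | inl i, inr k => - cIm (A (sigma t w) i k)
  | inr i, inl k => cIm (A (sigma t w) i k)
  | inr i, inr k => cRe (A (sigma t w) i k)
  end.
have orbc i k : continuous (fun t => A (sigma t w) i k).
  move=> t; exact: (continuous_comp (@flow_orbit_continuous w t) (@Acont (sigma t w) i k)).
have orbR i k : continuous (fun t => cRe (A (sigma t w) i k)).
  move=> t; exact: (continuous_comp (@orbc i k t) (@Re_continuous R _)).
have orbI i k : continuous (fun t => cIm (A (sigma t w) i k)).
  move=> t; exact: (continuous_comp (@orbc i k t) (@Im_continuous R _)).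
have [||x [x0 xd]] := @linear_ode_exists R _ a L
    (fun p => match p with inl i => (i == j)%:R | inr _ => 0 end).
- case=> [i|i] [k|k] t; [exact: orbR| |exact: orbI|exact: orbR].
  exact: (continuousN (@orbI i k t)).
- by move=> t [i|i] [k|k]; rewrite /= ?normrN.
exists (fun t => \col_i (x t (inl i) +i* x t (inr i))%C); split.
  apply/matrixP => i k; rewrite !mxE !x0.
  by case: (i == j).
move=> t i k; under eq_fun do rewrite mxE.
split => /=; rewrite mxE ?cRe_sum ?cIm_sum.
  have := xd t (inl i); rewrite big_sumType/= => /is_derive_eq; apply.
  rewrite -big_split/=; apply: eq_bigr => l _.
  by rewrite mxE cReM/= mulNr.
have := xd t (inr i); rewrite big_sumType/= => /is_derive_eq; apply.
rewrite -big_split/=; apply: eq_bigr => l _.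
by rewrite mxE cImM/= addrC.
Qed.

Section Fundamental.
Context (U : R -> Omega -> 'M[R[i]]_m).
Hypothesis fundU : fundamental_matrix sigma A U.

Lemma fundamental_solution w (z : 'cV[R[i]]_m) :
  solves sigma A w (fun t => U t w *m z).
Proof. by apply: solves_mulmxr; exact: (fundU w).2. Qed.

Lemma solution_fundamental w (z : R -> 'cV[R[i]]_m) : solves sigma A w z ->
  forall t, z t = U t w *m z 0.
Proof.
move=> zs; apply: (solution_unique zs (fundamental_solution w (z 0))).
by rewrite (fundU w).1 mul1mx.
Qed.

Lemma cocycle s t w : U (t + s) w = U t (sigma s w) *m U s w.
Proof.
have H := solves_shift s (fundU w).2.
apply: (solution_unique H (solves_mulmxr _ (fundU (sigma s w)).2)).
by rewrite add0r (fundU _).1 mul1mx.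
Qed.

Lemma fundamental_growth t w z :
  sqnorm (U t w *m z) <= sqnorm z * expR (c * `|t|).
Proof.
by have := solution_growth (fundamental_solution w z) t; rewrite (fundU w).1 mul1mx.
Qed.

Lemma solution_continuous w (z : R -> 'cV[R[i]]_m) t : solves sigma A w z ->
  entrywise_continuous z t.
Proof.
move=> zs i j; have [zr zi] := zs t i j.
by apply: cvg_complex; [exact: is_derive_continuous zr|exact: is_derive_continuous zi].
Qed.

(** The difference [D] of the solutions over w' and w solves the system of w' with forcing (A (sigma
    s w') - A (sigma s w)) z(s). By compactness of [-|t|, |t|] the forcing is uniformly small for w'
    near w, and Gronwall's inequality makes [D] small. *)
Lemma fundamental_continuous t w : entrywise_continuous (U t) w.
Proof.
move=> i j.
pose z s := U s w *m col j 1%:M.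
have zs : solves sigma A w z := fundamental_solution _ _.
pose D w' s := U s w' *m col j 1%:M - z s.
pose r w' s := (A (sigma s w') - A (sigma s w)) *m z s.
have Dsmall (e : R) : 0 < e -> \forall w' \near w, sqnorm (D w' t) <= e.
  move=> e0.
  pose e' := e / expR (c * `|t|).
  have e'0 : 0 < e' by rewrite divr_gt0// expR_gt0.
  have : \forall w' \near w, `[- `|t|, `|t|] `<=` [set s | sqnorm (r w' s) < e'].
    have /compact_near_coveringP := @segment_compact R (- `|t|) `|t|.
    move=> /(_ _ (nbhs w) (fun w' s => sqnorm (r w' s) < e') _); apply => s _.
    have [sc _ _] := flow.
    pose f (p : R * Omega) := (A (sigma p.1 p.2) - A (sigma p.1 w)) *m z p.1.
    have fc : entrywise_continuous f (s, w).
      have zc : entrywise_continuous (fun p : R * Omega => z p.1) (s, w).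
        exact: (@entrywise_comp R (R * Omega)%type _ _ _ fst z _ cvg_fst
          (solution_continuous zs)).
      have Ac1 : entrywise_continuous (fun p : R * Omega => A (sigma p.1 p.2)) (s, w).
        exact: (@entrywise_comp R (R * Omega)%type _ _ _
          (fun p : R * Omega => sigma p.1 p.2) A _ (@sc (s, w)) (@Acont _)).
      have orb : {for (s, w), continuous (fun p : R * Omega => sigma p.1 w)}.
        apply: (@continuous_comp _ _ _ (@fst R Omega) (sigma^~ w)).
          exact: cvg_fst.
        exact: (@flow_orbit_continuous w s).
      have Ac2 : entrywise_continuous (fun p : R * Omega => A (sigma p.1 w)) (s, w).
        exact: (@entrywise_comp R (R * Omega)%type _ _ _
          (fun p : R * Omega => sigma p.1 w) A _ orb (@Acont _)).
      exact: (entrywise_mulmx (entrywiseB Ac1 Ac2) zc).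
    have := entrywise_sqnorm fc => /cvgr_lt; apply.
    rewrite /f/= subrr mul0mx /sqnorm big1// => k _.
    by rewrite mxE /abs2/= expr0n/= addr0.
  apply: filterS => w' Hw'.
  have [|||d dd db] := @energy_derivative R m L (fun t => A (sigma t w'))
      (D w') (r w').
  - by [].
  - by [].
  - move=> s k.
    have -> : A (sigma s w') *m D w' s + r w' s =
        A (sigma s w') *m (U s w' *m col j 1%:M) - A (sigma s w) *m z s.
      by rewrite /D /r mulmxBr mulmxBl addrA subrK.
    rewrite mxE [X in _ + X]mxE; under eq_fun do rewrite !mxE.
    by apply: has_derivativeB; [have := fundamental_solution w' (col j 1%:M) s k 0|
      have := zs s k 0]; rewrite /z; under eq_fun do rewrite mxE.
  have D0 : sqnorm (D w' 0) = 0.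
    rewrite /D /z !(fundU _).1 subrr /sqnorm big1// => k _.
    by rewrite mxE /abs2/= expr0n/= addr0.
  have grow x : sqnorm (D w' 0) = x -> sqnorm (D w' t) <= (x + e') * expR (c * `|t|).
    move=> <-; apply: (gronwall c1 (ltW e'0) dd (T := `|t|)) => // s sT.
    apply: le_trans (db s) _; rewrite lerD2l ltW//; apply: Hw'.
    by rewrite /= in_itv/= -ler_norml.
  by move: (grow 0 D0); rewrite add0r /e' divfK// gt_eqF// expR_gt0.
have DE w' s : D w' s i 0 = U s w' i j - U s w i j.
  by rewrite /D /z !colE mul1mx -!colE !mxE.
have near_e (e : R) : 0 < e -> \forall w' \near w, abs2 (U t w' i j - U t w i j) < e ^+ 2.
  move=> e0; have : 0 < e ^+ 2 / 2 by rewrite divr_gt0// exprn_gt0.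
  move=> /Dsmall; apply: filterS => w' H; rewrite -DE.
  have : abs2 (D w' t i 0) <= sqnorm (D w' t).
    rewrite /sqnorm (bigD1 i)//= lerDl.
    by apply: sumr_ge0 => k _; exact: abs2_ge0.
  by have := exprn_gt0 2 e0; lra.
apply: (@cvg_complex R _ (nbhs w)); apply/(@cvgrPdist_lt _ _ _ (nbhs w)) => e e0;
  apply: filterS (near_e e e0) => w';
  rewrite /abs2 cReB cImB => H;
  rewrite distrC -sqrtr_sqr -(ger0_norm (ltW e0)) -(sqrtr_sqr e);
  rewrite ltr_sqrt ?exprn_gt0//; apply: le_lt_trans H;
  by rewrite ?lerDl ?lerDr sqr_ge0.
Qed.

End Fundamental.
End LinearSystems.

(** * Cocycles with a monotone flux *)

Section SqnormAlgebra.
Context {R : realType}.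

Lemma sqnorm0 m : sqnorm (0 : 'cV[R[i]]_m) = 0.
Proof. by rewrite /sqnorm big1// => i _; rewrite mxE /abs2/= expr0n/= addr0. Qed.

Lemma sqnormZ m (k : R[i]) (z : 'cV[R[i]]_m) : sqnorm (k *: z) = abs2 k * sqnorm z.
Proof. by rewrite /sqnorm mulr_sumr; apply: eq_bigr => i _; rewrite mxE abs2M. Qed.

Lemma sqnormD_le m (y z : 'cV[R[i]]_m) :
  sqnorm (y + z) <= 2 * sqnorm y + 2 * sqnorm z.
Proof.
rewrite /sqnorm !mulr_sumr -big_split/=; apply: ler_sum => i _.
rewrite mxE /abs2 cReD cImD.
have := sqr_ge0 (cRe (y i 0) - cRe (z i 0)).
have := sqr_ge0 (cIm (y i 0) - cIm (z i 0)).
nra.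
Qed.

Lemma sqnorm_gt0 m (z : 'cV[R[i]]_m) : (0 < sqnorm z) = (z != 0).
Proof.
rewrite lt0r sqnorm_ge0 andbT; congr (~~ _).
by apply/eqP/eqP => [|->]; [exact: sqnorm_eq0 | exact: sqnorm0].
Qed.

Lemma sqnorm_split m n (z : 'cV[R[i]]_(m + n)) :
  sqnorm z = sqnorm (usubmx z) + sqnorm (dsubmx z).
Proof.
rewrite /sqnorm big_split_ord/=; congr (_ + _);
by apply: eq_bigr => i _; rewrite mxE.
Qed.

Lemma abs2_real (a : R) : abs2 a%:C%C = a ^+ 2.
Proof. by rewrite /abs2/= expr0n/= addr0. Qed.

Definition flux n (z : 'cV[R[i]]_(n + n)) : R :=
  \sum_i cIm (conjc (usubmx z i 0) * dsubmx z i 0).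

Lemma abs_flux_le n (z : 'cV[R[i]]_(n + n)) : `|flux z| <= sqnorm z.
Proof.
apply: le_trans (ler_norm_sum _ _ _) _.
rewrite sqnorm_split /sqnorm -big_split/=; apply: ler_sum => i _.
rewrite cImM cReJ cImJ /abs2.
move: (cRe _) (cIm _) (cRe _) (cIm _) => a b c d.
rewrite ler_norml; have := sqr_ge0 (a - d); have := sqr_ge0 (a + d).
have := sqr_ge0 (b - c); have := sqr_ge0 (b + c).
have := sqr_ge0 a; have := sqr_ge0 b; have := sqr_ge0 c; have := sqr_ge0 d.
by move=> *; apply/andP; split; nra.
Qed.

Lemma unitmx_of_injective n (B : 'M[R[i]]_n) :
  (forall y : 'cV_n, B *m y = 0 -> y = 0) -> B \in unitmx.
Proof.
move=> Binj; rewrite -unitmx_tr -row_free_unit -kermx_eq0.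
apply/eqP/row_matrixP => i; rewrite row0.
apply: trmx_inj; rewrite trmx0; apply: Binj.
by apply: trmx_inj; rewrite trmx_mul trmxK trmx0 -row_mul mulmx_ker row0.
Qed.

Lemma flux_continuous (T : topologicalType) n (f : T -> 'cV[R[i]]_(n + n)) x :
  entrywise_continuous f x -> {for x, continuous (fun t => flux (f t))}.
Proof.
move=> fc; apply: continuous_bigsum => i.
have -> : (fun t => cIm (conjc (usubmx (f t) i 0) * dsubmx (f t) i 0)) =
  (fun t => cRe (f t (lshift n i) 0) * cIm (f t (rshift n i) 0) -
     cIm (f t (lshift n i) 0) * cRe (f t (rshift n i) 0)).
  by apply/funext => t; rewrite cImM cReJ cImJ !mxE mulNr.
have lr := continuous_comp (fc (lshift n i) 0) (@Re_continuous R _).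
have li := continuous_comp (fc (lshift n i) 0) (@Im_continuous R _).
have rr := continuous_comp (fc (rshift n i) 0) (@Re_continuous R _).
have ri := continuous_comp (fc (rshift n i) 0) (@Im_continuous R _).
exact: (continuousB (continuousM lr ri) (continuousM li rr)).
Qed.

End SqnormAlgebra.

(* Replaces the maximum of [y], which need not be attained: a point with [y t > D]
   can be traded for one with a four times larger value. *)
Lemma quarter_iteration {R : realType} (I : R -> Prop) (y : R -> R) (D K : R) :
  0 <= D -> (forall t, I t -> y t <= K) ->
  (forall t, I t -> y t <= D \/ exists2 u, I u & 4 * y t <= y u) ->
  forall t, I t -> y t <= D.
Proof.
move=> D0 yK step.
have iter k : forall t, I t -> y t <= D + `|K| / 2 ^+ k.
  elim: k => [t It|k IH t It].
    by rewrite expr0 divr1; have := yK t It; have := ler_norm K; lra.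
  have Kk : 0 <= `|K| / 2 ^+ k by rewrite divr_ge0// exprn_ge0.
  have -> : `|K| / 2 ^+ k.+1 = `|K| / 2 ^+ k / 2.
    by rewrite exprS; field.
  by have [|[u Iu yu]] := step t It; [lra|have := IH u Iu; lra].
move=> t It; apply/ler_addgt0Pr => e e0.
have e1 : 0 < e / (`|K| + 1) by rewrite divr_gt0// ltr_wpDl.
have [k /=] := filter_ex (near_infty_natSinv_expn_lt (PosNum e1)).
rewrite ltr_pdivlMr; last by rewrite ltr_wpDl.
move=> H; apply: le_trans (iter k t It) _; rewrite lerD2l.
have : 0 <= (2 ^+ k)^-1 :> R by rewrite invr_ge0 exprn_ge0.
by have := normr_ge0 K; lra.
Qed.

Lemma near_dist_lt {R : realType} (T : topologicalType) (f : T -> R) (x : T)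
    (e : R) : {for x, continuous f} -> 0 < e ->
  \forall y \near x, `|f x - f y| < e.
Proof. by move=> fc e0; move/cvgrPdist_lt: fc; exact. Qed.

(** Near +oo both values lie within d of the infimum, near -oo within d of the supremum. *)
Lemma nonincreasing_settles {R : realType} (phi : R -> R) (K : R) :
  (forall t u, t <= u -> phi u <= phi t) -> (forall t, `|phi t| <= K) ->
  forall s d, 0 < d ->
  (\forall t \near +oo, `|phi (t + s) - phi t| < d) /\
  (\forall t \near -oo, `|phi (t + s) - phi t| < d).
Proof.
move=> mono phiK s d d0.
have rng0 : range phi !=set0 by exists (phi 0); exists 0.
have lb : has_lbound (range phi).
  by exists (- K) => _ [t _ <-]; have := phiK t; rewrite ler_norml => /andP[].
have ub : has_ubound (range phi).
  by exists K => _ [t _ <-]; have := phiK t; rewrite ler_norml => /andP[].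
have [_ [t0 _ <-] t0d] := inf_adherent d0 (conj rng0 lb).
have [_ [t1 _ <-] t1d] := sup_adherent d0 (conj rng0 ub).
have inf_le t : inf (range phi) <= phi t by apply: ge_inf => //; exists t.
have le_sup t : phi t <= sup (range phi) by apply: ub_le_sup => //; exists t.
split.
  near=> t.
  have h1 : phi t <= phi t0 by apply: mono; near: t; exact: (nbhs_pinfty_ge (num_real _)).
  have h2 : phi (t + s) <= phi t0.
    apply: mono; rewrite -lerBlDr; near: t; exact: (nbhs_pinfty_ge (num_real _)).
  have := inf_le t; have := inf_le (t + s).
  by rewrite ltr_norml => *; apply/andP; split; lra.
near=> t.
have h1 : phi t1 <= phi t by apply: mono; near: t; exact: (nbhs_ninfty_le (num_real _)).
have h2 : phi t1 <= phi (t + s).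
  apply: mono; rewrite -lerBrDr; near: t; exact: (nbhs_ninfty_le (num_real _)).
have := le_sup t; have := le_sup (t + s).
by rewrite ltr_norml => *; apply/andP; split; lra.
Unshelve. all: by end_near. Qed.

Lemma mulmx_sum_cols (K : comPzRingType) m p (Y : 'M[K]_(m, p)) (a : 'cV[K]_p) :
  Y *m a = \sum_j a j 0 *: col j Y.
Proof.
apply/matrixP => i k; rewrite ord1 mxE summxE; apply: eq_bigr => j _.
by rewrite !mxE mulrC.
Qed.

Lemma norm_sign {R : realType} (s : R) : s ^+ 2 = 1 -> `|s| = 1.
Proof.
move=> s2; have : `|s| ^+ 2 = 1 by rewrite real_normK ?num_real.
by move/eqP; rewrite sqrp_eq1// => /eqP.
Qed.

Lemma norm_between {R : realType} (a b x e : R) : x <= a -> b <= x ->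
  `|a| < e -> `|b| < e -> `|x| <= e.
Proof.
move=> ? ?; rewrite !ltr_norml ler_norml => /andP[? ?] /andP[? ?].
by apply/andP; split; lra.
Qed.

Lemma addr_eq_sub_opp (V : zmodType) (p q a b : V) :
  p + q = a + b <-> q - b = - (p - a).
Proof.
have E : p + q - (a + b) = q - b + (p - a) by rewrite opprD addrACA addrC.
split=> /eqP; first by rewrite -subr_eq0 E addr_eq0 => /eqP.
by rewrite -addr_eq0 -E subr_eq0 => /eqP.
Qed.

(** * Bounded orbits, uniform decay, and the graph of the forward bounded vectors *)

Section Cocycle.
Context {R : realType} {Omega : topologicalType} (sigma : R -> Omega -> Omega).
Context {n : nat} (U : R -> Omega -> 'M[R[i]]_(n + n)) (c : R) (sg : R).
(* [sg] is the sign of Im l. Reversing time yields another such cocycle, with the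
   opposite [sg], so each statement about the future also covers the past. *)
Hypothesis Omega_compact : compact [set: Omega].
Hypothesis U0 : forall w, U 0 w = 1%:M.
Hypothesis UD : forall t s w, U (t + s) w = U t (sigma s w) *m U s w.
Hypothesis Ucont : forall t w, entrywise_continuous (U t) w.
Hypothesis Ugrowth : forall t w z,
  sqnorm (U t w *m z) <= sqnorm z * expR (c * `|t|).
Hypothesis c0 : 0 <= c.
Hypothesis sg2 : sg ^+ 2 = 1.
Hypothesis flux_mono : forall t w z, 0 <= t ->
  sg * flux (U t w *m z) <= sg * flux z.
Hypothesis flux_rigid : forall w z,
  (forall t, 0 <= t -> flux (U t w *m z) = flux z) -> dsubmx z = 0.
Hypothesis no_special : forall w z K, (forall t, sqnorm (U t w *m z) <= K) ->
  (forall t, dsubmx (U t w *m z) = 0) -> z = 0.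

Lemma cocycle_inv t w : U (- t) (sigma t w) *m U t w = 1%:M.
Proof. by rewrite -UD addNr U0. Qed.

Lemma cocycle_cont t (p : Omega * 'cV[R[i]]_(n + n)) :
  entrywise_continuous (fun q : Omega * 'cV[R[i]]_(n + n) => U t q.1 *m q.2) p.
Proof.
have Uc : entrywise_continuous (fun q : Omega * 'cV[R[i]]_(n + n) => U t q.1) p.
  exact: (@entrywise_comp R (Omega * 'cV[R[i]]_(n + n))%type _ _ _ fst _ _ cvg_fst
    (@Ucont t p.1)).
have zc : entrywise_continuous (fun q : Omega * 'cV[R[i]]_(n + n) => q.2) p.
  move=> i j.
  apply: (@continuous_comp _ _ _ (@snd Omega 'cV[R[i]]_(n + n)) (fun z => z i j)).
    exact: cvg_snd.
  exact: coord_continuous.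
exact: (entrywise_mulmx Uc zc).
Qed.

Lemma sqnorm_cocycle_cont t (p : Omega * 'cV[R[i]]_(n + n)) :
  {for p, continuous (fun q : Omega * 'cV[R[i]]_(n + n) => sqnorm (U t q.1 *m q.2))}.
Proof. exact: (entrywise_sqnorm (@cocycle_cont t p)). Qed.

Lemma flux_cocycle_cont t (p : Omega * 'cV[R[i]]_(n + n)) :
  {for p, continuous (fun q : Omega * 'cV[R[i]]_(n + n) => flux (U t q.1 *m q.2))}.
Proof. exact: (flux_continuous (@cocycle_cont t p)). Qed.

Lemma compact_shell (a b : R) :
  compact ([set: Omega] `*` [set z : 'cV[R[i]]_(n + n) | a <= sqnorm z <= b]).
Proof.
apply: compact_setX Omega_compact _.
apply: (subclosed_compact _ (@compact_sqnorm_le R (n + n) b)).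
  rewrite (_ : mkset _ = @sqnorm R (n + n) @^-1` [set x | a <= x] `&`
      @sqnorm R (n + n) @^-1` [set x | x <= b]); last first.
    by apply/seteqP; split => z /=; [move=> /andP[]|move=> [-> ->]].
  by apply: closedI; apply: closed_comp; try (by move=> z _; exact: sqnorm_continuous);
    [exact: closed_ge | exact: closed_le].
by move=> z /= /andP[].
Qed.

Lemma flux_orbit_mono w z t u : t <= u ->
  sg * flux (U u w *m z) <= sg * flux (U t w *m z).
Proof.
move=> tu; rewrite -(subrK t u) UD -mulmxA; apply: flux_mono.
by rewrite subr_ge0.
Qed.

(* [F] is a neighbourhood filter of an end of the line. At any limit point of the
   orbit the flux is constant in time, so by rigidity the limit point is a special
   solution; a limit point of size at least [e] is thereby excluded. *)
Lemma bounded_orbit_vanishes (F : set_system R) w z K : ProperFilter F ->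
  (forall t, sqnorm (U t w *m z) <= K) ->
  (forall s d, 0 < d -> \forall t \near F,
     `|flux (U (t + s) w *m z) - flux (U t w *m z)| < d) ->
  forall e, 0 < e -> \forall t \near F, sqnorm (U t w *m z) < e.
Proof.
move=> FF zK asym e e0.
pose K0 := [set: Omega] `*` [set y : 'cV[R[i]]_(n + n) | e <= sqnorm y <= K].
have /compact_near_coveringP := @compact_shell e K.
move=> /(_ _ F (fun t q => q <> (sigma t w, U t w *m z)) _) H.
(* It is enough that near each point of the shell, and for t near the end of the line, the orbit
   does not pass; compactness merges these neighbourhoods. A point is avoided in this sense once its
   own orbit exceeds [K] or changes its flux. *)
have : \forall t \near F, K0 `<=` (fun q => q <> (sigma t w, U t w *m z)).
  apply: H => -[w' z'] [_ /= /andP[ez' _]].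
  have [s [Hs|Hs]] : exists s, K < sqnorm (U s w' *m z') \/
      flux (U s w' *m z') <> flux z'.
    apply: contrapT => nex.
    have z'K s : sqnorm (U s w' *m z') <= K.
      by rewrite leNgt; apply/negP => Ks; apply: nex; exists s; left.
    have z'f s : flux (U s w' *m z') = flux z'.
      by apply: contrapT => nf; apply: nex; exists s; right.
    have z'0 : z' = 0.
      apply: (no_special z'K) => t; apply: (@flux_rigid (sigma t w')) => s s0.
      by rewrite mulmxA -UD !z'f.
    by move: ez'; rewrite z'0 sqnorm0 leNgt e0.
  - have nb : \forall q \near (w', z'), K < sqnorm (U s q.1 *m q.2).
      exact: (cvgr_gt _ (@sqnorm_cocycle_cont s (w', z')) _ Hs).
    exists ([set q | K < sqnorm (U s q.1 *m q.2)], setT).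
      by split; [exact: nb | exact: filterT].
    move=> [q t] [/= Kq _] qE; move: Kq.
    by rewrite qE /= mulmxA -UD ltNge zK.
  - pose d := `|flux (U s w' *m z') - flux z'|.
    have d0 : 0 < d by rewrite normr_gt0 subr_eq0; apply/eqP.
    have d3 : 0 < d / 3 by rewrite divr_gt0.
    have f1 : \forall q \near (w', z'),
        `|flux (U s w' *m z') - flux (U s q.1 *m q.2)| < d / 3.
      exact: (near_dist_lt (@flux_cocycle_cont s (w', z')) d3).
    (* [U 0] is the identity, inserted so that continuity of the flux itself is an instance of
       [flux_cocycle_cont]. *)
    have f2 : \forall q \near (w', z'),
        `|flux (U 0 w' *m z') - flux (U 0 q.1 *m q.2)| < d / 3.
      exact: (near_dist_lt (@flux_cocycle_cont 0 (w', z')) d3).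
    have f3 : \forall t \near F, `|flux (U (t + s) w *m z) - flux (U t w *m z)| < d / 3.
      exact: asym d3.
    exists ([set q | `|flux (U s w' *m z') - flux (U s q.1 *m q.2)| < d / 3 /\
                     `|flux (U 0 w' *m z') - flux (U 0 q.1 *m q.2)| < d / 3],
            [set t | `|flux (U (t + s) w *m z) - flux (U t w *m z)| < d / 3]).
      by split; [exact: filterI f1 f2 | exact: f3].
    move=> [q t] [/= [h1 h2] h3] qE.
    move: h1 h2; rewrite qE /= !U0 !mul1mx mulmxA -UD (addrC s t) => h1 h2.
    move: d0 h1 h2 h3; rewrite /d.
    move: (flux (U s w' *m z')) (flux z') (flux (U (t + s) w *m z)) => a b x.
    move: (flux (U t w *m z)) => y.
    rewrite (_ : a - b = (a - x) + (x - y) - (b - y)); last by ring.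
    have := ler_normB ((a - x) + (x - y)) (b - y); have := ler_normD (a - x) (x - y).
    by lra.
apply: filterS => t Ht; rewrite ltNge; apply/negP => ez.
apply: (Ht (sigma t w, U t w *m z)) => //.
by split => //=; rewrite ez zK.
Qed.

Lemma norm_sg (x : R) : `|sg * x| = `|x|.
Proof. by rewrite normrM (norm_sign sg2) mul1r. Qed.

Lemma no_bounded_orbit w z K : (forall t, sqnorm (U t w *m z) <= K) -> z = 0.
Proof.
move=> zK.
pose phi t := sg * flux (U t w *m z).
have mono t u : t <= u -> phi u <= phi t by exact: flux_orbit_mono.
have phi_le t : `|phi t| <= sqnorm (U t w *m z).
  by rewrite /phi norm_sg abs_flux_le.
have phiK t : `|phi t| <= K := le_trans (phi_le t) (zK t).
have settle s d (d0 : 0 < d) := nonincreasing_settles mono phiK s d0.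
have phiE t s : `|phi (t + s) - phi t| =
    `|flux (U (t + s) w *m z) - flux (U t w *m z)|.
  by rewrite /phi -mulrBr norm_sg.
have van1 e : 0 < e -> \forall t \near +oo, sqnorm (U t w *m z) < e.
  apply: (@bounded_orbit_vanishes _ w z K _ zK) => s d d0.
  by have [H _] := settle s d d0; apply: filterS H => t; rewrite phiE.
have van2 e : 0 < e -> \forall t \near -oo, sqnorm (U t w *m z) < e.
  apply: (@bounded_orbit_vanishes _ w z K _ zK) => s d d0.
  by have [_ H] := settle s d d0; apply: filterS H => t; rewrite phiE.
have phi0 t : phi t = 0.
  apply/eqP; rewrite -normr_le0; apply/ler_addgt0Pr => e e0; rewrite add0r.
  have [u [tu ue]] : exists u, t <= u /\ sqnorm (U u w *m z) < e.
    exact: filter_ex (filterI (nbhs_pinfty_ge (num_real t)) (van1 e e0)).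
  have [v [vt ve]] : exists v, v <= t /\ sqnorm (U v w *m z) < e.
    exact: filter_ex (filterI (nbhs_ninfty_le (num_real t)) (van2 e e0)).
  have := le_lt_trans (phi_le u) ue; have := le_lt_trans (phi_le v) ve.
  have := mono _ _ tu; have := mono _ _ vt.
  exact: norm_between.
have flux0 t : flux (U t w *m z) = 0.
  by apply/eqP; rewrite -normr_eq0 -norm_sg -/(phi t) phi0 normr0.
apply: (no_special zK) => t; apply: (@flux_rigid (sigma t w)) => s s0.
by rewrite mulmxA -UD !flux0.
Qed.

(** The factor 4 is a doubling of the norm. On the unit sphere a strict excess at one instant
    persists for nearby data, and homogeneity carries the common [T] to all vectors. *)
Lemma uniform_expansion : exists2 T : R, 0 < T & forall w z,
  exists2 t, `|t| <= T & 4 * sqnorm z <= sqnorm (U t w *m z).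
Proof.
have /compact_near_coveringP := @compact_shell 1 1.
move=> /(_ _ (pinfty_nbhs R) (fun T q => exists2 t : R, `|t| <= T &
    4 < sqnorm (U t q.1 *m q.2)) _) H.
have : \forall T \near +oo, ([set: Omega] `*`
    [set y : 'cV[R[i]]_(n + n) | 1 <= sqnorm y <= 1]) `<=`
    [set q | exists2 t : R, `|t| <= T & 4 < sqnorm (U t q.1 *m q.2)].
  apply: H => -[w z] [_ /= z1].
  have [t Ht] : exists t, 4 < sqnorm (U t w *m z).
    apply: contrapT => nex.
    have z0 : z = 0.
      apply: (@no_bounded_orbit w z 4) => t; rewrite leNgt; apply/negP => Ht.
      by apply: nex; exists t.
    by move: z1; rewrite z0 sqnorm0 ler10.
  exists ([set q | 4 < sqnorm (U t q.1 *m q.2)], [set T | `|t| <= T]).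
    split; last exact: (nbhs_pinfty_ge (num_real _)).
    exact: (cvgr_gt _ (@sqnorm_cocycle_cont t (w, z)) _ Ht).
  by move=> [q T] [/= Hq HT]; exists t.
move=> /filterI/(_ (nbhs_pinfty_gt (num_real (0 : R))))/filter_ex[T [TP T0]].
exists T => // w z.
have [->|z0] := eqVneq z 0.
  exists 0; first by rewrite normr0 ltW.
  by rewrite mulmx0 !sqnorm0 mulr0.
have zs : 0 < sqnorm z by rewrite sqnorm_gt0.
pose a := (Num.sqrt (sqnorm z))^-1.
have a2 : a ^+ 2 * sqnorm z = 1.
  by rewrite exprVn sqr_sqrtr ?sqnorm_ge0// mulVf// gt_eqF.
have [|t tT] := TP (w, a%:C%C *: z).
  by split => //=; rewrite sqnormZ abs2_real a2 lexx.
rewrite /= -scalemxAr sqnormZ abs2_real => Ht; exists t => //.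
have a20 : 0 < a ^+ 2 by rewrite exprn_gt0// invr_gt0 sqrtr_gt0.
by rewrite -(ler_pM2l a20) mulrCA a2 mulr1 ltW.
Qed.

Lemma orbit_expansion T w z : (forall w z,
    exists2 t, `|t| <= T & 4 * sqnorm z <= sqnorm (U t w *m z)) ->
  forall t, exists u, [/\ t - T <= u, u <= t + T &
    4 * sqnorm (U t w *m z) <= sqnorm (U u w *m z)].
Proof.
move=> exT t; have [s] := exT (sigma t w) (U t w *m z).
rewrite mulmxA -UD ler_norml => /andP[s1 s2] H.
by exists (t + s); rewrite lerD2l s1 lerD2l s2 (addrC t).
Qed.

(* The last clause is uniform in [S], which is what
   allows [S] to tend to infinity in [forward_graph_exists]. *)
Lemma uniform_decay : exists C b : R, [/\ 1 <= C, 0 < b,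
  (forall w z K, (forall t, 0 <= t -> sqnorm (U t w *m z) <= K) ->
     forall t, 0 <= t -> sqnorm (U t w *m z) <= C * expR (- b * t) * sqnorm z) &
  (forall w z S, sqnorm (U S w *m z) <= 2 * sqnorm z ->
     forall t, 0 <= t <= S -> sqnorm (U t w *m z) <= C * sqnorm z)].
Proof.
have [T T0 exT] := uniform_expansion.
(* Growth over a time at most [T]. The factor 4 and the rate [ln 4 / T] below come from rounding t /
   T down to k: 4^(-k) <= 4 exp (- (ln 4 / T) t). *)
pose C0 := expR (c * T).
have C01 : 1 <= C0 by rewrite -expR0 ler_expR mulr_ge0// ltW.
have short w z t : `|t| <= T -> sqnorm (U t w *m z) <= C0 * sqnorm z.
  move=> tT; apply: le_trans (Ugrowth _ _ _) _; rewrite mulrC.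
  by rewrite ler_wpM2r ?sqnorm_ge0// ler_expR ler_wpM2l.
exists (4 * C0), (ln 4 / T); split.
- lra.
- by rewrite divr_gt0// ln_gt0// ltr1n.
- move=> w z K zK.
  have C0z : 0 <= C0 * sqnorm z by rewrite mulr_ge0 ?sqnorm_ge0// (le_trans _ C01).
  (* For t > T the instant of doubling is u >= t - T > 0, still on the half-line where the orbit is
     bounded. *)
  have bnd : forall t, 0 <= t -> sqnorm (U t w *m z) <= C0 * sqnorm z.
    apply: (quarter_iteration C0z zK) => t t0.
    have [tT|Tt] := leP t T; first by left; apply: short; rewrite ger0_norm.
    right; have [u [u1 _ Hu]] := orbit_expansion w z exT t.
    by exists u => //; lra.
  (* Passing from t to the instant u of doubling costs at most one [T] and gains a factor 4. *)
  have geo k : forall t, k%:R * T <= t ->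
      sqnorm (U t w *m z) <= C0 * sqnorm z / 4 ^+ k.
    elim: k => [t|k IH t].
      by rewrite mul0r expr0 divr1; exact: bnd.
    rewrite -natr1 mulrDl mul1r => kt.
    have [u [u1 _ Hu]] := orbit_expansion w z exT t.
    have ku : k%:R * T <= u by lra.
    rewrite (_ : _ / _ = C0 * sqnorm z / 4 ^+ k / 4); last by rewrite exprS; field.
    by rewrite ler_pdivlMr// mulrC (le_trans Hu)// IH.
  move=> t t0; pose k := Num.truncn (t / T).
  have tT0 : 0 <= t / T by rewrite divr_ge0// ltW.
  have /andP[k1 k2] := truncn_itv tT0.
  apply: le_trans (geo k t _) _; first by rewrite -ler_pdivlMr.
  have key : (4 ^+ k)^-1 <= 4 * expR (- (ln 4 / T) * t).
    rewrite -ler_pdivrMl// -invfM -exprS.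
    have -> : 4 ^+ k.+1 = expR (k.+1%:R * ln 4) :> R.
      by rewrite expRM_natl lnK// posrE.
    rewrite -expRN ler_expR mulNr lerN2 mulrAC -mulrA mulrC.
    by rewrite ler_wpM2r ?ln_ge0 ?ler1n// ltW// -natr1.
  rewrite (_ : 4 * C0 * _ * _ = C0 * sqnorm z * (4 * expR (- (ln 4 / T) * t))).
    by rewrite ler_wpM2l.
  by ring.
- move=> w z S zS.
  (* The instant of doubling can leave [0, S] only if t is within [T] of an end. Near 0 the growth
     from 0 gives [C0]; near S the growth backwards from S gives [2 * C0], by the hypothesis at
     S. *)
  have D0 : 0 <= 2 * C0 * sqnorm z.
    by rewrite mulr_ge0 ?sqnorm_ge0// mulr_ge0// (le_trans _ C01).
  move=> t tS; apply: (@le_trans _ _ (2 * C0 * sqnorm z)); last first.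
    by rewrite ler_wpM2r ?sqnorm_ge0//; lra.
  have C0z : C0 * sqnorm z <= 2 * C0 * sqnorm z.
    by rewrite ler_wpM2r ?sqnorm_ge0//; lra.
  move: t tS; apply: (quarter_iteration (K := sqnorm z * expR (c * S)) D0).
    move=> t /andP[t0 tS]; apply: le_trans (Ugrowth _ _ _) _.
    rewrite ler_wpM2l ?sqnorm_ge0// ler_expR ler_wpM2l//.
    by rewrite ger0_norm.
  move=> t /andP[t0 tS].
  have [tT|Tt] := leP t T.
    by left; apply: le_trans C0z; apply: short; rewrite ger0_norm.
  have [tST|tST] := leP (S - T) t.
    left; rewrite -(subrK S t) UD -mulmxA; apply: le_trans (short _ _ _ _) _.
      by rewrite ler0_norm; lra.
    by rewrite (mulrC 2) -mulrA ler_wpM2l// (le_trans _ C01).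
  right; have [u [u1 u2 Hu]] := orbit_expansion w z exT t.
  exists u => //; apply/andP; split.
    by rewrite (le_trans _ u1)// subr_ge0 ltW.
  by rewrite (le_trans u2)// -lerBrDr ltW.
Qed.

(** Membership in the stable fibre, kept as a predicate because the dimension of the fibre is still
    unknown. *)
Definition forward_bounded w z : Prop :=
  exists K, forall t, 0 <= t -> sqnorm (U t w *m z) <= K.

Lemma forward_boundedD w y z : forward_bounded w y -> forward_bounded w z ->
  forward_bounded w (y + z).
Proof.
move=> [K yK] [L zL]; exists (2 * K + 2 * L) => t t0.
rewrite mulmxDr (le_trans (sqnormD_le _ _))//.
by rewrite lerD// ler_pM2l// ?yK ?zL.
Qed.

Lemma forward_boundedZ w k z : forward_bounded w z -> forward_bounded w (k *: z).
Proof.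
move=> [K zK]; exists (abs2 k * K) => t t0.
by rewrite -scalemxAr sqnormZ ler_wpM2l ?abs2_ge0// zK.
Qed.

Lemma forward_bounded_mulmx p w (Y : 'M[R[i]]_(n + n, p)) (a : 'cV[R[i]]_p) :
  (forall j, forward_bounded w (col j Y)) -> forward_bounded w (Y *m a).
Proof.
move=> Yb; rewrite mulmx_sum_cols.
elim/big_ind: _ => [|x y|j _].
- by exists 0 => t _; rewrite mulmx0 sqnorm0.
- exact: forward_boundedD.
- exact: forward_boundedZ.
Qed.

Lemma cocycle_injective t w (z : 'cV[R[i]]_(n + n)) : U t w *m z = 0 -> z = 0.
Proof. by move=> Uz; rewrite -[z]mul1mx -(cocycle_inv t w) -mulmxA Uz mulmx0. Qed.

(* If the upper half of [z] vanishes then so does its flux; since the flux of a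
   decaying solution is monotone with limit 0, it is identically 0. *)
Lemma forward_bounded_transversal w z :
  forward_bounded w z -> usubmx z = 0 -> z = 0.
Proof.
move=> [K zK] uz.
have [C [b [C1 b0 dec _]]] := uniform_decay.
have {zK}zd := dec w z K zK.
have fz : flux z = 0.
  by rewrite /flux uz big1// => i _; rewrite mxE conjc0 mul0r.
suff f0 t : 0 <= t -> flux (U t w *m z) = 0.
  have dz : dsubmx z = 0 by apply: (@flux_rigid w) => t t0; rewrite f0.
  by rewrite -[z]vsubmxK uz dz col_mx0.
move=> t0; apply/eqP; rewrite -normr_le0 -norm_sg; apply/ler_addgt0Pr => e e0.
rewrite add0r.
have h1 : sg * flux (U t w *m z) <= 0.
  by rewrite (le_trans (flux_mono _ _ t0))// fz mulr0.
rewrite ler0_norm//.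
have Cz : 0 <= C * sqnorm z by rewrite mulr_ge0 ?sqnorm_ge0// (le_trans _ C1).
(* Late enough that C exp (- b u) |z|^2 <= e, by exp (b u) >= 1 + b u. *)
pose u := Num.max t (C * sqnorm z / (e * b)).
have tu : t <= u by rewrite le_max lexx.
have u0 : 0 <= u := le_trans t0 tu.
have := flux_orbit_mono w z tu; rewrite -lerN2 => /le_trans; apply.
apply: le_trans (ler_norm _) _; rewrite normrN norm_sg.
apply: le_trans (abs_flux_le _) (le_trans (zd u u0) _).
have eb : 0 < e * b by rewrite mulr_gt0.
have ue : C * sqnorm z / (e * b) <= u by rewrite le_max lexx orbT.
rewrite mulrAC mulNr expRN ler_pdivrMr ?expR_gt0//.
rewrite ler_pdivrMr// in ue.
apply: le_trans ue _; rewrite mulrCA ler_pM2l// mulrC.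
by have := expR_ge1Dx (b * u); apply: le_trans; rewrite lerDr.
Qed.

(* The solutions that satisfy z2 = sg i z1 at time [S]; there [sg * flux] is half
   of the squared norm, so monotonicity bounds the solution at [S] by its value
   at 0. [horizon_mx] is the matrix of the resulting linear system for the lower
   half of the initial value. *)
Definition horizon_mx S w : 'M[R[i]]_n :=
  drsubmx (U S w) - (sg%:C%C * 'i%C) *: ursubmx (U S w).

Definition horizon w S (z : 'cV[R[i]]_(n + n)) : Prop :=
  dsubmx (U S w *m z) = (sg%:C%C * 'i%C) *: usubmx (U S w *m z).

Lemma horizon_flux w S z : horizon w S z ->
  sqnorm (U S w *m z) = 2 * (sg * flux (U S w *m z)).
Proof.
rewrite /horizon; move: (U S w *m z) => y yS.
have -> : flux y = sg * sqnorm (usubmx y).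
  rewrite /flux yS /sqnorm mulr_sumr; apply: eq_bigr => i _.
  rewrite [X in cIm (_ * X)]mxE; move: (usubmx y i 0) => -[a d].
  rewrite /abs2 cImM cReJ cImJ !(cImM, cReM)/=; ring.
have -> : sqnorm y = sqnorm (usubmx y) + sqnorm (usubmx y).
  rewrite [LHS]sqnorm_split yS sqnormZ abs2M abs2_real sg2.
  by rewrite /abs2/= expr0n expr1n/= add0r !mul1r.
by rewrite [sg * (_ * _)]mulrA -expr2 sg2 mul1r mulr_natl mulr2n.
Qed.

Lemma horizon_le w S z : 0 <= S -> horizon w S z ->
  sqnorm (U S w *m z) <= 2 * sqnorm z.
Proof.
move=> S0 zS; rewrite horizon_flux// ler_pM2l//.
apply: le_trans (flux_mono _ _ S0) _; apply: le_trans (ler_norm _) _.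
by rewrite norm_sg abs_flux_le.
Qed.

(** For the lower half [y] the condition is a square linear system with trivial kernel: over the
    upper half 0 the flux starts at 0, so [sg * flux], which at time [S] is half of the squared
    norm, cannot be positive there. *)
Lemma horizon_exists w S (a : 'cV[R[i]]_n) : 0 <= S ->
  exists y, horizon w S (col_mx a y).
Proof.
move=> S0; pose k := sg%:C%C * 'i%C : R[i].
have hE a' y : (horizon w S (col_mx a' y)) <->
    horizon_mx S w *m y = - ((dlsubmx (U S w) - k *: ulsubmx (U S w)) *m a').
  rewrite /horizon -{1 2}[U S w]submxK mul_block_col col_mxKu col_mxKd.
  rewrite [k *: (_ + _)]scalerDr 2![k *: (_ *m _)]scalemxAl.
  rewrite [horizon_mx S w *m y]mulmxBl [(_ - _) *m a']mulmxBl.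
  exact: addr_eq_sub_opp.
have Bu : horizon_mx S w \in unitmx.
  apply: unitmx_of_injective => y By.
  have h : horizon w S (col_mx 0 y) by apply/hE; rewrite mulmx0 oppr0.
  have : U S w *m col_mx 0 y = 0.
    apply: sqnorm_eq0; apply/eqP; rewrite eq_le sqnorm_ge0 andbT horizon_flux//.
    rewrite pmulr_rle0//; apply: le_trans (flux_mono _ _ S0) _.
    by rewrite /flux big1 ?mulr0// => i _; rewrite col_mxKu mxE conjc0 mul0r.
  by move/cocycle_injective/(congr1 dsubmx); rewrite col_mxKd linear0.
exists (invmx (horizon_mx S w) *m - ((dlsubmx (U S w) - k *: ulsubmx (U S w)) *m a)).
by apply/hE; rewrite mulmxA mulmxV// mul1mx.
Qed.

Lemma entrywise_col_mx (T : topologicalType) (f g : T -> 'cV[R[i]]_n) x :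
  entrywise_continuous f x -> entrywise_continuous g x ->
  entrywise_continuous (fun t => col_mx (f t) (g t)) x.
Proof.
move=> fc gc i j; case: (split_ordP i) => k ->.
  have -> : (fun t => col_mx (f t) (g t) (lshift n k) j) = (fun t => f t k j).
    by apply/funext => t; rewrite col_mxEu.
  exact: fc.
have -> : (fun t => col_mx (f t) (g t) (rshift n k) j) = (fun t => g t k j).
  by apply/funext => t; rewrite col_mxEd.
exact: gc.
Qed.

Lemma entrywise_snd (T : topologicalType) m (p : T * 'cV[R[i]]_m) :
  entrywise_continuous (fun q : T * 'cV[R[i]]_m => q.2) p.
Proof.
move=> i j.
apply: (@continuous_comp _ _ _ (@snd T 'cV[R[i]]_m) (fun z => z i j)).
  exact: cvg_snd.
exact: coord_continuous.
Qed.

(** By [uniform_decay] a vector fails to be forward bounded only if it violates the decay estimate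
    at some instant t, and a strict violation at a fixed t is an open condition. *)
Lemma not_forward_bounded_near w z : ~ forward_bounded w z ->
  \forall q \near (w, z), ~ forward_bounded q.1 q.2.
Proof.
have [C [b [C1 b0 dec _]]] := uniform_decay.
move=> nz.
have [t [t0 Ht]] : exists t, 0 <= t /\
    C * expR (- b * t) * sqnorm z < sqnorm (U t w *m z).
  apply: contrapT => nex; apply: nz; exists (C * sqnorm z) => t t0.
  apply: (@le_trans _ _ (C * expR (- b * t) * sqnorm z)).
    by rewrite leNgt; apply/negP => H; apply: nex; exists t.
  rewrite ler_wpM2r ?sqnorm_ge0// ler_piMr ?(le_trans _ C1)//.
  by rewrite -expR0 ler_expR mulNr oppr_le0 mulr_ge0// ltW.
pose f (q : Omega * 'cV[R[i]]_(n + n)) : R :=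
  sqnorm (U t q.1 *m q.2) - C * expR (- b * t) * sqnorm q.2.
have fc : {for (w, z), continuous f}.
  have c1 := @sqnorm_cocycle_cont t (w, z).
  have c2 := entrywise_sqnorm (@entrywise_snd Omega (n + n) (w, z)).
  have c3 : {for (w, z), continuous (fun _ : Omega * 'cV[R[i]]_(n + n) =>
    C * expR (- b * t))} by exact: cvg_cst.
  exact: (continuousB c1 (continuousM c3 c2)).
have f0 : 0 < f (w, z) by rewrite subr_gt0.
apply: filterS (cvgr_gt _ fc _ f0) => q; rewrite /f subr_gt0 => Hq [K qK].
by have := dec _ _ _ qK t t0; rewrite leNgt Hq.
Qed.

(* The horizon vectors over [a], divided by their norm, accumulate as [S] tends to
   infinity at a forward bounded (r a, y). By transversality r is nonzero, so
   dividing by r gives the claim. The pairs [q] below stand for (r, y). *)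
Lemma forward_graph_exists w a : exists y, forward_bounded w (col_mx a y).
Proof.
have [C [b [C1 b0 dec fin]]] := uniform_decay.
apply: contrapT => nex.
pose Zm (q : R * 'cV[R[i]]_n) : 'cV[R[i]]_(n + n) := col_mx (q.1%:C%C *: a) q.2.
have Zc q : entrywise_continuous Zm q.
  apply: entrywise_col_mx; last exact: entrywise_snd.
  move=> i j.
  have -> : (fun q : R * 'cV[R[i]]_n => (q.1%:C%C *: a) i j) =
      (fun q => q.1%:C%C * a i j) by apply/funext => p; rewrite mxE.
  apply: continuous_cmul; last exact: cvg_cst.
  by apply: (@cvg_complex R _ (nbhs q)) => /=; [exact: cvg_fst | exact: cvg_cst].
pose h (q : R * 'cV[R[i]]_n) : R := q.1 * q.1 + sqnorm q.2.
(* The normalisation r^2 + |y|^2 = 1 replaces the norm of [Zm], so that it does not involve [a]. *)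
pose Kc := (`[0, 1]%classic `*` [set y : 'cV[R[i]]_n | sqnorm y <= 1]) `&`
  [set q | h q = 1].
have hc : continuous h.
  move=> q; have c1 : {for q, continuous (@fst R 'cV[R[i]]_n)} by exact: cvg_fst.
  exact: (continuousD (continuousM c1 c1) (entrywise_sqnorm (@entrywise_snd R n q))).
have Kcc : compact Kc.
  apply: compact_closedI.
    by apply: compact_setX; [exact: segment_compact | exact: compact_sqnorm_le].
  rewrite (_ : [set q | h q = 1] = h @^-1` [set 1])//.
  by apply: closed_comp => [q _|]; [exact: hc | exact: closed_eq].
move/compact_near_coveringP : Kcc.
move=> /(_ _ (pinfty_nbhs R) (fun S q => ~ horizon w S (Zm q)) _) H.
have : \forall S \near +oo, Kc `<=` (fun q => ~ horizon w S (Zm q)).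
  apply: H => q [_ hq].
  (* Otherwise q would give the forward bounded vector that is assumed not to exist. The excess at t
     persists near q, and [fin] forbids it for horizon vectors with S >= t. *)
  have [t [t0 Ht]] : exists t, 0 <= t /\ C * sqnorm (Zm q) < sqnorm (U t w *m Zm q).
    apply: contrapT => nt.
    have fb : forward_bounded w (Zm q).
      exists (C * sqnorm (Zm q)) => t t0; rewrite leNgt; apply/negP => Ht.
      by apply: nt; exists t.
    have [q0|q0] := eqVneq q.1 0.
      have Z0 : Zm q = 0.
        apply: forward_bounded_transversal fb _.
        by rewrite col_mxKu q0 scale0r.
      have q20 : q.2 = 0 by rewrite -[q.2](col_mxKd (q.1%:C%C *: a)) -/(Zm q) Z0 linear0.
      by move: hq; rewrite /= /h q0 q20 sqnorm0 mul0r addr0 => /eqP; rewrite eq_sym oner_eq0.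
    apply: nex; exists ((q.1^-1)%:C%C *: q.2).
    have -> : col_mx a ((q.1^-1)%:C%C *: q.2) = (q.1^-1)%:C%C *: Zm q.
      rewrite scale_col_mx scalerA -rmorphM/= mulVf// scale1r//.
    exact: forward_boundedZ.
  pose f (p : R * 'cV[R[i]]_n) : R := sqnorm (U t w *m Zm p) - C * sqnorm (Zm p).
  have fc : {for q, continuous f}.
    have c1 := entrywise_sqnorm (entrywise_mulmx (@entrywise_cst _ _ _ _ (U t w) q) (@Zc q)).
    have c3 : {for q, continuous (fun _ : R * 'cV[R[i]]_n => C)} by exact: cvg_cst.
    exact: (continuousB c1 (continuousM c3 (entrywise_sqnorm (@Zc q)))).
  have f0 : 0 < f q by rewrite subr_gt0.
  exists ([set p | 0 < f p], [set S | t <= S]).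
    split; first exact: (cvgr_gt _ fc _ f0).
    exact: (nbhs_pinfty_ge (num_real _)).
  move=> [p S] [/= fp tS] pS; move: fp; rewrite subr_gt0 ltNge => /negP; apply.
  by apply: (fin w (Zm p) S); [exact: horizon_le (le_trans t0 tS) pS | rewrite t0].
move=> /filterI/(_ (nbhs_pinfty_gt (num_real (0 : R))))/filter_ex[S [SK S0]].
have [y yS] := horizon_exists w a (ltW S0).
pose r := (Num.sqrt (1 + sqnorm y))^-1.
have y0 := sqnorm_ge0 y.
have r0 : 0 <= r by rewrite invr_ge0 sqrtr_ge0.
have r2 : r ^+ 2 * (1 + sqnorm y) = 1.
  by rewrite exprVn sqr_sqrtr ?mulVf ?gt_eqF//; lra.
have r21 : r ^+ 2 * sqnorm y <= 1 by have := sqr_ge0 r; lra.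
apply: (SK (r, r%:C%C *: y)).
  split; last by rewrite /= /h /= sqnormZ abs2_real -expr2; lra.
  split=> /=; last by rewrite sqnormZ abs2_real.
  rewrite in_itv/= r0/= -(@expr_le1 _ 2)//.
  by have := mulr_ge0 (sqr_ge0 r) y0; lra.
rewrite /horizon.
have -> : Zm (r, r%:C%C *: y) = r%:C%C *: col_mx a y by rewrite scale_col_mx.
have dZ k (v : 'cV[R[i]]_(n + n)) : dsubmx (k *: v) = k *: dsubmx v.
  by apply/matrixP => i j; rewrite !mxE.
have uZ k (v : 'cV[R[i]]_(n + n)) : usubmx (k *: v) = k *: usubmx v.
  by apply/matrixP => i j; rewrite !mxE.
by rewrite -scalemxAr dZ uZ yS !scalerA mulrC.
Qed.

(** By transversality the upper half of a forward bounded unit vector is nonzero, and compactness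
    makes this uniform in w. It confines the Weyl matrices of all w to one compact set. *)
Lemma forward_bounded_usubmx : exists B : R, forall w z, forward_bounded w z ->
  sqnorm z <= B * sqnorm (usubmx z).
Proof.
have /compact_near_coveringP := @compact_shell 1 1.
move=> /(_ _ (pinfty_nbhs R) (fun B q => forward_bounded q.1 q.2 ->
    1 <= B * sqnorm (usubmx q.2)) _) H.
have : \forall B \near +oo, ([set: Omega] `*`
    [set y : 'cV[R[i]]_(n + n) | 1 <= sqnorm y <= 1]) `<=`
    (fun q => forward_bounded q.1 q.2 -> 1 <= B * sqnorm (usubmx q.2)).
  apply: H => -[w z] [_ /= z1].
  have [zf|znf] := pselect (forward_bounded w z); last first.
    exists ([set q | ~ forward_bounded q.1 q.2], setT).
      by split; [exact: not_forward_bounded_near | exact: filterT].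
    by move=> [q B] [/= nq _] /nq.
  pose m := sqnorm (usubmx z).
  have m0 : 0 < m.
    rewrite sqnorm_gt0; apply/eqP => uz.
    by move: z1; rewrite (forward_bounded_transversal zf uz) sqnorm0 ler10.
  have uc : entrywise_continuous (fun q : Omega * 'cV[R[i]]_(n + n) => usubmx q.2) (w, z).
    move=> i j.
    have -> : (fun q : Omega * 'cV[R[i]]_(n + n) => usubmx q.2 i j) =
        (fun q => q.2 (lshift n i) j) by apply/funext => q; rewrite mxE.
    exact: entrywise_snd.
  have m2 : m / 2 < m by rewrite ltr_pdivrMr// ltr_pMr// ltr1n.
  exists ([set q | m / 2 < sqnorm (usubmx q.2)], [set B | 2 / m <= B]).
    split; last exact: (nbhs_pinfty_ge (num_real _)).
    exact: (cvgr_gt _ (entrywise_sqnorm uc) _ m2).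
  move=> [q B] [/= mq mB] _.
  have -> : 1 = 2 / m * (m / 2) :> R by field; rewrite gt_eqF.
  by apply: ler_pM => //; [rewrite divr_ge0// ltW | rewrite divr_ge0// ltW | exact: ltW].
move=> /filter_ex[B BP]; exists B => w z zf.
have [->|z0] := eqVneq z 0; first by rewrite !linear0 !sqnorm0 mulr0.
have zs : 0 < sqnorm z by rewrite sqnorm_gt0.
pose a := (Num.sqrt (sqnorm z))^-1.
have a2 : a ^+ 2 * sqnorm z = 1.
  by rewrite exprVn sqr_sqrtr ?sqnorm_ge0// mulVf// gt_eqF.
have a20 : 0 < a ^+ 2 by rewrite exprn_gt0// invr_gt0 sqrtr_gt0.
have /= := BP (w, a%:C%C *: z).
have -> : usubmx (a%:C%C *: z) = a%:C%C *: usubmx z by apply/matrixP => i j; rewrite !mxE.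
rewrite !sqnormZ abs2_real a2 => /(_ _ (forward_boundedZ _ zf)) H1.
by rewrite -(ler_pM2l a20) a2 mulrCA H1// lexx.
Qed.

(** Column j is the lower half of the forward bounded vector over the unit vector [e j]. Continuity
    is a closed graph argument: all columns lie in one compact set, and a value other than [Y w0 j]
    is not forward bounded at w0, which persists near w0. *)
Lemma forward_weyl_matrix : exists M : Omega -> 'M[R[i]]_n,
  (forall w, entrywise_continuous M w) /\
  (forall w z, dsubmx z = M w *m usubmx z <-> forward_bounded w z).
Proof.
pose e j : 'cV[R[i]]_n := delta_mx j 0.
have /choice[Y YP] : forall w, exists Y : 'I_n -> 'cV[R[i]]_n,
    forall j, forward_bounded w (col_mx (e j) (Y j)).
  move=> w; have /choice[Y YP] := fun j => forward_graph_exists w (e j).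
  by exists Y.
pose M w : 'M[R[i]]_n := \matrix_(i, j) Y w j i 0.
have MC w j : col j (M w) = Y w j by apply/matrixP => i k; rewrite !mxE ord1.
have graph w z : dsubmx z = M w *m usubmx z <-> forward_bounded w z.
  have gb u : forward_bounded w (col_mx u (M w *m u)).
    have -> : col_mx u (M w *m u) = col_mx 1%:M (M w) *m u.
      by rewrite mul_col_mx mul1mx.
    apply: forward_bounded_mulmx => j.
    have -> : col j (col_mx 1%:M (M w)) = col_mx (e j) (Y w j).
      rewrite -MC; apply/matrixP => i k; rewrite mxE.
      case: (split_ordP i) => l ->; first by rewrite !col_mxEu !mxE ord1 eqxx andbT.
      by rewrite !col_mxEd [RHS]mxE.
    exact: YP.
  split=> [dz|zf]; first by rewrite -[z]vsubmxK dz.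
  pose d := z + (-1) *: col_mx (usubmx z) (M w *m usubmx z).
  have df : forward_bounded w d.
    by apply: forward_boundedD => //; exact: forward_boundedZ.
  have ud : usubmx d = 0.
    by apply/matrixP => i j; rewrite !mxE (unsplitK (inl _)) !mxE mulN1r subrr.
  have := forward_bounded_transversal df ud.
  rewrite /d scaleN1r => /eqP; rewrite subr_eq0 => /eqP ->.
  by rewrite col_mxKd col_mxKu.
exists M; split => // w0 i j.
have [B BP] := forward_bounded_usubmx.
pose K := [set y : 'cV[R[i]]_n | sqnorm y <= B * sqnorm (e j)].
have YK w : K (Y w j).
  have := BP w _ (YP w j); rewrite col_mxKu; apply: le_trans.
  by rewrite sqnorm_split col_mxKu col_mxKd lerDr sqnorm_ge0.
have near_Y (d : R) : 0 < d -> \forall w \near w0, sqnorm (Y w0 j - Y w j) < d.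
  move=> d0.
  have /compact_near_coveringP : compact K by exact: compact_sqnorm_le.
  move=> /(_ _ (nbhs w0) (fun w y => Y w j = y -> sqnorm (Y w0 j - y) < d) _) H.
  have : \forall w \near w0, K `<=` (fun y => Y w j = y -> sqnorm (Y w0 j - y) < d).
    apply: H => y _.
    have [yf|ynf] := pselect (forward_bounded w0 (col_mx (e j) y)).
      have yE : y = Y w0 j.
        by move/graph : yf; rewrite col_mxKd col_mxKu -colE MC.
      exists ([set y' | sqnorm (Y w0 j - y') < d], setT); last first.
        by move=> [y' w] [/= Hy' _].
      split; last exact: filterT.
      have idc : entrywise_continuous (fun y' : 'cV[R[i]]_n => y') y.
        by move=> k l; exact: coord_continuous.
      have cY := entrywise_sqnorm (entrywiseB (@entrywise_cst _ _ _ _ (Y w0 j) y) idc).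
      by apply: (cvgr_lt _ cY); rewrite yE subrr sqnorm0.
    have := not_forward_bounded_near ynf => Hnear.
    pose g (p : 'cV[R[i]]_n * Omega) := (p.2, col_mx (e j) p.1).
    have gc : {for (y, w0), continuous g}.
      have c1 : entrywise_continuous (fun p : 'cV[R[i]]_n * Omega => p.1) (y, w0).
        move=> k l.
        apply: (@continuous_comp _ _ _ (@fst 'cV[R[i]]_n Omega) (fun z => z k l)).
          exact: cvg_fst.
        exact: coord_continuous.
      have c2 := entrywise_col_mx (@entrywise_cst _ _ _ _ (e j) (y, w0)) c1.
      have c3 : {for (y, w0), continuous (fun p : 'cV[R[i]]_n * Omega => col_mx (e j) p.1)}.
        exact: (@cvg_mx _ (nbhs (y, w0)) _ _ _ _ _ _ c2).
      exact: (cvg_pair (@cvg_snd _ _ (nbhs y) (nbhs w0) _) c3).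
    have [[P Q] /= PQn PQ] := gc _ Hnear.
    exists (P, Q) => //; case=> y' w /PQ /= nf wE.
    by exfalso; apply: nf; rewrite -wE; exact: YP.
  by apply: filterS => w Hw; apply: (Hw (Y w j)).
have near_e (d : R) : 0 < d -> \forall w \near w0, abs2 (M w0 i j - M w i j) < d ^+ 2.
  move=> d0; apply: filterS (near_Y _ (exprn_gt0 2 d0)) => w; apply: le_lt_trans.
  by rewrite /sqnorm (bigD1 i)//= !mxE lerDl; apply: sumr_ge0 => k _; exact: abs2_ge0.
apply: (@cvg_complex R _ (nbhs w0)); apply/(@cvgrPdist_lt _ _ _ (nbhs w0)) => d d0;
  apply: filterS (near_e d d0) => w;
  rewrite /abs2 cReB cImB => H;
  rewrite -sqrtr_sqr -(ger0_norm (ltW d0)) -(sqrtr_sqr d);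
  rewrite ltr_sqrt ?exprn_gt0//; apply: le_lt_trans H;
  by rewrite ?lerDl ?lerDr sqr_ge0.
Qed.

Lemma forward_bounded_orbit w z t : forward_bounded w z ->
  forward_bounded (sigma t w) (U t w *m z).
Proof.
move=> [K zK]; exists (Num.max K (sqnorm z * expR (c * `|t|))) => s s0.
rewrite mulmxA -UD le_max; have [st|st] := leP 0 (s + t); first by rewrite zK.
apply/orP; right; apply: le_trans (Ugrowth _ _ _) _.
rewrite ler_wpM2l ?sqnorm_ge0// ler_expR ler_wpM2l// ltr0_norm//.
have t0 : t < 0 by rewrite (le_lt_trans _ st)// lerDr.
by rewrite ltr0_norm// lerN2 lerDr.
Qed.

End Cocycle.

(** Rigidity knows the flux to be constant only on a half-line; this already fixes the derivative at
    the end point. The left version serves reversed time. *)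
Lemma is_derive_right_cst {R : realType} (f : R -> R) (x d : R) :
  is_derive x 1 f d -> (forall t, x <= t -> f t = f x) -> d = 0.
Proof.
move=> /is_derive1_caratheodory[g [fg gc <-]] fx.
apply/eqP; apply: contrapT => /negP gx0.
have : 0 < `|g x| by rewrite normr_gt0.
move=> /(near_dist_lt gc) /nbhs_ballP[e /= e0 eg].
have := eg (x + e / 2); rewrite /ball/= opprD addNKr normrN => /(_ _) H.
have {H} : `|g x - g (x + e / 2)| < `|g x|.
  by apply: H; rewrite gtr0_norm; lra.
have := fg (x + e / 2); rewrite fx; last by rewrite lerDl; lra.
rewrite subrr [x + _ - x]addrC addKr => /esym/eqP.
rewrite mulf_eq0 => /orP[/eqP -> |/eqP]; last by lra.
by rewrite subr0 ltxx.
Qed.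

Lemma is_derive_left_cst {R : realType} (f : R -> R) (x d : R) :
  is_derive x 1 f d -> (forall t, t <= x -> f t = f x) -> d = 0.
Proof.
move=> fd fx; apply/eqP; rewrite -oppr_eq0; apply/eqP.
apply: (@is_derive_right_cst _ (fun s => f (- s)) (- x)).
  by apply: is_derive_compN; rewrite opprK.
by move=> t xt; rewrite opprK fx// lerNl.
Qed.

Lemma bounded_on_compact {R : realType} (T : topologicalType) (f : T -> R) :
  compact [set: T] -> continuous f -> exists L, forall x, `|f x| <= L.
Proof.
move=> /compact_near_coveringP Tc fc.
have := Tc _ (pinfty_nbhs R) (fun L x => `|f x| <= L) _ => /(_ _) H.
have : \forall L \near +oo, [set: T] `<=` (fun x => `|f x| <= L).
  apply: H => x _.
  exists ([set y | `|f x - f y| < 1], [set L | `|f x| + 1 <= L]).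
    split; last exact: (nbhs_pinfty_ge (num_real _)).
    exact: (near_dist_lt (@fc x) ltr01).
  move=> [y L] /= [yx xL]; apply: le_trans xL.
  by have := ler_normB (f x) (f x - f y); rewrite opprB addrC subrK; lra.
by move=> /filter_ex[L LP]; exists L => x; exact: LP.
Qed.

(** * The Hamiltonian family *)

Section SesquilinearForm.
Context {R : realType}.

Definition ctr m p (A : 'M[R[i]]_(m, p)) : 'M[R[i]]_(p, m) := (map_mx conjc A)^T.
Definition toC m p (A : 'M[R]_(m, p)) : 'M[R[i]]_(m, p) := map_mx (fun x => x%:C%C) A.

Lemma ctr_mulmx m p q (A : 'M[R[i]]_(m, p)) (B : 'M[R[i]]_(p, q)) :
  ctr (A *m B) = ctr B *m ctr A.
Proof. by rewrite /ctr map_mxM trmx_mul. Qed.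

Lemma ctrD m p (A B : 'M[R[i]]_(m, p)) : ctr (A + B) = ctr A + ctr B.
Proof. by apply/matrixP => i j; rewrite !mxE rmorphD. Qed.

Lemma ctrN m p (A : 'M[R[i]]_(m, p)) : ctr (- A) = - ctr A.
Proof. by apply/matrixP => i j; rewrite !mxE rmorphN. Qed.

Lemma ctrZ m p (k : R[i]) (A : 'M[R[i]]_(m, p)) : ctr (k *: A) = conjc k *: ctr A.
Proof. by apply/matrixP => i j; rewrite !mxE rmorphM. Qed.

Lemma ctr_toC m p (A : 'M[R]_(m, p)) : ctr (toC A) = toC A^T.
Proof. by apply/matrixP => i j; rewrite !mxE conjc_real. Qed.

Lemma toC_tr m p (A : 'M[R]_(m, p)) : (toC A)^T = toC A^T.
Proof. by apply/matrixP => i j; rewrite !mxE. Qed.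

(** The form W of the overview. It is conjugate-linear on the left, so a solution for conj l and one
    for l have constant W. *)
Definition symplectic_form n (y z : 'cV[R[i]]_(n + n)) : R[i] :=
  (ctr (usubmx y) *m dsubmx z - ctr (dsubmx y) *m usubmx z) 0 0.

Definition hermitian_form n (D : 'M[R]_n) (y z : 'cV[R[i]]_n) : R[i] :=
  (ctr y *m toC D *m z) 0 0.

Lemma symplectic_form_flux n (z : 'cV[R[i]]_(n + n)) :
  cIm (symplectic_form z z) = 2 * flux z.
Proof.
rewrite /symplectic_form mxE [X in _ + X]mxE !mxE -sumrB cIm_sum /flux mulr_sumr.
apply: eq_bigr => i _; rewrite !mxE cImB !cImM !cReJ !cImJ; ring.
Qed.

Lemma quadratic_form_sum n (D : 'M[R]_n) (x : 'cV[R]_n) :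
  (x^T *m D *m x) 0 0 = \sum_j \sum_i x i 0 * D i j * x j 0.
Proof.
rewrite mxE; apply: eq_bigr => j _; rewrite mxE mulr_suml.
by apply: eq_bigr => i _; rewrite mxE.
Qed.

Lemma Re_hermitian_form n (D : 'M[R]_n) (z : 'cV[R[i]]_n) :
  let a := map_mx (@cRe R) z in let b := map_mx (@cIm R) z in
  cRe (hermitian_form D z z) = (a^T *m D *m a) 0 0 + (b^T *m D *m b) 0 0.
Proof.
move=> a b; rewrite !quadratic_form_sum -big_split/= /hermitian_form mxE cRe_sum.
apply: eq_bigr => j _; rewrite -big_split/= mxE mulr_suml cRe_sum.
apply: eq_bigr => i _; rewrite !mxE !cReM !cImM cReJ cImJ /=; ring.
Qed.

Lemma Re_hermitian_form_gt0 n (D : 'M[R]_n) (z : 'cV[R[i]]_n) :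
  positive_definite D -> z != 0 -> 0 < cRe (hermitian_form D z z).
Proof.
move=> Dpos z0; rewrite Re_hermitian_form.
set a := map_mx (@cRe R) z; set b := map_mx (@cIm R) z.
have semi (x : 'cV[R]_n) : 0 <= (x^T *m D *m x) 0 0.
  have [->|x0] := eqVneq x 0; last by rewrite ltW// Dpos.
  by rewrite mulmx0 mxE.
have [a0|a0] := eqVneq a 0; last by rewrite ltr_pwDl// Dpos.
have [b0|b0] := eqVneq b 0; last by rewrite ltr_wpDl// Dpos.
case/eqP: z0; apply/matrixP => i j; rewrite mxE.
apply: complex_eqP.
  by move/matrixP/(_ i j) : a0; rewrite !mxE.
by move/matrixP/(_ i j) : b0; rewrite !mxE.
Qed.

Lemma Re_hermitian_form_ge0 n (D : 'M[R]_n) (z : 'cV[R[i]]_n) :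
  positive_definite D -> 0 <= cRe (hermitian_form D z z).
Proof.
move=> Dpos; have [->|z0] := eqVneq z 0; last by rewrite ltW// Re_hermitian_form_gt0.
by rewrite /hermitian_form mulmx0 mxE.
Qed.

Lemma has_derivative_ctr_mul n (dy dz : 'cV[R[i]]_n) (Y Z : R -> 'cV[R[i]]_n) t :
  (forall i, has_derivative (fun s => Y s i 0) t (dy i 0)) ->
  (forall i, has_derivative (fun s => Z s i 0) t (dz i 0)) ->
  has_derivative (fun s => (ctr (Y s) *m Z s) 0 0) t
    ((ctr dy *m Z t + ctr (Y t) *m dz) 0 0).
Proof.
move=> Yd Zd.
have -> : (fun s => (ctr (Y s) *m Z s) 0 0) =
    (fun s => \sum_i conjc (Y s i 0) * Z s i 0).
  by apply/funext => s; rewrite mxE; apply: eq_bigr => i _; rewrite !mxE.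
have -> : (ctr dy *m Z t + ctr (Y t) *m dz) 0 0 =
    \sum_i (conjc (dy i 0) * Z t i 0 + conjc (Y t i 0) * dz i 0).
  by rewrite !mxE -big_split/=; apply: eq_bigr => i _; rewrite !mxE.
apply: has_derivative_sum => i.
exact: (has_derivativeM (has_derivativeJ (Yd i)) (Zd i)).
Qed.

End SesquilinearForm.

Section Hamiltonian.
Context {R : realType} {Omega : topologicalType} (sigma : R -> Omega -> Omega).
Context {n : nat} (H1 H2 H3 Delta : Omega -> 'M[R]_n).
Hypothesis H_sp : forall w, sp (hamiltonian_mx (H1 w) (H2 w) (H3 w)).
Hypothesis Delta_sym : forall w, (Delta w)^T = Delta w.

Let F := spectral_family H1 H2 H3 Delta.

Lemma sp_symmetric w : (H2 w)^T = H2 w /\ (H3 w)^T = H3 w.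
Proof.
have := H_sp w; rewrite /sp /hamiltonian_mx /symplectic_J tr_block_mx.
rewrite !mulmx_block !mulmx0 !mul0mx !mulmxN !mulNmx !mulmx1 !mul1mx.
rewrite !addr0 !add0r add_block_mx -(block_mx0 _ n n n n) => /eq_block_mx[E1 _ _ E4].
move: E1 E4; rewrite ?opprK => /eqP + /eqP.
by rewrite subr_eq0 => /eqP -> ; rewrite addrC subr_eq0 => /eqP <-.
Qed.

Lemma usubmx_spectral l w (z : 'cV[R[i]]_(n + n)) : usubmx (F l w *m z) =
  toC (H1 w) *m usubmx z + (toC (H3 w) + l *: toC (Delta w)) *m dsubmx z.
Proof. by rewrite -{1}[z]vsubmxK mul_block_col col_mxKu. Qed.

Lemma dsubmx_spectral l w (z : 'cV[R[i]]_(n + n)) : dsubmx (F l w *m z) =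
  toC (H2 w) *m usubmx z - (toC (H1 w))^T *m dsubmx z.
Proof. by rewrite -{1}[z]vsubmxK mul_block_col col_mxKd mulNmx. Qed.

(** The terms with [H1] cancel between the two halves of the form, those with [H2] and [H3] because
    these are real and symmetric; only the parameter terms survive, conj l from the left argument
    and m from the right. *)
Lemma symplectic_form_derivative l m w (y z : R -> 'cV[R[i]]_(n + n)) t :
  solves sigma (F l) w y -> solves sigma (F m) w z ->
  has_derivative (fun s => symplectic_form (y s) (z s)) t
    ((conjc l - m) *
     hermitian_form (Delta (sigma t w)) (dsubmx (y t)) (dsubmx (z t))).
Proof.
move=> ys zs.
have ud k (x : R -> 'cV[R[i]]_(n + n)) : solves sigma (F k) w x -> forall i,
    has_derivative (fun s => usubmx (x s) i 0) t (usubmx (F k (sigma t w) *m x t) i 0).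
  move=> xs i; rewrite mxE.
  have -> : (fun s => usubmx (x s) i 0) = (fun s => x s (lshift n i) 0).
    by apply/funext => s; rewrite mxE.
  exact: xs.
have dd k (x : R -> 'cV[R[i]]_(n + n)) : solves sigma (F k) w x -> forall i,
    has_derivative (fun s => dsubmx (x s) i 0) t (dsubmx (F k (sigma t w) *m x t) i 0).
  move=> xs i; rewrite mxE.
  have -> : (fun s => dsubmx (x s) i 0) = (fun s => x s (rshift n i) 0).
    by apply/funext => s; rewrite mxE.
  exact: xs.
have d1 := @has_derivative_ctr_mul R n _ _ (fun s => usubmx (y s))
  (fun s => dsubmx (z s)) t (ud _ _ ys) (dd _ _ zs).
have d2 := @has_derivative_ctr_mul R n _ _ (fun s => dsubmx (y s))
  (fun s => usubmx (z s)) t (dd _ _ ys) (ud _ _ zs).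
have := has_derivativeB d1 d2.
have -> : (fun s => (ctr (usubmx (y s)) *m dsubmx (z s)) 0 0 -
    (ctr (dsubmx (y s)) *m usubmx (z s)) 0 0) =
    (fun s => symplectic_form (y s) (z s)).
  by apply/funext => s; rewrite /symplectic_form [RHS]mxE [X in _ = _ + X]mxE.
congr has_derivative.
have [S2 S3] := sp_symmetric (sigma t w).
rewrite !usubmx_spectral !dsubmx_spectral.
rewrite !(ctrD, ctrN, ctr_mulmx, ctrZ, toC_tr, ctr_toC) trmxK S2 S3 Delta_sym.
rewrite /hermitian_form.
move: (ctr (usubmx (y t))) (ctr (dsubmx (y t))) => y1 y2.
move: (usubmx (z t)) (dsubmx (z t)) => z1 z2.
rewrite !(mulmxDl, mulmxDr, mulmxBl, mulmxBr, mulmxN, mulNmx) !mulmxA.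
rewrite -!(scalemxAl, scalemxAr).
move: (y1 *m toC (H1 _)^T *m z2) (y2 *m toC (H3 _) *m z2) => a b.
move: (y1 *m toC (H2 _) *m z1) (y2 *m toC (H1 _) *m z1) => c d.
by move: (y2 *m toC (Delta _) *m z2) => e; rewrite !mxE; ring.
Qed.

Lemma flux_derivative l w (z : R -> 'cV[R[i]]_(n + n)) (t : R) :
  solves sigma (F l) w z ->
  is_derive t 1 (fun s => flux (z s))
    (- cIm l * cRe (hermitian_form (Delta (sigma t w)) (dsubmx (z t)) (dsubmx (z t)))).
Proof.
move=> zs; have [_ d] := symplectic_form_derivative t zs zs.
have -> : (fun s => flux (z s)) =
    2^-1 *: (fun s => cIm (symplectic_form (z s) (z s))).
  apply/funext => s; transitivity (2^-1 * cIm (symplectic_form (z s) (z s))) => //.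
  by rewrite symplectic_form_flux mulKf.
have := is_deriveZ 2^-1 d => /is_derive_eq; apply.
rewrite /GRing.scale /= cImM cReB cImB cReJ cImJ subrr mul0r add0r.
by field.
Qed.

Lemma spectral_continuous l : (forall w, entrywise_continuous (fun w => toC (H1 w)) w) ->
  (forall w, entrywise_continuous (fun w => toC (H2 w)) w) ->
  (forall w, entrywise_continuous (fun w => toC (H3 w)) w) ->
  (forall w, entrywise_continuous (fun w => toC (Delta w)) w) ->
  forall w, entrywise_continuous (F l) w.
Proof.
move=> c1 c2 c3 cD w i j.
have E (f : Omega -> R[i]) : f = (fun w => F l w i j) -> {for w, continuous f} ->
  {for w, continuous (fun w => F l w i j)} by move=> ->.
case: (split_ordP i) E => i' ->; case: (split_ordP j) => j' -> E.
- apply: (E (fun w => toC (H1 w) i' j')); last exact: c1.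
  by apply/funext => v; rewrite /F /spectral_family /hamiltonian_mx block_mxEul.
- apply: (E (fun w => toC (H3 w) i' j' + l * toC (Delta w) i' j')).
    by apply/funext => v; rewrite /F /spectral_family /hamiltonian_mx block_mxEur !mxE.
  apply: continuous_cadd; first exact: c3.
  by apply: continuous_cmul; [exact: cvg_cst | exact: cD].
- apply: (E (fun w => toC (H2 w) i' j')); last exact: c2.
  by apply/funext => v; rewrite /F /spectral_family /hamiltonian_mx block_mxEdl.
- apply: (E (fun w => 0 - toC (H1 w) j' i')).
    by apply/funext => v; rewrite /F /spectral_family /hamiltonian_mx block_mxEdr !mxE sub0r.
  by apply: continuous_csub; [exact: cvg_cst | exact: c1].
Qed.

Lemma special_solution_any l l' w (z1 : R -> 'cV[R[i]]_n) :
  solves sigma (F l) w (fun t => col_mx (z1 t) 0) ->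
  solves sigma (F l') w (fun t => col_mx (z1 t) 0).
Proof.
move=> zs t i j; have := zs t i j.
suff -> : F l' (sigma t w) *m col_mx (z1 t) 0 = F l (sigma t w) *m col_mx (z1 t) 0 by [].
by rewrite /F /spectral_family /hamiltonian_mx !mul_block_col !mulmx0 !addr0.
Qed.

End Hamiltonian.

Lemma entrywise_bounded {R : realType} (T : topologicalType) m p
    (A : T -> 'M[R[i]]_(m, p)) : compact [set: T] ->
  (forall x, entrywise_continuous A x) ->
  exists2 L : R, 0 <= L & forall x i j, `|cRe (A x i j)| <= L /\ `|cIm (A x i j)| <= L.
Proof.
move=> Tc Ac.
have /choice[L LP] : forall ij : 'I_m * 'I_p, exists L : R,
    forall x, `|cRe (A x ij.1 ij.2)| <= L /\ `|cIm (A x ij.1 ij.2)| <= L.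
  move=> [i j] /=.
  have [L1 H1] : exists L, forall x, `|cRe (A x i j)| <= L.
    apply: bounded_on_compact => // x.
    exact: (continuous_comp (Ac x i j) (@Re_continuous R _)).
  have [L2 H2] : exists L, forall x, `|cIm (A x i j)| <= L.
    apply: bounded_on_compact => // x.
    exact: (continuous_comp (Ac x i j) (@Im_continuous R _)).
  by exists (Num.max L1 L2) => x; rewrite !le_max H1 H2 orbT.
exists (\sum_ij `|L ij|) => [|x i j]; first exact: sumr_ge0.
have Lle : L (i, j) <= \sum_ij `|L ij|.
  rewrite (bigD1 (i, j))//= (le_trans (ler_norm _))// lerDl.
  exact: sumr_ge0.
by have [a b] := LP (i, j) x; rewrite !(le_trans _ Lle).
Qed.

(** * Exponential dichotomy *)

Section GraphSpace.
Context {R : realType} {n : nat}.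
Implicit Types M : 'M[R[i]]_n.

Definition graph_space M : {vspace 'cV[R[i]]_(n + n)} :=
  <<[seq col j (col_mx 1%:M M) | j : 'I_n]>>%VS.

Lemma col_mx1_mul M (u : 'cV[R[i]]_n) : col_mx 1%:M M *m u = col_mx u (M *m u).
Proof. by rewrite mul_col_mx mul1mx. Qed.

Lemma mem_graph_space M z :
  (z \in graph_space M) <-> dsubmx z = M *m usubmx z.
Proof.
pose B := row_mx (- M) 1%:M.
have BE v : B *m v = dsubmx v - M *m usubmx v.
  by rewrite -{1}[v]vsubmxK mul_row_col mul1mx mulNmx addrC.
split=> [zg|dz]; last first.
  have -> : z = col_mx 1%:M M *m usubmx z by rewrite col_mx1_mul -dz vsubmxK.
  rewrite mulmx_sum_cols; apply: memv_suml => j _; apply: memvZ.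
  by apply: memv_span; apply: map_f; rewrite mem_enum.
have : (graph_space M <= lker (linfun (mulmx B)))%VS.
  apply/span_subvP => _ /mapP[j _ ->]; rewrite memv_ker lfunE /= BE.
  by rewrite colE col_mx1_mul col_mxKd col_mxKu subrr.
by move=> /subvP/(_ z zg); rewrite memv_ker lfunE /= BE subr_eq0 => /eqP.
Qed.

Lemma graph_space_basis M : graph_of (graph_space M) M.
Proof.
rewrite /graph_of /basis_of eqxx /=.
set X := [seq _ | _ in _].
have sX : size X == n by rewrite size_map size_enum_ord.
suff : free (Tuple sX) by [].
apply/freeP => k sum0 i.
have nthX (j : 'I_n) : (Tuple sX)`_j = col j (col_mx 1%:M M).
  by rewrite /= /X (nth_map j) ?size_enum_ord// nth_ord_enum.
move: sum0; under eq_bigr do rewrite nthX.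
move/matrixP/(_ (lshift n i) 0); rewrite summxE mxE (bigD1 i)//= !mxE.
rewrite (unsplitK (inl i)) mxE eqxx mulr1 big1 ?addr0// => j ji.
by rewrite !mxE (unsplitK (inl i)) mxE eq_sym (negbTE ji) mulr0.
Qed.

Lemma dim_graph_space M : \dim (graph_space M) = n.
Proof.
have /andP[/eqP <- /eqP ->] := graph_space_basis M.
by rewrite size_map size_enum_ord.
Qed.

(** Two graphs have dimension n each, so a trivial intersection already makes them span. *)
Lemma graph_space_splitting M N :
  (forall z, z \in graph_space M -> z \in graph_space N -> z = 0) ->
  (graph_space M + graph_space N = fullv)%VS /\
  (graph_space M :&: graph_space N = 0)%VS.
Proof.
move=> MN.
have cap0 : (graph_space M :&: graph_space N = 0)%VS.
  apply/eqP; rewrite -subv0; apply/subvP => z; rewrite memv_cap memv0.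
  by move=> /andP[zM zN]; apply/eqP; exact: MN.
split=> //; apply/eqP; rewrite eqEdim subvf dimvf /=.
by rewrite dimv_disjoint_sum// !dim_graph_space /dim/= muln1.
Qed.

End GraphSpace.

(** Closedness is the openness of the complement of [P]; the columns of (I; M) form a frame over all
    of [Omega], which serves around every point. *)
Lemma closed_subbundle_graph {R : realType} (Omega : topologicalType) n
    (M : Omega -> 'M[R[i]]_n) (P : Omega -> 'cV[R[i]]_(n + n) -> Prop) :
  (forall w, entrywise_continuous M w) ->
  (forall w z, dsubmx z = M w *m usubmx z <-> P w z) ->
  (forall w z, ~ P w z -> \forall q \near (w, z), ~ P q.1 q.2) ->
  closed_subbundle (fun w => graph_space (M w)).
Proof.
move=> Mc MP Popen; split.
  rewrite (_ : mkset _ = ~` [set q | ~ P q.1 q.2]); last first.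
    apply/seteqP; split=> [q /= /mem_graph_space/MP Pq nP|q /= nnP]; first exact: nP.
    by apply/mem_graph_space/MP; apply: contrapT.
  apply: open_closedC; rewrite openE => -[w z] /= nP.
  exact: Popen.
move=> w0; exists n, (fun j w => col j (col_mx 1%:M (M w))).
apply: nearW => w; split=> [j|]; last exact: graph_space_basis.
suff colc : entrywise_continuous (fun v => col j (col_mx 1%:M (M v))) w.
  exact: (@cvg_mx _ (nbhs w) _ _ _ _ _ _ colc).
move=> i k.
case: (split_ordP i) => i' ->.
  have -> : (fun v => col j (col_mx 1%:M (M v)) (lshift n i') k) =
      (fun=> (1%:M : 'M[R[i]]_n) i' j) by apply/funext => v; rewrite mxE col_mxEu.
  exact: cvg_cst.
have -> : (fun v => col j (col_mx 1%:M (M v)) (rshift n i') k) =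
    (fun v => M v i' j) by apply/funext => v; rewrite mxE col_mxEd.
exact: Mc.
Qed.

Lemma sqrt_decay {R : realType} (C b t x y : R) : 0 <= x -> 0 <= C ->
  y <= C * expR (- b * t) * x ->
  Num.sqrt y <= Num.sqrt C * expR (- (b / 2) * t) * Num.sqrt x.
Proof.
move=> x0 C0 yx; apply: le_trans (ler_wsqrtr yx) _.
rewrite sqrtrM ?mulr_ge0 ?expR_ge0// sqrtrM//.
rewrite (_ : - b * t = - (b / 2) * t + - (b / 2) * t); last by field.
by rewrite expRD -expr2 sqrtr_sqr ger0_norm// expR_ge0.
Qed.

(** * Construction of the dichotomy for a nonreal parameter *)

Section NonrealParameter.
Context {R : realType} {n : nat} {Omega : topologicalType}.
Context (sigma : R -> Omega -> Omega) (H1 H2 H3 Delta : Omega -> 'M[R]_n).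
Hypothesis Omega_compact : compact [set: Omega].
Hypothesis flow : continuous_flow sigma.
Hypothesis H_sp : forall w, sp (hamiltonian_mx (H1 w) (H2 w) (H3 w)).
Hypothesis Delta_sym : forall w, (Delta w)^T = Delta w.
Hypothesis Delta_pos : forall w, positive_definite (Delta w).
Hypothesis H1c : forall w, entrywise_continuous (fun w => toC (H1 w)) w.
Hypothesis H2c : forall w, entrywise_continuous (fun w => toC (H2 w)) w.
Hypothesis H3c : forall w, entrywise_continuous (fun w => toC (H3 w)) w.
Hypothesis Deltac : forall w, entrywise_continuous (fun w => toC (Delta w)) w.

Let F := spectral_family H1 H2 H3 Delta.

Lemma spectral_fundamental l : exists U (c : R), [/\ 0 <= c,
  fundamental_matrix sigma (F l) U,
  forall t s w, U (t + s) w = U t (sigma s w) *m U s w,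
  forall t w, entrywise_continuous (U t) w &
  forall t w z, sqnorm (U t w *m z) <= sqnorm z * expR (c * `|t|)].
Proof.
have Fc w : entrywise_continuous (F l) w by exact: spectral_continuous.
have [L L0 FL] := entrywise_bounded Omega_compact Fc.
have FR w i j : `|cRe (F l w i j)| <= L by case: (FL w i j).
have FI w i j : `|cIm (F l w i j)| <= L by case: (FL w i j).
have [U fU] := fundamental_matrix_exists flow Fc FR FI.
exists U, (4 * L * (n + n)%:R + 1); split.
- by rewrite addr_ge0// !mulr_ge0.
- exact: fU.
- by move=> t s w; exact: (cocycle flow FR FI L0 fU).
- by move=> t w; exact: (fundamental_continuous flow Fc FR FI L0 fU).
- by move=> t w z; exact: (fundamental_growth FR FI L0 fU).
Qed.

Section Dichotomy.
Context (l : R[i]).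
Hypothesis l_nonreal : cIm l != 0.
Hypothesis no_special_solution : forall w (z1 : R -> 'cV[R[i]]_n),
  let z t : 'cV[R[i]]_(n + n) := col_mx (z1 t) 0 in
  ~ [/\ solves sigma (F l) w z, bounded_on_line z & exists t, z t != 0].

Lemma dichotomy_nonreal : exists Mp Mm,
  dichotomy_splitting sigma (F l) (fun w => graph_space (Mp w))
    (fun w => graph_space (Mm w)).
Proof.
have [U [c [c0 fU UD Uc Ug]]] := spectral_fundamental l.
have U0 w : U 0 w = 1%:M := (fU w).1.
have Us w (z : 'cV[R[i]]_(n + n)) : solves sigma (F l) w (fun t => U t w *m z).
  exact: (fundamental_solution fU).
(* With this sign the derivative of [sg * flux] is - |Im l| times the form of [Delta], hence at most
   0. *)
pose sg : R := Num.sg (cIm l).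
have sg2 : sg ^+ 2 = 1 by rewrite sqr_sg l_nonreal.
have fd w z t := flux_derivative H_sp Delta_sym t (Us w z).
have q0 w y : 0 <= cRe (hermitian_form (Delta w) y y).
  exact: Re_hermitian_form_ge0.
have mono t w z : 0 <= t -> sg * flux (U t w *m z) <= sg * flux z.
  move=> t0.
  have d (s : R) := is_deriveZ sg (fd w z s).
  have : sg * flux (U t w *m z) <= sg * flux (U 0 w *m z).
    apply: (@derive_le0_nonincreasing R (fun s => sg * flux (U s w *m z)) _ 0 t t0
      (fun s _ => d s)) => s _.
    by rewrite /GRing.scale /= mulrA mulrN /sg -normrEsg mulNr oppr_le0 mulr_ge0.
  by rewrite U0 mul1mx.
have rigid0 w z : - cIm l * cRe (hermitian_form (Delta (sigma 0 w))
    (dsubmx (U 0 w *m z)) (dsubmx (U 0 w *m z))) = 0 -> dsubmx z = 0.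
  move/eqP; rewrite mulf_eq0 oppr_eq0 (negbTE l_nonreal) /= U0 mul1mx => /eqP H.
  apply/eqP; apply: contrapT => /negP dz.
  by have := Re_hermitian_form_gt0 (Delta_pos (sigma 0 w)) dz; rewrite H ltxx.
have rigid w z : (forall t, 0 <= t -> flux (U t w *m z) = flux z) -> dsubmx z = 0.
  move=> fz; apply: (rigid0 w); apply: is_derive_right_cst (fd w z 0) _ => t t0.
  by rewrite fz// U0 mul1mx.
have rigid' w z : (forall t, 0 <= t -> flux (U (- t) w *m z) = flux z) -> dsubmx z = 0.
  move=> fz; apply: (rigid0 w); apply: is_derive_left_cst (fd w z 0) _ => t t0.
  by rewrite -[t]opprK fz ?oppr_ge0// U0 mul1mx.
have nosp w z K : (forall t, sqnorm (U t w *m z) <= K) ->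
    (forall t, dsubmx (U t w *m z) = 0) -> z = 0.
  move=> zK dz; apply/eqP; apply: contrapT => /negP z0.
  apply: (@no_special_solution w (fun t => usubmx (U t w *m z))).
  have E t : col_mx (usubmx (U t w *m z)) 0 = U t w *m z.
    by rewrite -(dz t) vsubmxK.
  split.
  - by under eq_fun do rewrite E; exact: Us.
  - exists (Num.sqrt K) => t.
    by rewrite E euclidean_normE ler_wsqrtr.
  - by exists 0; rewrite E U0 mul1mx.
pose sigma' t := sigma (- t); pose U' t := U (- t).
have U0' w : U' 0 w = 1%:M by rewrite /U' oppr0.
have UD' t s w : U' (t + s) w = U' t (sigma' s w) *m U' s w.
  by rewrite /U' opprD UD.
have Uc' t w : entrywise_continuous (U' t) w by exact: Uc.
have Ug' t w z : sqnorm (U' t w *m z) <= sqnorm z * expR (c * `|t|).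
  by rewrite -normrN; exact: Ug.
have sg2' : (- sg) ^+ 2 = 1 by rewrite sqrrN.
have mono' t w z : 0 <= t -> - sg * flux (U' t w *m z) <= - sg * flux z.
  move=> t0; rewrite !mulNr lerN2.
  have := mono t (sigma (- t) w) (U (- t) w *m z) t0.
  by rewrite mulmxA -UD subrr U0 mul1mx.
have nosp' w z K : (forall t, sqnorm (U' t w *m z) <= K) ->
    (forall t, dsubmx (U' t w *m z) = 0) -> z = 0.
  move=> zK dz; apply: (nosp w z K) => t; rewrite -[t]opprK; [exact: zK|exact: dz].
have [Mp [Mpc MpP]] := forward_weyl_matrix Omega_compact U0 UD Uc Ug c0 sg2 mono rigid nosp.
have [Mm [Mmc MmP]] :=
  forward_weyl_matrix Omega_compact U0' UD' Uc' Ug' c0 sg2' mono' rigid' nosp'.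
have [Cp [bp [Cp1 bp0 decp _]]] := uniform_decay Omega_compact U0 UD Uc Ug c0 sg2 mono rigid nosp.
have [Cm [bm [Cm1 bm0 decm _]]] :=
  uniform_decay Omega_compact U0' UD' Uc' Ug' c0 sg2' mono' rigid' nosp'.
exists Mp, Mm; split.
- apply: closed_subbundle_graph Mpc MpP _ => w z.
  exact: (not_forward_bounded_near Omega_compact U0 UD Uc Ug c0 sg2 mono rigid nosp).
- apply: closed_subbundle_graph Mmc MmP _ => w z.
  exact: (not_forward_bounded_near Omega_compact U0' UD' Uc' Ug' c0 sg2' mono' rigid' nosp').
(* A vector in both fibres has an orbit that is bounded on the whole line. *)
- move=> w; apply: graph_space_splitting => z.
  move=> /mem_graph_space/MpP[K zK] /mem_graph_space/MmP[K' zK'].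
  apply: (no_bounded_orbit Omega_compact U0 UD Uc sg2 mono rigid nosp
    (w := w) (K := Num.max K K')) => t.
  rewrite le_max; have [t0|t0] := leP 0 t; first by rewrite zK.
  by have := zK' (- t); rewrite /U' opprK => ->; rewrite ?orbT// oppr_ge0 ltW.
(* One constant and one rate for both ends. Passing from [sqnorm] to the norm takes the root of [C]
   and halves [b]. *)
pose C := Num.max Cp Cm; pose b := Num.min bp bm.
have b0 : 0 < b by rewrite lt_min bp0.
have C0 : 0 <= C by rewrite le_max (le_trans ler01 Cp1).
exists U, (Num.sqrt C), (b / 2); split.
- exact: fU.
- by rewrite -sqrtr1 ler_wsqrtr// le_max Cp1.
- by rewrite divr_gt0.
- move=> t w z; split=> /mem_graph_space H; apply/mem_graph_space.
    by apply/MpP; move/MpP : H; exact: (forward_bounded_orbit UD Ug c0).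
  apply/MmP; move/MmP : H => /(forward_bounded_orbit UD' Ug' c0 (- t)).
  by rewrite /sigma' /U' opprK.
- move=> t w z; rewrite !euclidean_normE; split=> t0 /mem_graph_space.
    move=> /MpP[K zK]; apply: sqrt_decay (sqnorm_ge0 _) C0 _.
    apply: le_trans (decp w z K zK t t0) _.
    rewrite ler_wpM2r ?sqnorm_ge0// ler_pM ?expR_ge0 ?(le_trans ler01)//.
      by rewrite le_max lexx.
    by rewrite ler_expR !mulNr lerN2 ler_wpM2r// ge_min lexx.
  move=> /MmP[K zK].
  have -> : b / 2 * t = - (b / 2) * (- t) by rewrite mulrNN.
  apply: sqrt_decay (sqnorm_ge0 _) C0 _.
  have nt0 : 0 <= - t by rewrite oppr_ge0.
  have := decm w z K zK (- t) nt0; rewrite /U' opprK => /le_trans; apply.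
  rewrite ler_wpM2r ?sqnorm_ge0// ler_pM ?expR_ge0 ?(le_trans ler01)//.
    by rewrite le_max lexx orbT.
  by rewrite ler_expR !mulNr lerN2 ler_wpM2r// ge_min lexx orbT.
Qed.

End Dichotomy.
End NonrealParameter.

(** * What a given dichotomy implies for individual solutions *)

Lemma exp_decay_le0 {R : realType} (a K b : R) : 0 < b ->
  (forall t, 0 <= t -> a <= K * expR (- b * t)) -> a <= 0.
Proof.
move=> b0 aK; rewrite leNgt; apply/negP => a0.
have K0 : 0 < K.
  by have := aK 0 (lexx 0); rewrite mulr0 expR0 mulr1; exact: lt_le_trans.
(* At t = K / (a b) the inequality exp (b t) >= 1 + b t gives a exp (b t) >= a + K > K. *)
have t0 : 0 <= K / (a * b) by rewrite ltW// divr_gt0// mulr_gt0.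
have := aK _ t0; rewrite mulNr expRN ler_pdivlMr ?expR_gt0//.
apply/negP; rewrite -ltNge.
have -> : b * (K / (a * b)) = K / a by field; rewrite !gt_eqF.
apply: lt_le_trans (_ : a * (1 + K / a) <= _); last first.
  by rewrite ler_wpM2l ?expR_ge1Dx// ltW.
by rewrite mulrDr mulr1 mulrCA divff ?gt_eqF// mulr1 ltrDr.
Qed.

Section DichotomyConsequences.
Context {R : realType} {Omega : topologicalType} (sigma : R -> Omega -> Omega).
Hypothesis flow : continuous_flow sigma.
Context {m : nat} (A : Omega -> 'M[R[i]]_m) (L : R).
Hypothesis ARe : forall w i j, `|cRe (A w i j)| <= L.
Hypothesis AIm : forall w i j, `|cIm (A w i j)| <= L.
Hypothesis L0 : 0 <= L.

(** Split the initial value into p + q. Forward in time the solution and its p part are bounded,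
    hence so is the q part, while |q| <= eta exp (- beta t) |U t q|; thus q = 0. Then p = 0 by the
    same argument from the past. *)
Lemma dichotomy_bounded_solution_eq0 Lp Lm w (z : R -> 'cV[R[i]]_m) :
  dichotomy_splitting sigma A Lp Lm -> solves sigma A w z -> bounded_on_line z ->
  forall t, z t = 0.
Proof.
move=> [_ _ split_pm [U [eta [beta [fU eta1 beta0 inv est]]]]] zs [K zK].
have UD := cocycle flow ARe AIm L0 fU.
have U0 v : U 0 v = 1%:M := (fU v).1.
have zU := solution_fundamental ARe AIm L0 fU zs.
have : z 0 \in (Lp w + Lm w)%VS by rewrite (split_pm w).1 memvf.
move=> /memv_addP[p pL [q qL zpq]].
have eta0 : 0 <= eta := le_trans ler01 eta1.
have KK t : sqnorm (z t) <= K ^+ 2.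
  have := zK t; rewrite euclidean_normE => H.
  rewrite -(sqr_sqrtr (sqnorm_ge0 (z t))) ler_sqr ?nnegrE ?sqrtr_ge0//.
  exact: le_trans (sqrtr_ge0 _) H.
have euclid0 (v : 'cV[R[i]]_m) : euclidean_norm v <= 0 -> v = 0.
  rewrite euclidean_normE => H; apply: sqnorm_eq0; apply/eqP.
  rewrite eq_le sqnorm_ge0 andbT leNgt -sqrtr_gt0 -leNgt //.
have euclid_le (v : 'cV[R[i]]_m) (c : R) : sqnorm v <= c -> euclidean_norm v <= Num.sqrt c.
  by rewrite euclidean_normE; exact: ler_wsqrtr.
have inv_orbit t (v : 'cV[R[i]]_m) : U (- t) (sigma t w) *m (U t w *m v) = v.
  by rewrite mulmxA -UD addNr U0 mul1mx.
have expb t : 0 <= t -> expR (- beta * t) <= 1.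
  by move=> t0; rewrite -expR0 ler_expR mulNr oppr_le0 mulr_ge0// ltW.
have q0 : q = 0.
  apply: euclid0; pose N := 2 * K ^+ 2 + 2 * (eta * euclidean_norm p) ^+ 2.
  apply: (exp_decay_le0 (K := eta * Num.sqrt N) beta0) => t t0.
  have tneg : - t <= 0 by rewrite oppr_le0.
  have := (est (- t) (sigma t w) (U t w *m q)).2 tneg ((inv t w q).2 qL).
  rewrite inv_orbit mulrN -mulNr => /le_trans; apply.
  rewrite mulrAC ler_wpM2r ?expR_ge0// ler_wpM2l//.
  apply: euclid_le.
  have -> : U t w *m q = z t + (- 1) *: (U t w *m p).
    by rewrite zU zpq mulmxDr scaleN1r addrC addKr.
  apply: le_trans (sqnormD_le _ _) _; rewrite /N lerD// ler_pM2l//.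
  have -> : (-1 : R[i]) = (-1)%:C%C by rewrite rmorphN1.
  rewrite sqnormZ abs2_real sqrrN expr1n mul1r.
  rewrite -(sqr_sqrtr (sqnorm_ge0 _)) -euclidean_normE.
  rewrite ler_sqr ?nnegrE ?mulr_ge0 ?sqrtr_ge0//.
  apply: le_trans ((est t w p).1 t0 pL) _.
  by rewrite ler_wpM2r ?sqrtr_ge0// ler_piMr// expb.
move: zpq; rewrite q0 addr0 => zp.
have p0 : p = 0.
  apply: euclid0.
  apply: (exp_decay_le0 (K := eta * Num.sqrt (K ^+ 2)) beta0) => t t0.
  have := (est t (sigma (- t) w) (U (- t) w *m p)).1 t0 ((inv (- t) w p).1 pL).
  have := inv_orbit (- t) p; rewrite opprK => -> /le_trans; apply.
  rewrite mulrAC ler_wpM2r ?expR_ge0// ler_wpM2l//.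
  by apply: euclid_le; rewrite -zp -zU.
by move=> t; rewrite zU zp p0 mulmx0.
Qed.

(** The form in which the kernel argument uses a dichotomy; squaring the norm doubles the rate. *)
Lemma dichotomy_decay Lp Lm : dichotomy_splitting sigma A Lp Lm ->
  (forall w z, z \in Lp w -> exists2 y : R -> 'cV[R[i]]_m,
     solves sigma A w y /\ y 0 = z & exists K b, 0 < b /\
     forall t, 0 <= t -> sqnorm (y t) <= K * expR (- b * t)) /\
  (forall w z, z \in Lm w -> exists2 y : R -> 'cV[R[i]]_m,
     solves sigma A w y /\ y 0 = z & exists K b, 0 < b /\
     forall t, 0 <= t -> sqnorm (y (- t)) <= K * expR (- b * t)).
Proof.
move=> [_ _ split_pm [U [eta [beta [fU eta1 beta0 inv est]]]]].
have eta0 : 0 <= eta := le_trans ler01 eta1.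
have sq (x y t : R) : 0 <= x -> 0 <= y -> x <= eta * expR (- beta * t) * y ->
    x ^+ 2 <= (eta * y) ^+ 2 * expR (- (2 * beta) * t).
  move=> x0 y0 H.
  have -> : expR (- (2 * beta) * t) = expR (- beta * t) ^+ 2.
    by rewrite expr2 -expRD; congr expR; ring.
  rewrite -exprMn ler_sqr ?nnegrE ?mulr_ge0 ?expR_ge0//.
  by rewrite mulrAC.
split=> w z zL; exists (fun t => U t w *m z).
- by split; [exact: (fundamental_solution fU) | rewrite (fU w).1 mul1mx].
- exists ((eta * euclidean_norm z) ^+ 2), (2 * beta); split; first by rewrite mulr_gt0.
  move=> t t0; rewrite -(sqr_sqrtr (sqnorm_ge0 _)) -euclidean_normE.
  by apply: sq; rewrite ?sqrtr_ge0//; exact: (est t w z).1.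
- by split; [exact: (fundamental_solution fU) | rewrite (fU w).1 mul1mx].
- exists ((eta * euclidean_norm z) ^+ 2), (2 * beta); split; first by rewrite mulr_gt0.
  move=> t t0; rewrite -(sqr_sqrtr (sqnorm_ge0 _)) -euclidean_normE.
  apply: sq; rewrite ?sqrtr_ge0// mulNr -mulrN; apply: (est (- t) w z).2 => //.
  by rewrite oppr_le0.
Qed.

End DichotomyConsequences.

(** * Herglotz functions *)

Lemma abs_Re_mul_le {R : realType} (a b : R[i]) : `|cRe (a * b)| <= abs2 a + abs2 b.
Proof.
rewrite cReM /abs2; move: (cRe a) (cIm a) (cRe b) (cIm b) => p q r s.
have := sqr_ge0 (p - r); have := sqr_ge0 (p + r).
have := sqr_ge0 (q - s); have := sqr_ge0 (q + s).
have := sqr_ge0 p; have := sqr_ge0 q; have := sqr_ge0 r; have := sqr_ge0 s.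
by move=> *; rewrite ler_norml; apply/andP; split; nra.
Qed.

Lemma abs2J {R : realType} (a : R[i]) : abs2 (conjc a) = abs2 a.
Proof. by rewrite /abs2 cReJ cImJ sqrrN. Qed.

Lemma signed_mono {R : realType} (G : R -> R) (s t : R) : s ^+ 2 = 1 ->
  (forall t u, t <= u -> G t <= G u) -> 0 <= t -> s * G 0 <= s * G (s * t).
Proof.
move=> s2 mono t0.
have /orP[/eqP-> | /eqP->] : (s == 1) || (s == -1) by rewrite -sqrf_eq1 s2.
  by rewrite !mul1r mono.
by rewrite !mulN1r lerN2 mono// oppr_le0.
Qed.

Section SymplecticAlgebra.
Context {R : realType} {n : nat}.
Implicit Types x y z : 'cV[R[i]]_(n + n).

Lemma symplectic_form_sum y z : symplectic_form y z =
  \sum_i (conjc (y (lshift n i) 0) * z (rshift n i) 0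
    - conjc (y (rshift n i) 0) * z (lshift n i) 0).
Proof.
rewrite /symplectic_form mxE [X in _ + X]mxE !mxE -sumrB.
by apply: eq_bigr => i _; rewrite !mxE.
Qed.

Lemma abs_Re_symplectic_le y z (k : R[i]) :
  `|cRe (symplectic_form y z * k)| <= sqnorm y + abs2 k * sqnorm z.
Proof.
rewrite symplectic_form_sum mulr_suml cRe_sum !sqnorm_split /sqnorm.
apply: le_trans (ler_norm_sum _ _ _) _.
rewrite -!big_split/= mulr_sumr -big_split/=; apply: ler_sum => i _.
rewrite !mxE mulrBl cReB -!mulrA.
have := abs_Re_mul_le (conjc (y (lshift n i) 0)) (z (rshift n i) 0 * k).
have := abs_Re_mul_le (conjc (y (rshift n i) 0)) (z (lshift n i) 0 * k).
have := ler_normB (cRe (conjc (y (lshift n i) 0) * (z (rshift n i) 0 * k)))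
  (cRe (conjc (y (rshift n i) 0) * (z (lshift n i) 0 * k))).
rewrite !abs2J !abs2M; lra.
Qed.

Lemma hermitian_form_suml (D : 'M[R]_n) (I : finType) (y : I -> 'cV[R[i]]_n) :
  \sum_i \sum_j hermitian_form D (y i) (y j) =
  hermitian_form D (\sum_i y i) (\sum_i y i).
Proof.
rewrite /hermitian_form.
have -> : ctr (\sum_i y i) = \sum_i ctr (y i).
  apply/matrixP => a b; rewrite !mxE !summxE rmorph_sum.
  by apply: eq_bigr => i _; rewrite !mxE.
rewrite !mulmx_suml summxE; apply: eq_bigr => i _.
by rewrite mulmx_sumr summxE.
Qed.

End SymplecticAlgebra.

Section Kernel.
Context {R : realType} {n : nat} {Omega : topologicalType}.
Context (sigma : R -> Omega -> Omega) (H1 H2 H3 Delta : Omega -> 'M[R]_n).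
Hypothesis H_sp : forall w, sp (hamiltonian_mx (H1 w) (H2 w) (H3 w)).
Hypothesis Delta_sym : forall w, (Delta w)^T = Delta w.
Hypothesis Delta_pos : forall w, positive_definite (Delta w).
Let F := spectral_family H1 H2 H3 Delta.

(* [s] is 1 for decay in the future and -1 for decay in the past. *)
Definition decays (s : R) (y : R -> 'cV[R[i]]_(n + n)) : Prop :=
  exists K b, 0 < b /\ forall t, 0 <= t -> sqnorm (y (s * t)) <= K * expR (- b * t).

Lemma decaysZ s y (k : R[i]) : decays s y -> decays s (fun t => k *: y t).
Proof.
move=> [K [b [b0 yK]]]; exists (abs2 k * K), b; split=> // t t0.
by rewrite sqnormZ -mulrA ler_wpM2l ?abs2_ge0// yK.
Qed.

Lemma solvesZ l w y (k : R[i]) : solves sigma (F l) w y ->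
  solves sigma (F l) w (fun t => k *: (y t : 'cV[R[i]]_(n + n))).
Proof.
move=> ys t i j; rewrite -scalemxAr mxE.
have -> : (fun s => (k *: y s) i j) = (fun s => k * y s i j).
  by apply/funext => s; rewrite mxE.
exact: (has_derivativeZ k (ys t i j)).
Qed.

Lemma decays_conj s (y : R -> 'cV[R[i]]_(n + n)) : decays s y ->
  decays s (fun t => map_mx conjc (y t)).
Proof.
move=> [K [b [b0 yK]]]; exists K, b; split=> // t t0.
apply: le_trans (yK t t0); rewrite le_eqVlt; apply/orP; left; apply/eqP.
by rewrite /sqnorm; apply: eq_bigr => i _; rewrite mxE abs2J.
Qed.

Lemma spectral_conj l w : map_mx conjc (F l w) = F (conjc l) w.
Proof.
rewrite /F /spectral_family /hamiltonian_mx map_block_mx.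
have realc (B : 'M[R]_n) : map_mx conjc (map_mx (fun x : R => x%:C%C) B) =
    map_mx (fun x : R => x%:C%C) B by apply/matrixP => i j; rewrite !mxE conjc_real.
congr block_mx; rewrite ?realc//.
  by rewrite map_mxD map_mxZ !realc.
by apply/matrixP => i j; rewrite !mxE; apply: complex_eqP; rewrite /= ?opprK ?oppr0.
Qed.

Lemma solves_conj l w (y : R -> 'cV[R[i]]_(n + n)) : solves sigma (F l) w y ->
  solves sigma (F (conjc l)) w (fun t => map_mx conjc (y t)).
Proof.
move=> ys t i j; rewrite -spectral_conj -map_mxM mxE.
have -> : (fun s => map_mx conjc (y s) i j) = (fun s => conjc (y s i j)).
  by apply/funext => s; rewrite mxE.
exact: (has_derivativeJ (ys t i j)).
Qed.

(* The double sum has derivative - Y^* Delta Y with Y the sum of the lower halves,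
   hence is monotone, and it vanishes at the end where the solutions decay. *)
Lemma kernel_ge0 (I : finType) (p : I -> R[i]) w
    (y : I -> R -> 'cV[R[i]]_(n + n)) (s : R) : s ^+ 2 = 1 ->
  (forall i, solves sigma (F (p i)) w (y i)) -> (forall i, decays s (y i)) ->
  (forall i j, p j - conjc (p i) != 0) ->
  0 <= s * cRe (\sum_i \sum_j symplectic_form (y i 0) (y j 0) / (p j - conjc (p i))).
Proof.
move=> s2 ys yd p0.
(* Differentiation cancels each denominator up to the factor -1; the sign in front makes [G]
   nondecreasing. *)
pose G t := - cRe (\sum_i \sum_j symplectic_form (y i t) (y j t) / (p j - conjc (p i))).
have Gd (t : R) : exists2 d : R, 0 <= d & is_derive t 1 G d.
  pose Y := \sum_i dsubmx (y i t).
  exists (cRe (hermitian_form (Delta (sigma t w)) Y Y)).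
    exact: Re_hermitian_form_ge0.
  have D i j : has_derivative (fun u => symplectic_form (y i u) (y j u) /
      (p j - conjc (p i))) t
      (- hermitian_form (Delta (sigma t w)) (dsubmx (y i t)) (dsubmx (y j t))).
    have := has_derivativeZ (p j - conjc (p i))^-1
      (symplectic_form_derivative H_sp Delta_sym t (ys i) (ys j)).
    have -> : (fun u => (p j - conjc (p i))^-1 * symplectic_form (y i u) (y j u)) =
        (fun u => symplectic_form (y i u) (y j u) / (p j - conjc (p i))).
      by apply/funext => u; rewrite mulrC.
    congr has_derivative.
    by rewrite mulrA -[conjc (p i) - _]opprB mulrN mulVf// mulN1r.
  have [DR _] := has_derivative_sum (index_enum I)
    (fun i => has_derivative_sum (index_enum I) (D i)).
  have := is_deriveN DR.
  congr is_derive; rewrite -hermitian_form_suml//.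
  by under eq_bigr do rewrite sumrN; rewrite sumrN cReN opprK.
have Gmono t u : t <= u -> G t <= G u.
  move=> tu; have /choice[d dP] : forall t : R, exists d : R, 0 <= d /\ is_derive t 1 G d.
    by move=> v; have [d d0 dd] := Gd v; exists d.
  rewrite -lerN2.
  apply: (@derive_le0_nonincreasing R (fun v => - G v) (fun v => - d v) t u tu) => v _.
    by have [_ ?] := dP v; apply: is_deriveN.
  by rewrite oppr_le0; case: (dP v).
have GE : s * cRe (\sum_i \sum_j symplectic_form (y i 0) (y j 0) /
    (p j - conjc (p i))) = - (s * G 0) by rewrite /G mulrN opprK.
rewrite GE oppr_ge0.
have /choice[K /choice[b Kb]] := yd.
(* The slowest of the rates, capped by 1, which keeps it positive for an empty family. *)
pose b' := \big[Num.min/1]_i b i.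
have b'0 : 0 < b'.
  by rewrite /b'; elim/big_ind: _ => [|u v u0 v0|i _]; rewrite ?ltr01 ?lt_min ?u0//; case: (Kb i).
pose C i j := `|K i| + abs2 (p j - conjc (p i))^-1 * `|K j|.
apply: (exp_decay_le0 (K := \sum_i \sum_j C i j) b'0) => t t0.
(* Time 0 is compared with the time s t, at which all the solutions are small, for s = 1 and s = -1
   alike. *)
apply: (@le_trans _ _ (s * G (s * t))).
  exact: (signed_mono s2 Gmono t0).
have sn := norm_sign s2.
apply: le_trans (ler_norm _) _; rewrite normrM sn mul1r /G normrN cRe_sum.
apply: le_trans (ler_norm_sum _ _ _) _; rewrite mulr_suml; apply: ler_sum => i _.
rewrite cRe_sum; apply: le_trans (ler_norm_sum _ _ _) _.
rewrite mulr_suml; apply: ler_sum => j _.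
apply: le_trans (abs_Re_symplectic_le _ _ _) _.
have small k : sqnorm (y k (s * t)) <= `|K k| * expR (- b' * t).
  have [b0 kK] := Kb k; apply: le_trans (kK t t0) _.
  apply: (@le_trans _ _ (`|K k| * expR (- b k * t))).
    by rewrite ler_wpM2r ?expR_ge0// ler_norm.
  by rewrite ler_wpM2l// ler_expR !mulNr lerN2 ler_wpM2r// bigmin_le_cond.
have -> : C i j * expR (- b' * t) = `|K i| * expR (- b' * t) +
    abs2 (p j - conjc (p i))^-1 * (`|K j| * expR (- b' * t)) by rewrite /C; ring.
by apply: lerD; [exact: small | rewrite ler_wpM2l ?abs2_ge0//; exact: small].
Qed.

End Kernel.

(** * From kernel inequalities to complex differentiability *)

Lemma abs2V {R : realType} (a : R[i]) : abs2 a^-1 = (abs2 a)^-1.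
Proof.
have [->|a0] := eqVneq a 0; first by rewrite invr0 /abs2/= expr0n/= addr0 invr0.
have : abs2 a != 0 by apply: contra a0 => /eqP/abs2_eq0 ->.
move=> n0; apply: (mulIf n0); rewrite -abs2M mulVf// mulVf//.
by rewrite /abs2/= expr1n expr0n addr0.
Qed.

Lemma cvg_abs2 {R : realType} (T : Type) (F : set_system T) (FF : Filter F)
    (f : T -> R[i]) (l : R[i]) :
  (forall e, 0 < e -> \forall x \near F, abs2 (l - f x) < e) -> f x @[x --> F] --> l.
Proof.
move=> fl; apply: cvg_complex; apply/cvgrPdist_lt => e e0;
  apply: filterS (fl _ (exprn_gt0 2 e0)) => x; rewrite /abs2 cReB cImB => H;
  rewrite -sqrtr_sqr -(ger0_norm (ltW e0)) -(sqrtr_sqr e);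
  rewrite ltr_sqrt ?exprn_gt0//; apply: le_lt_trans H;
  by rewrite ?lerDl ?lerDr sqr_ge0.
Qed.

Lemma near_abs2_small {R : realType} (z : R[i]) (e : R) : 0 < e ->
  \forall w \near z, abs2 (z - w) < e.
Proof.
move=> e0; have s0 : 0 < Num.sqrt e by rewrite sqrtr_gt0.
by apply: filterS (near_abs2_lt z s0) => w; rewrite sqr_sqrtr// ltW.
Qed.

Lemma continuous_conjc {R : realType} (T : topologicalType) (f : T -> R[i]) x :
  {for x, continuous f} -> {for x, continuous (fun t => conjc (f t))}.
Proof.
move=> fc; apply: (@cvg_complex R _ (nbhs x)).
  rewrite cReJ; under eq_fun do rewrite cReJ.
  exact: (continuous_comp fc (@Re_continuous R _)).
rewrite cImJ; under eq_fun do rewrite cImJ.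
exact: (continuousN (continuous_comp fc (@Im_continuous R _))).
Qed.

Section DifferenceQuotients.
Context {R : realType} (lam : R[i]) (f g : R[i] -> R[i]) (D : set R[i]) (s K K2 : R).
Hypothesis lam_nonreal : cIm lam != 0.
Hypothesis s2 : s ^+ 2 = 1.
Hypothesis nearD : \forall mu \near lam, D mu.

(** The Nevanlinna-Pick kernel of a scalar function; [f] will be a diagonal entry of a Weyl matrix
    and [g] an arbitrary one. *)
Definition pick_kernel (mu nu : R[i]) : R[i] :=
  (f nu - conjc (f mu)) / (nu - conjc mu).

(* Tends to 0 as mu and nu tend to [lam], provided that [f] is continuous there; so
   [g_quotients] says that the difference quotients of [g] are Cauchy. *)
Definition pick_defect (mu nu : R[i]) : R[i] :=
  pick_kernel mu mu + pick_kernel nu nu - pick_kernel mu nu - pick_kernel nu mu.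

Hypothesis f_quotient : forall mu, D mu -> mu != lam ->
  abs2 ((f mu - f lam) / (mu - lam)) <= K * (s * (cIm (f mu) / cIm mu)).
Hypothesis g_quotients : forall mu nu, D mu -> mu != lam -> D nu -> nu != lam ->
  abs2 ((g mu - g lam) / (mu - lam) - (g nu - g lam) / (nu - lam)) <=
    K2 * (s * cRe (pick_defect mu nu)).

(** The bound on the quotient involves f(mu) itself. With x = |f(mu) - f(lam)|^2 and d = |mu -
    lam|^2 it takes the form x <= C d (B + x), and for small d the term with x is absorbed on the
    left. *)
Lemma pick_continuous : {for lam, continuous f}.
Proof.
apply: (@cvg_abs2 R _ (nbhs lam)) => e e0.
pose m := `|cIm lam| / 2.
have m0 : 0 < m by rewrite divr_gt0// normr_gt0.
pose B := `|cIm (f lam)| + 1.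
have B0 : 0 < B by rewrite ltr_wpDl.
pose K' := `|K| + 1.
have K'0 : 0 < K' by rewrite ltr_wpDl.
(* For d below the first number the coefficient of x is at most 1/2; below the second, twice the
   remaining term is less than [e]. The margin [m] keeps Im mu away from 0. *)
have e1 : 0 < Num.min (m / (2 * K')) (e * m / (2 * K' * B)).
  have tK : 0 < 2 * K' by rewrite mulr_gt0.
  have em : 0 < e * m by rewrite mulr_gt0.
  by rewrite lt_min (divr_gt0 m0 tK) (divr_gt0 em (mulr_gt0 tK B0)).
have nIm : \forall mu \near lam, `|cIm lam - cIm mu| < m.
  by move/(@cvgrPdist_lt _ _ _ (nbhs lam)): (@Im_continuous R lam); exact.
near=> mu.
have [->|mulam] := eqVneq mu lam; first by rewrite subrr /abs2/= expr0n/= addr0.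
have Dmu : D mu by near: mu; exact: nearD.
have mun : `|cIm lam - cIm mu| < m by near: mu; exact: nIm.
have dl : abs2 (lam - mu) < Num.min (m / (2 * K')) (e * m / (2 * K' * B)).
  by near: mu; exact: (near_abs2_small lam e1).
have Immu : m <= `|cIm mu|.
  have := ler_normD (cIm lam - cIm mu) (cIm mu); rewrite subrK.
  have : `|cIm lam| = m + m by rewrite /m -splitr.
  by move=> ->; lra.
have := f_quotient Dmu mulam; rewrite abs2M abs2V.
have E1 : abs2 (f mu - f lam) = abs2 (f lam - f mu) by rewrite /abs2 !cReB !cImB; ring.
have E2 : abs2 (mu - lam) = abs2 (lam - mu) by rewrite /abs2 !cReB !cImB; ring.
rewrite E1 E2.
set x := abs2 (f lam - f mu); set d := abs2 (lam - mu) in dl *.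
have x0 : 0 <= x := abs2_ge0 _.
have d0 : 0 < d.
  rewrite lt0r abs2_ge0 andbT; apply: contra mulam => /eqP/abs2_eq0/eqP.
  by rewrite subr_eq0 eq_sym.
rewrite ler_pdivrMr// => H.
have ImB : `|cIm (f mu)| <= B + x.
  have : `|cIm (f lam - f mu)| <= 1 + x.
    rewrite /x /abs2; move: (cRe _) (cIm _) => a b.
    have := sqr_ge0 a; have := sqr_ge0 (b - 1); have := sqr_ge0 (b + 1).
    by have := sqr_ge0 b => *; rewrite ler_norml; apply/andP; split; nra.
  have := ler_normB (cIm (f lam)) (cIm (f lam - f mu)).
  by rewrite cImB opprB addrC subrK /B; lra.
have s1 := norm_sign s2.
have bound : K * (s * (cIm (f mu) / cIm mu)) <= K' * ((B + x) / m).
  have q : `|cIm (f mu) / cIm mu| <= (B + x) / m.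
    rewrite normf_div ler_pdivrMr ?(lt_le_trans m0)//.
    apply: le_trans ImB _; rewrite mulrAC ler_pdivlMr// ler_wpM2l//.
    by rewrite addr_ge0// ltW.
  apply: le_trans (ler_norm _) _; rewrite normrM (normrM s) s1 mul1r.
  by apply: ler_pM => //; rewrite lerDl.
have Hx : x <= K' * ((B + x) / m) * d.
  by apply: le_trans H _; rewrite ler_wpM2r// ltW.
move: dl; rewrite lt_min => /andP[dl1 dl2].
have h1 : K' * d / m <= 1 / 2.
  rewrite ler_pdivrMr// -ler_pdivlMl// (le_trans (ltW dl1))//.
  by rewrite le_eqVlt; apply/orP; left; apply/eqP; field; rewrite gt_eqF.
have h2 : 2 * (K' * d / m) * B < e.
  have -> : 2 * (K' * d / m) * B = d * (2 * K' * B) / m by field; rewrite gt_eqF.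
  by rewrite ltr_pdivrMr// -ltr_pdivlMr ?mulr_gt0.
have Hx2 : x <= K' * d / m * B + K' * d / m * x.
  by apply: le_trans Hx _; rewrite le_eqVlt; apply/orP; left; apply/eqP; ring.
have : K' * d / m * x <= 1 / 2 * x by rewrite ler_wpM2r.
by move: h2 Hx2; move: (K' * d / m) => q *; lra.
Unshelve. all: by end_near. Qed.

(** At (lam, lam) the four terms of the defect cancel, and the defect is continuous there because
    [f] is and lam - conj lam is nonzero. So the quotients of [g] are Cauchy; completeness of [R] is
    applied to their real and imaginary parts. *)
Lemma pick_derivable : derivable g lam 1.
Proof.
pose P (p : R[i] * R[i]) := K2 * (s * cRe (pick_defect p.1 p.2)).
have fc := pick_continuous.
have den : lam - conjc lam != 0.
  apply: contra lam_nonreal => /eqP/(congr1 (@cIm R)).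
  by rewrite cImB cImJ opprK /= => H; apply/eqP; lra.
have c1 : {for (lam, lam), continuous (fun p : R[i] * R[i] => p.1)} by exact: cvg_fst.
have c2 : {for (lam, lam), continuous (fun p : R[i] * R[i] => p.2)} by exact: cvg_snd.
have f1 : {for (lam, lam), continuous (fun p : R[i] * R[i] => f p.1)}.
  exact: (@continuous_comp _ _ _ (@fst R[i] R[i]) f (lam, lam) c1 fc).
have f2 : {for (lam, lam), continuous (fun p : R[i] * R[i] => f p.2)}.
  exact: (@continuous_comp _ _ _ (@snd R[i] R[i]) f (lam, lam) c2 fc).
have kc (u v : R[i] * R[i] -> R[i]) : u (lam, lam) = lam -> v (lam, lam) = lam ->
    {for (lam, lam), continuous u} -> {for (lam, lam), continuous v} ->
    {for (lam, lam), continuous (fun p => f (u p))} ->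
    {for (lam, lam), continuous (fun p => f (v p))} ->
    {for (lam, lam), continuous (fun p => pick_kernel (u p) (v p))}.
  move=> ul vl uc vc fu fv.
  have num := continuous_csub fv (continuous_conjc fu).
  have dn := continuous_csub vc (continuous_conjc uc).
  have dn0 : v (lam, lam) - conjc (u (lam, lam)) != 0 by rewrite ul vl.
  exact: (continuous_cmul num (cvgV dn0 dn)).
have k11 := kc _ _ (erefl _) (erefl _) c1 c1 f1 f1.
have k22 := kc _ _ (erefl _) (erefl _) c2 c2 f2 f2.
have k12 := kc _ _ (erefl _) (erefl _) c1 c2 f1 f2.
have k21 := kc _ _ (erefl _) (erefl _) c2 c1 f2 f1.
have dc := continuous_csub (continuous_csub (continuous_cadd k11 k22) k12) k21.
have Rc := continuous_comp dc (@Re_continuous R _).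
have Pc : {for (lam, lam), continuous P}.
  have cs : {for (lam, lam), continuous (fun _ : R[i] * R[i] => s)} by exact: cvg_cst.
  have cK : {for (lam, lam), continuous (fun _ : R[i] * R[i] => K2)} by exact: cvg_cst.
  exact: (continuousM cK (continuousM cs Rc)).
have P0 : P (lam, lam) = 0.
  by rewrite /P /pick_defect /= addrK subrr /= !mulr0.
pose Q (h : R[i]) := h^-1 *: (g (h *: 1 + lam) - g lam).
have QE h : Q h = (g (h + lam) - g lam) / (h + lam - lam).
  by rewrite /Q /GRing.scale /= mulr1 addrK mulrC.
have cau (e : R) : 0 < e -> exists h0, \forall h \near 0^', abs2 (Q h0 - Q h) < e.
  move=> e0.
  have : \forall p \near (lam, lam), P p < e by apply: (cvgr_lt _ Pc); rewrite P0.
  move=> [[A B] /= [An Bn] AB].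
  pose C := A `&` (B `&` D).
  have Cn : nbhs lam C by exact: (filterI An (filterI Bn nearD)).
  have shiftc : {for (0 : R[i]), continuous (fun h : R[i] => h + lam)}.
    have idc : {for (0 : R[i]), continuous (fun h : R[i] => h)} by exact: cvg_id.
    have cst : {for (0 : R[i]), continuous (fun _ : R[i] => lam)}.
      exact: (@cvg_cst _ lam _ (nbhs (0 : R[i])) (nbhs_filter _)).
    exact: (continuous_cadd idc cst).
  have sC : nbhs (0 : R[i]) [set h | C (h + lam)].
    by apply: shiftc; rewrite add0r.
  have nC : \forall h \near (0 : R[i])^', C (h + lam) /\ h != 0.
    rewrite /prop_near1 /dnbhs /nbhs/= /within/=.
    by apply: (filterS _ sC) => h Ch hn0.
  have [h0 [[Ah0 [Bh0 Dh0]] h00]] := @filter_ex _ _ (Proper_dnbhs_numFieldType (0 : R[i])) _ nC.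
  exists h0; apply: filterS nC => h [[Ah [Bh Dh]] hn0].
  have shift0 k : k != 0 -> k + lam != lam.
    by apply: contra => /eqP/(congr1 (fun z => z - lam)); rewrite addrK subrr => ->.
  rewrite !QE; apply: le_lt_trans (g_quotients Dh0 (shift0 _ h00) Dh (shift0 _ hn0)) _.
  exact: (AB (h0 + lam, h + lam)).
have cRecvg : cvg (cRe (Q h) @[h --> 0^']).
  apply/cauchy_cvgP/cauchy_exP => e e0.
  have [h0 Hh0] := cau _ (exprn_gt0 2 e0).
  exists (cRe (Q h0)); apply: filterS Hh0 => h.
  rewrite /ball/= /abs2 cReB => H.
  rewrite -sqrtr_sqr -(ger0_norm (ltW e0)) -(sqrtr_sqr e).
  rewrite ltr_sqrt ?exprn_gt0//; apply: le_lt_trans H.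
  by rewrite lerDl sqr_ge0.
have cImcvg : cvg (cIm (Q h) @[h --> 0^']).
  apply/cauchy_cvgP/cauchy_exP => e e0.
  have [h0 Hh0] := cau _ (exprn_gt0 2 e0).
  exists (cIm (Q h0)); apply: filterS Hh0 => h.
  rewrite /ball/= /abs2 cImB => H.
  rewrite -sqrtr_sqr -(ger0_norm (ltW e0)) -(sqrtr_sqr e).
  rewrite ltr_sqrt ?exprn_gt0//; apply: le_lt_trans H.
  by rewrite lerDr sqr_ge0.
pose l := (lim (cRe (Q h) @[h --> (0 : R[i])^']) +i*
  lim (cIm (Q h) @[h --> (0 : R[i])^']))%C.
have Ql : Q h @[h --> (0 : R[i])^'] --> l.
  exact: (@cvg_complex R _ (0 : R[i])^' _ Q l cRecvg cImcvg).
by apply/cvg_ex; exists l; exact: Ql.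
Qed.

End DifferenceQuotients.

(* The choice a = - s X / (k + 1), which stays defined for k = 0. *)
Lemma discriminant_bound {R : realType} (s k N : R) (X : R[i]) :
  s ^+ 2 = 1 -> 0 <= k ->
  (forall a : R[i], 0 <= abs2 a * k + 2 * (s * cRe (conjc a * X)) + N) ->
  abs2 X <= (k + 1) * N.
Proof.
move=> s2 k0 H.
pose tau := (k + 1)^-1.
have k1 : 0 < k + 1 by lra.
have := H ((- (tau * s))%:C%C * X).
rewrite abs2M abs2_real sqrrN exprMn s2 mulr1.
have -> : cRe (conjc ((- (tau * s))%:C%C * X) * X) = - (tau * s) * abs2 X.
  by rewrite cReM cReJ cImJ cReM cImM /= /abs2; ring.
have -> : s * (- (tau * s) * abs2 X) = - (s ^+ 2 * tau * abs2 X) by ring.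
rewrite s2 mul1r => H2.
have tk : tau * (k + 1) = 1 by rewrite mulVf// gt_eqF.
have t0 : 0 < tau by rewrite invr_gt0.
have A0 := abs2_ge0 X.
have : tau ^+ 2 * k <= tau.
  have -> : tau ^+ 2 * k = tau * (tau * (k + 1)) - tau ^+ 2 by ring.
  by rewrite tk mulr1 gerBl sqr_ge0.
move=> t2k.
have : tau * abs2 X <= N.
  have : tau ^+ 2 * k * abs2 X <= tau * abs2 X by rewrite ler_wpM2r.
  by move: H2; rewrite -[tau ^+ 2 * abs2 X * k]mulrAC; lra.
by rewrite /tau mulrC ler_pdivrMr// mulrC.
Qed.

(** * Values of the kernel on graphs *)

Section SymplecticValues.
Context {R : realType} {n : nat}.

Lemma symplectic_formZ (a b : R[i]) (y z : 'cV[R[i]]_(n + n)) :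
  symplectic_form (a *: y) (b *: z) = conjc a * b * symplectic_form y z.
Proof.
rewrite !symplectic_form_sum mulr_sumr; apply: eq_bigr => i _.
by rewrite !mxE !rmorphM; ring.
Qed.

Lemma symplectic_formZr (b : R[i]) (y z : 'cV[R[i]]_(n + n)) :
  symplectic_form y (b *: z) = b * symplectic_form y z.
Proof. by rewrite -[y in LHS]scale1r symplectic_formZ conjc1 mul1r. Qed.

Lemma symplectic_formZl (a : R[i]) (y z : 'cV[R[i]]_(n + n)) :
  symplectic_form (a *: y) z = conjc a * symplectic_form y z.
Proof. by rewrite -[z in LHS]scale1r symplectic_formZ mulr1. Qed.

(** The kernel is Hermitian, so opposite off-diagonal entries have equal real parts and merge into
    the term 2 Re of the quadratic inequalities. *)
Lemma Re_symplectic_quotient_sym (p q : R[i]) (y z : 'cV[R[i]]_(n + n)) :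
  cRe (symplectic_form z y / (p - conjc q)) =
  cRe (symplectic_form y z / (q - conjc p)).
Proof.
have -> : symplectic_form z y = - conjc (symplectic_form y z).
  rewrite !symplectic_form_sum rmorph_sum -sumrN; apply: eq_bigr => i _.
  by rewrite rmorphB !rmorphM /= !conjcK opprB mulrC [X in _ - X]mulrC.
rewrite -[p in LHS]conjcK -rmorphB -opprB rmorphN invrN mulrNN -fmorphV -rmorphM.
exact: cReJ.
Qed.

Definition graph_point (P : 'M[R[i]]_n) (a : 'cV[R[i]]_n) := col_mx a (P *m a).

Lemma conj_graph_point P (x : 'cV[R]_n) :
  map_mx conjc (graph_point P (toC x)) = graph_point (map_mx conjc P) (toC x).
Proof.
rewrite /graph_point map_col_mx map_mxM.
suff -> : map_mx conjc (toC x) = toC x by [].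
by apply/matrixP => i j; rewrite !mxE conjc_real.
Qed.

Lemma symplectic_graph_point P N (x y : 'cV[R]_n) :
  symplectic_form (graph_point P (toC x)) (graph_point N (toC y)) =
  (toC x^T *m N *m toC y) 0 0 - conjc ((toC y^T *m P *m toC x) 0 0).
Proof.
rewrite /symplectic_form /graph_point !col_mxKu !col_mxKd mxE [X in _ + X]mxE.
rewrite ctr_toC mulmxA; congr (_ - _).
rewrite ctr_mulmx ctr_toC.
have -> : conjc ((toC y^T *m P *m toC x) 0 0) = (ctr (toC y^T *m P *m toC x)) 0 0.
  by rewrite [RHS]mxE [RHS]mxE.
by rewrite !ctr_mulmx !ctr_toC trmxK mulmxA.
Qed.

Definition unit_vec (i : 'I_n) : 'cV[R]_n := delta_mx i 0.

Lemma toC_unit_vec (i : 'I_n) : toC (unit_vec i) = delta_mx i 0.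
Proof. by apply/matrixP => k l; rewrite !mxE; case: (_ && _). Qed.

Lemma toC_tr_unit_vec (i : 'I_n) : toC (unit_vec i)^T = delta_mx 0 i.
Proof. by rewrite -toC_tr toC_unit_vec trmx_delta. Qed.

(** Unit vectors isolate entries. For P the conjugate of M(l) and N = M(mu), the symmetry of M(l)
    turns the right-hand side into the increment of entry (i, j) from l to mu. *)
Lemma symplectic_graph_unit P N (i j : 'I_n) :
  symplectic_form (graph_point P (toC (unit_vec i)))
    (graph_point N (toC (unit_vec j))) = N i j - conjc (P j i).
Proof.
have E (Q : 'M[R[i]]_n) (k l : 'I_n) :
    (toC (unit_vec k)^T *m Q *m toC (unit_vec l)) 0 0 = Q k l.
  by rewrite toC_tr_unit_vec toC_unit_vec -mulmxA -colE -rowE !mxE.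
by rewrite symplectic_graph_point !E.
Qed.

Lemma abs2_conjM (a : R[i]) : conjc a * a = (abs2 a)%:C%C.
Proof.
by apply: complex_eqP; rewrite ?cReM ?cImM cReJ cImJ /= /abs2; ring.
Qed.

Lemma Re_quotient_conj (z w : R[i]) : cIm w != 0 ->
  cRe ((z - conjc z) / (w - conjc w)) = cIm z / cIm w.
Proof.
move=> w0; rewrite !subcJ.
have -> : 2 * (cIm z)%:C%C * 'i%C / (2 * (cIm w)%:C%C * 'i%C) =
    (cIm z / cIm w)%:C%C :> R[i].
  have wc : (cIm w)%:C%C != 0 :> R[i] by rewrite fmorph_eq0.
  have ic : 'i%C != 0 :> R[i] by rewrite -normr_eq0 normc_abs2 /abs2/= expr0n expr1n/= add0r sqrtr1 oner_eq0.
  rewrite rmorphM fmorphV; field.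
  by rewrite ic wc.
by [].
Qed.

Lemma Re_quotient_conj_scaled (a m l : R[i]) : cIm l != 0 ->
  cRe (conjc a * (a * (conjc m - m)) / (conjc l - l)) = abs2 a * (cIm m / cIm l).
Proof.
move=> l0; rewrite mulrA abs2_conjM -mulrA cReM /= mul0r subr0; congr (_ * _).
have := @Re_quotient_conj (conjc m) (conjc l); rewrite !conjcK !cImJ => ->.
  by rewrite invrN mulrNN.
by rewrite oppr_eq0.
Qed.

End SymplecticValues.

(** * The Weyl function over a fixed base point *)

Section WeylFunction.
Context {R : realType} {n : nat} {Omega : topologicalType}.
Context (sigma : R -> Omega -> Omega) (H1 H2 H3 Delta : Omega -> 'M[R]_n).
Hypothesis H_sp : forall w, sp (hamiltonian_mx (H1 w) (H2 w) (H3 w)).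
Hypothesis Delta_sym : forall w, (Delta w)^T = Delta w.
Hypothesis Delta_pos : forall w, positive_definite (Delta w).
Let F := spectral_family H1 H2 H3 Delta.
Context (w : Omega) (s : R) (M : R[i] -> 'M[R[i]]_n).
Hypothesis s2 : s ^+ 2 = 1.
Hypothesis weyl_solution : forall l, cIm l != 0 -> forall a,
  exists y, [/\ solves sigma (F l) w y, y 0 = graph_point (M l) a & decays s y].

Lemma nonreal_sub_conj (l m : R[i]) : 0 < cIm l * cIm m -> l - conjc m != 0.
Proof.
move=> lm; apply/eqP => /(congr1 (@cIm R)); rewrite cImB cImJ opprK /= => H.
have E : cIm l = - cIm m by apply/eqP; rewrite -addr_eq0 H.
by move: lm; rewrite E mulNr oppr_gt0 ltNge -expr2 sqr_ge0.
Qed.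

(** This supplies the kernel point conj l. The initial vector [toC x] is real, so conjugation
    affects only the matrix of the graph. *)
Lemma conj_weyl_solution l (x : 'cV[R]_n) : cIm l != 0 ->
  exists y, [/\ solves sigma (F (conjc l)) w y,
    y 0 = graph_point (map_mx conjc (M l)) (toC x) & decays s y].
Proof.
move=> l0; have [y [ys y0 yd]] := weyl_solution l0 (toC x).
exists (fun t => map_mx conjc (y t)); split.
- exact: solves_conj.
- by rewrite y0 conj_graph_point.
- exact: decays_conj.
Qed.

(* Solutions of F^(conj l) and F^l have constant W, which is 0 by decay. *)
Lemma weyl_symmetric l : cIm l != 0 -> (M l)^T = M l.
Proof.
move=> l0; apply/matrixP => j i; rewrite mxE; apply/eqP; rewrite -subr_eq0; apply/eqP.
have [y [ys y0 yd]] := conj_weyl_solution (unit_vec i) l0.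
have [z [zs z0 zd]] := weyl_solution l0 (toC (unit_vec j)).
pose G t := symplectic_form (y t) (z t).
have G0 : G 0 = M l i j - M l j i.
  by rewrite /G y0 z0 symplectic_graph_unit mxE conjcK.
rewrite -G0.
have Gd t : has_derivative G t 0.
  have := symplectic_form_derivative H_sp Delta_sym t ys zs.
  by rewrite conjcK subrr mul0r.
have GR t : cRe (G t) = cRe (G 0).
  by apply: (is_derive_0_is_cst (f := fun u => cRe (G u))) => u; case: (Gd u).
have GI t : cIm (G t) = cIm (G 0).
  by apply: (is_derive_0_is_cst (f := fun u => cIm (G u))) => u; case: (Gd u).
have Gc t : G t = G 0 by apply: complex_eqP.
move: yd zd => [K [b [b0 yK]]] [K' [b' [b'0 zK]]].
pose b2 := Num.min b b'.
have b20 : 0 < b2 by rewrite lt_min b0.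
(* The multiplier k is free; taking the conjugate of [G 0] gives |G 0|^2 <= 0. *)
have small (k : R[i]) : cRe (G 0 * k) <= 0.
  apply: (exp_decay_le0 (K := `|K| + abs2 k * `|K'|) b20) => t t0.
  rewrite -(Gc (s * t)); apply: le_trans (ler_norm _) _.
  apply: le_trans (abs_Re_symplectic_le _ _ _) _.
  have e1 : sqnorm (y (s * t)) <= `|K| * expR (- b2 * t).
    apply: le_trans (yK t t0) _; apply: (@le_trans _ _ (`|K| * expR (- b * t))).
      by rewrite ler_wpM2r ?expR_ge0// ler_norm.
    by rewrite ler_wpM2l// ler_expR !mulNr lerN2 ler_wpM2r// ge_min lexx.
  have e2 : sqnorm (z (s * t)) <= `|K'| * expR (- b2 * t).
    apply: le_trans (zK t t0) _; apply: (@le_trans _ _ (`|K'| * expR (- b' * t))).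
      by rewrite ler_wpM2r ?expR_ge0// ler_norm.
    by rewrite ler_wpM2l// ler_expR !mulNr lerN2 ler_wpM2r// ge_min lexx orbT.
  have -> : (`|K| + abs2 k * `|K'|) * expR (- b2 * t) =
    `|K| * expR (- b2 * t) + abs2 k * (`|K'| * expR (- b2 * t)) by ring.
  by apply: lerD => //; rewrite ler_wpM2l ?abs2_ge0.
have := small (conjc (G 0)); rewrite cReM cReJ cImJ => H.
apply: abs2_eq0; apply/eqP; rewrite eq_le abs2_ge0 andbT.
by move: H; rewrite mulrN opprK -!expr2.
Qed.

Lemma weyl_sign l (x : 'cV[R]_n) : cIm l != 0 ->
  0 <= s * (cIm ((toC x^T *m M l *m toC x) 0 0) / cIm l).
Proof.
move=> l0; have [y [ys y0 yd]] := weyl_solution l0 (toC x).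
have ll : 0 < cIm l * cIm l by rewrite -expr2 exprn_even_gt0.
have := @kernel_ge0 R n Omega sigma H1 H2 H3 Delta H_sp Delta_sym Delta_pos 'I_1
  (fun=> l) w (fun=> y) s s2 (fun=> ys) (fun=> yd) (fun _ _ => nonreal_sub_conj ll).
by rewrite !big_ord1 y0 symplectic_graph_point Re_quotient_conj.
Qed.

(* The kernel at the points conj l and mu, with weights [a] and 1. *)
Lemma weyl_quotient l mu i j (a : R[i]) : cIm l != 0 -> 0 < cIm mu * cIm l ->
  mu != l ->
  0 <= s * (abs2 a * (cIm (M l i i) / cIm l) +
    2 * cRe (conjc a * ((M mu i j - M l i j) / (mu - l))) + cIm (M mu j j) / cIm mu).
Proof.
move=> l0 mul mun.
have mu0 : cIm mu != 0 by apply: contraTneq mul => ->; rewrite mul0r ltxx.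
have [y [ys y0 yd]] := conj_weyl_solution (unit_vec i) l0.
have [z [zs z0 zd]] := weyl_solution mu0 (toC (unit_vec j)).
pose p (k : 'I_2) := nth 0 [:: conjc l; mu] k.
pose v (k : 'I_2) := nth (fun=> 0) [:: fun t => a *: y t; z] k.
have vs k : solves sigma (F (p k)) w (v k).
  by case: k => [[|[|//]] ?]; rewrite /p /v /=; [exact: solvesZ|].
have vd k : decays s (v k).
  by case: k => [[|[|//]] ?]; rewrite /v /=; [exact: decaysZ|].
have ll : 0 < cIm l * cIm l by rewrite -expr2 exprn_even_gt0.
have mm : 0 < cIm mu * cIm mu by rewrite -expr2 exprn_even_gt0.
have mul0 : mu - l != 0 by rewrite subr_eq0.
have pp k k' : p k' - conjc (p k) != 0.
  case: k => [[|[|//]] ?]; case: k' => [[|[|//]] ?]; rewrite /p /= ?conjcK //.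
  - by rewrite -[l]conjcK -rmorphB conjc_eq0 conjcK; exact: nonreal_sub_conj.
  - by rewrite -rmorphB conjc_eq0 -opprB oppr_eq0.
  - exact: nonreal_sub_conj.
have := @kernel_ge0 R n Omega sigma H1 H2 H3 Delta H_sp Delta_sym Delta_pos 'I_2
  p w v s s2 vs vd pp.
rewrite !big_ord_recl !big_ord0 !addr0 /p /v /=.
rewrite y0 z0 !cReD (Re_symplectic_quotient_sym (conjc l) mu).
rewrite !symplectic_formZl !symplectic_formZr !symplectic_graph_unit !mxE !conjcK.
rewrite Re_quotient_conj_scaled// Re_quotient_conj//.
have sym : M l j i = M l i j by rewrite -[in RHS](weyl_symmetric l0) mxE.
rewrite sym -mulrA; set A := abs2 a * _; set B := cRe _; set C := cIm _ / _.
by rewrite (_ : A + B + (B + C) = A + 2 * B + C)//; ring.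
Qed.

(* The kernel at the points conj l, mu and nu, with weights [a], 1 and -1. *)
Lemma weyl_quotients l mu nu i j (a : R[i]) : cIm l != 0 ->
  0 < cIm mu * cIm l -> mu != l -> 0 < cIm nu * cIm l -> nu != l ->
  0 <= s * (abs2 a * (cIm (M l i i) / cIm l) +
    2 * cRe (conjc a * ((M mu i j - M l i j) / (mu - l) -
                        (M nu i j - M l i j) / (nu - l))) +
    cRe (pick_defect (fun z => M z j j) mu nu)).
Proof.
move=> l0 mul mun nul nun.
have mu0 : cIm mu != 0 by apply: contraTneq mul => ->; rewrite mul0r ltxx.
have nu0 : cIm nu != 0 by apply: contraTneq nul => ->; rewrite mul0r ltxx.
have [y [ys y0 yd]] := conj_weyl_solution (unit_vec i) l0.
have [z [zs z0 zd]] := weyl_solution mu0 (toC (unit_vec j)).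
have [u [us u0 ud]] := weyl_solution nu0 (toC (unit_vec j)).
pose p (k : 'I_3) := nth 0 [:: conjc l; mu; nu] k.
pose v (k : 'I_3) := nth (fun=> 0) [:: fun t => a *: y t; z; fun t => (-1) *: u t] k.
have vs k : solves sigma (F (p k)) w (v k).
  by case: k => [[|[|[|//]]] ?]; rewrite /p /v /=; [exact: solvesZ| |exact: solvesZ].
have vd k : decays s (v k).
  by case: k => [[|[|[|//]]] ?]; rewrite /v /=; [exact: decaysZ| |exact: decaysZ].
have ll : 0 < cIm l * cIm l by rewrite -expr2 exprn_even_gt0.
have mm : 0 < cIm mu * cIm mu by rewrite -expr2 exprn_even_gt0.
have nn : 0 < cIm nu * cIm nu by rewrite -expr2 exprn_even_gt0.
(* Both points lie in the half-plane of l, hence in the same one, so mu - conj nu is nonzero. *)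
have mn : 0 < cIm mu * cIm nu.
  have : 0 < (cIm mu * cIm l) * (cIm nu * cIm l) by rewrite mulr_gt0.
  by rewrite mulrACA pmulr_lgt0.
have mul0 : mu - l != 0 by rewrite subr_eq0.
have nul0 : nu - l != 0 by rewrite subr_eq0.
have pp k k' : p k' - conjc (p k) != 0.
  case: k => [[|[|[|//]]] ?]; case: k' => [[|[|[|//]]] ?]; rewrite /p /= ?conjcK //.
  - by rewrite -[l]conjcK -rmorphB conjc_eq0 conjcK; exact: nonreal_sub_conj.
  - by rewrite -rmorphB conjc_eq0 -opprB oppr_eq0.
  - exact: nonreal_sub_conj.
  - by apply: nonreal_sub_conj; rewrite mulrC.
  - by rewrite -rmorphB conjc_eq0 -opprB oppr_eq0.
  - exact: nonreal_sub_conj.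
  - exact: nonreal_sub_conj.
have := @kernel_ge0 R n Omega sigma H1 H2 H3 Delta H_sp Delta_sym Delta_pos 'I_3
  p w v s s2 vs vd pp.
rewrite !big_ord_recl !big_ord0 !addr0 /p /v /=.
have sym : M l j i = M l i j by rewrite -[in RHS](weyl_symmetric l0) mxE.
have Wyy : symplectic_form (y 0) (y 0) = conjc (M l i i) - M l i i.
  by rewrite y0 symplectic_graph_unit !mxE conjcK.
have Wyz : symplectic_form (y 0) (z 0) = M mu i j - M l i j.
  by rewrite y0 z0 symplectic_graph_unit mxE conjcK sym.
have Wyu : symplectic_form (y 0) (u 0) = M nu i j - M l i j.
  by rewrite y0 u0 symplectic_graph_unit mxE conjcK sym.
have Wzz : symplectic_form (z 0) (z 0) = M mu j j - conjc (M mu j j).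
  by rewrite z0 symplectic_graph_unit.
have Wzu : symplectic_form (z 0) (u 0) = M nu j j - conjc (M mu j j).
  by rewrite z0 u0 symplectic_graph_unit.
have Wuz : symplectic_form (u 0) (z 0) = M mu j j - conjc (M nu j j).
  by rewrite z0 u0 symplectic_graph_unit.
have Wuu : symplectic_form (u 0) (u 0) = M nu j j - conjc (M nu j j).
  by rewrite u0 symplectic_graph_unit.
have N1 : conjc (-1) = -1 :> R[i] by apply: complex_eqP; rewrite /= ?oppr0.
rewrite !cReD (Re_symplectic_quotient_sym (conjc l) mu).
rewrite (Re_symplectic_quotient_sym (conjc l) nu).
rewrite !symplectic_formZl !symplectic_formZr Wyy Wyz Wyu Wzz Wzu Wuz Wuu !conjcK N1.
rewrite Re_quotient_conj_scaled// !mulN1r !opprK !mulrN !mulNr !cReN.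
rewrite [conjc a * (_ / _ - _ / _)]mulrBr cReB !mulrA /pick_kernel.
set t1 := abs2 a * _ / _; set t2 := cRe (_ / (mu - l)); set t3 := cRe (_ / (nu - l)).
set t4 := cRe (_ / (mu - conjc mu)); set t5 := cRe (_ / (nu - conjc nu)).
set t6 := cRe (_ / (nu - conjc mu)); set t7 := cRe (_ / (mu - conjc nu)).
have -> // : t1 + (t2 - t3) + (t2 + (t4 - t6) + (- t3 + (- t7 + t5))) =
  t1 + 2 * (t2 - t3) + (t4 + t5 - t6 - t7) by ring.
Qed.

Lemma unit_quadratic (N : 'M[R[i]]_n) (i : 'I_n) :
  (toC (unit_vec i)^T *m N *m toC (unit_vec i)) 0 0 = N i i.
Proof. by rewrite toC_tr_unit_vec toC_unit_vec -mulmxA -colE -rowE !mxE. Qed.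

(** The quadratic inequalities hold for every weight a, so their discriminants bound the quotients.
    The diagonal entry (j, j) plays the role of [f], entry (i, j) that of [g]; the weights at l
    contribute the constants from the entries (j, j) and (i, i) of M(l). *)
Lemma weyl_derivable l i j : cIm l != 0 -> derivable (fun z => M z i j) l 1.
Proof.
move=> l0.
have kpos k : 0 <= s * (cIm (M l k k) / cIm l).
  by have := weyl_sign (unit_vec k) l0; rewrite unit_quadratic.
pose D := [set mu : R[i] | 0 < cIm mu * cIm l].
apply: (@pick_derivable R l (fun z => M z j j) (fun z => M z i j) D s
  (s * (cIm (M l j j) / cIm l) + 1) (s * (cIm (M l i i) / cIm l) + 1)) => //.
- have l1 : 0 < `|cIm l| by rewrite normr_gt0.
  have : \forall mu \near l, `|cIm l - cIm mu| < `|cIm l|.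
    by move/(@cvgrPdist_lt _ _ _ (nbhs l)): (@Im_continuous R l); exact.
  apply: filterS => mu lt_mu; rewrite /D /=.
  have -> : cIm mu * cIm l = cIm l ^+ 2 - (cIm l - cIm mu) * cIm l by ring.
  rewrite subr_gt0 -[cIm l ^+ 2]real_normK ?num_real//.
  by rewrite (le_lt_trans (ler_norm _))// normrM expr2 ltr_pM2r.
- move=> mu Dmu mul; apply: (discriminant_bound s2 (kpos j)) => a.
  have := weyl_quotient j j a l0 Dmu mul; set X := _ / (mu - l).
  congr (0 <= _); ring.
- move=> mu nu Dmu mul Dnu nul; apply: (discriminant_bound s2 (kpos i)) => a.
  have := weyl_quotients i j a l0 Dmu mul Dnu nul.
  congr (0 <= _); ring.
Qed.

Lemma weyl_quadratic_sign l (x : 'cV[R]_n) : cIm l != 0 ->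
  0 <= (s * cIm l) * (x^T *m map_mx (@cIm R) (M l) *m x) 0 0.
Proof.
move=> l0.
have -> : (x^T *m map_mx (@cIm R) (M l) *m x) 0 0 =
    cIm ((toC x^T *m M l *m toC x) 0 0).
  rewrite quadratic_form_sum mxE cIm_sum; apply: eq_bigr => j _.
  rewrite mxE mulr_suml cIm_sum; apply: eq_bigr => i _.
  by rewrite !mxE !cImM !cReM /=; ring.
have := weyl_sign x l0; move: (cIm (_ 0 0)) => q H.
have -> : s * cIm l * q = s * (q / cIm l) * cIm l ^+ 2 by field.
by rewrite mulr_ge0// sqr_ge0.
Qed.

(** The sign of Im M is that of s Im l: it changes with the half-plane and with the end at which the
    solutions decay. *)
Lemma weyl_herglotz : herglotz upper_half_plane M /\ herglotz lower_half_plane M.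
Proof.
have up (l : R[i]) : upper_half_plane l -> cIm l != 0 by rewrite /upper_half_plane /= => /gt_eqF ->.
have lo (l : R[i]) : lower_half_plane l -> cIm l != 0 by rewrite /lower_half_plane /= => /lt_eqF ->.
have sE : (s == 1) || (s == -1) by rewrite -sqrf_eq1 s2.
have quadN l (x : 'cV[R]_n) : (x^T *m (- map_mx (@cIm R) (M l)) *m x) 0 0 =
    - (x^T *m map_mx (@cIm R) (M l) *m x) 0 0.
  by rewrite mulmxN mulNmx mxE.
split; split.
- by move=> l /up; exact: weyl_symmetric.
- by move=> l /up l0 i j; exact: weyl_derivable.
- case/orP: sE => /eqP sE; [left|right] => l lD x; have := weyl_quadratic_sign x (up l lD).
    by rewrite sE mul1r pmulr_rge0.
  by rewrite sE mulN1r nmulr_rge0 ?oppr_lt0// quadN oppr_ge0.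
- by move=> l /lo; exact: weyl_symmetric.
- by move=> l /lo l0 i j; exact: weyl_derivable.
- case/orP: sE => /eqP sE; [right|left] => l lD x; have := weyl_quadratic_sign x (lo l lD).
    by rewrite sE mul1r nmulr_rge0// quadN oppr_ge0.
  by rewrite sE mulN1r pmulr_rge0 ?oppr_gt0.
Qed.

End WeylFunction.

(** * The dynamical alternative *)

Lemma entrywise_toC {R : realType} (T : topologicalType) m p
    (f : T -> 'M[R]_(m, p)) x : {for x, continuous f} ->
  entrywise_continuous (fun t => toC (f t)) x.
Proof.
move=> fc i j.
have -> : (fun t => toC (f t) i j) = (fun t => (f t i j)%:C%C).
  by apply/funext => t; rewrite mxE.
apply: (@cvg_complex R _ (nbhs x)) => /=; last exact: cvg_cst.
exact: (continuous_comp fc (@coord_continuous R m p i j (f x))).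
Qed.

Theorem corollary3p7 (R : realType) (n : nat)
    (Omega : metricType R) (Omega_compact : compact [set: Omega])
    (sigma : R -> Omega -> Omega) (sigma_flow : continuous_flow sigma)
    (H1 H2 H3 Delta : Omega -> 'M[R]_n)
    (H_continuous :
       continuous (fun w => hamiltonian_mx (H1 w) (H2 w) (H3 w)))
    (H_sp : forall w, sp (hamiltonian_mx (H1 w) (H2 w) (H3 w)))
    (Delta_continuous : continuous Delta)
    (Delta_sym : forall w, (Delta w)^T = Delta w)
    (Delta_pos : forall w, positive_definite (Delta w)) :
  let F := spectral_family H1 H2 H3 Delta in
  let ED (l : R[i]) := exponential_dichotomy sigma (F l) in
  let special_solution (w : Omega) (l : R[i]) (z1 : R -> 'cV[R[i]]_n) :=
    let z t : 'cV[R[i]]_(n + n) := col_mx (z1 t) 0 in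
    [/\ solves sigma (F l) w z, bounded_on_line z & exists t, z t != 0] in
  let O1 :=
    (exists l0, ED l0) /\
    (forall l : R[i], complex.Im l != 0 -> ED l) /\
    (exists Mp Mm : Omega -> R[i] -> 'M[R[i]]_n,
       (forall l : R[i], complex.Im l != 0 ->
          weyl_functions sigma (F l) (Mp^~ l) (Mm^~ l)) /\
       (forall w, [/\ herglotz upper_half_plane (Mp w),
                      herglotz lower_half_plane (Mp w),
                      herglotz upper_half_plane (Mm w) &
                      herglotz lower_half_plane (Mm w)])) in
  let O2 := forall l, ~ ED l in
  [/\ O1 \/ O2,
      O2 <-> (exists w l0 z1, special_solution w l0 z1) &
      forall w l0 z1, special_solution w l0 z1 ->
        forall l, solves sigma (F l) w (fun t => col_mx (z1 t) 0)].
Proof.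
move=> F ED special_solution O1 O2.
have Hc w := entrywise_toC (@H_continuous w).
(* Continuity is given for the whole matrix; [ri] and [rj] select a block of it. *)
have sub (f : Omega -> 'M[R]_n) (ri rj : 'I_n -> 'I_(n + n)) w :
    (forall v i j, hamiltonian_mx (H1 v) (H2 v) (H3 v) (ri i) (rj j) = f v i j) ->
    entrywise_continuous (fun v => toC (f v)) w.
  move=> fE i j.
  have -> : (fun v => toC (f v) i j) =
      (fun v => toC (hamiltonian_mx (H1 v) (H2 v) (H3 v)) (ri i) (rj j)).
    by apply/funext => v; rewrite [LHS]mxE [RHS]mxE fE.
  exact: Hc.
have H1c w : entrywise_continuous (fun v => toC (H1 v)) w.
  by apply: (sub _ (@lshift n n) (@lshift n n)) => v i j; rewrite /hamiltonian_mx block_mxEul.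
have H2c w : entrywise_continuous (fun v => toC (H2 v)) w.
  by apply: (sub _ (@rshift n n) (@lshift n n)) => v i j; rewrite /hamiltonian_mx block_mxEdl.
have H3c w : entrywise_continuous (fun v => toC (H3 v)) w.
  by apply: (sub _ (@lshift n n) (@rshift n n)) => v i j; rewrite /hamiltonian_mx block_mxEur.
have Dc w : entrywise_continuous (fun v => toC (Delta v)) w.
  exact: (entrywise_toC (@Delta_continuous w)).
have any w l0 z1 : special_solution w l0 z1 ->
    forall l, solves sigma (F l) w (fun t => col_mx (z1 t) 0).
  by move=> [zs _ _] l; exact: special_solution_any zs.
have special_no_ED : (exists w l0 z1, special_solution w l0 z1) -> O2.
  move=> [w [l0 [z1 sp1]]] l [Lp [Lm split_pm]].
  (* The same function solves the system at the parameter [l] of the assumed dichotomy, where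
     bounded solutions vanish. *)
  have zs := any _ _ _ sp1 l; case: sp1 => _ zb [t /eqP zt]; apply: zt.
  have [L L0 FL] := entrywise_bounded Omega_compact (spectral_continuous (l := l) H1c H2c H3c Dc).
  have FR v i j : `|cRe (F l v i j)| <= L by case: (FL v i j).
  have FI v i j : `|cIm (F l v i j)| <= L by case: (FL v i j).
  exact: (dichotomy_bounded_solution_eq0 sigma_flow FR FI L0 split_pm zs zb).
have no_special_O1 : ~ (exists w l0 z1, special_solution w l0 z1) -> O1.
  move=> nsp.
  have dich l : cIm l != 0 -> exists Mp Mm,
      dichotomy_splitting sigma (F l) (fun w => graph_space (Mp w))
        (fun w => graph_space (Mm w)).
    move=> l0; apply: dichotomy_nonreal => // w z1 z zsp.
    by apply: nsp; exists w, l, z1.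
  have EDl l : cIm l != 0 -> ED l.
    by move=> /dich[Mp [Mm H]]; exists (fun w => graph_space (Mp w)), (fun w => graph_space (Mm w)).
  have i0 : cIm ('i%C : R[i]) != 0 by rewrite /= oner_eq0.
  split; first by exists 'i%C; exact: EDl.
  split=> //.
  have /choice[Mp /choice[Mm MpmP]] : forall l : R[i], exists Mp Mm : Omega -> 'M[R[i]]_n,
      cIm l != 0 -> dichotomy_splitting sigma (F l) (fun w => graph_space (Mp w))
        (fun w => graph_space (Mm w)).
    (* Choice asks for matrices at real l as well; 0 is a dummy value there. *)
    move=> l; have [l0|l0] := eqVneq (cIm l) 0; first by exists (fun=> 0), (fun=> 0).
    by have [Mp [Mm H]] := dich l l0; exists Mp, Mm.
  exists (fun w l => Mp l w), (fun w l => Mm l w); split=> [l l0|w].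
    exists (fun w => graph_space (Mp l w)), (fun w => graph_space (Mm l w)).
    by split=> [|w]; [exact: MpmP | split; exact: graph_space_basis].
  have solp l : cIm l != 0 -> forall a, exists y, [/\ solves sigma (F l) w y,
      y 0 = graph_point (Mp l w) a & decays 1 y].
    move=> l0 a; have [dp _] := dichotomy_decay (MpmP l l0).
    have [|y [ys y0] [K [b [b0 yK]]]] := dp w (graph_point (Mp l w) a).
      by apply/mem_graph_space; rewrite /graph_point col_mxKd col_mxKu.
    by exists y; split=> //; exists K, b; split=> // t t0; rewrite mul1r yK.
  have solm l : cIm l != 0 -> forall a, exists y, [/\ solves sigma (F l) w y,
      y 0 = graph_point (Mm l w) a & decays (-1) y].
    move=> l0 a; have [_ dm] := dichotomy_decay (MpmP l l0).
    have [|y [ys y0] [K [b [b0 yK]]]] := dm w (graph_point (Mm l w) a).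
      by apply/mem_graph_space; rewrite /graph_point col_mxKd col_mxKu.
    by exists y; split=> //; exists K, b; split=> // t t0; rewrite mulN1r yK.
  have [pu pl] := weyl_herglotz H_sp Delta_sym Delta_pos (expr1n _ _) solp.
  have sN1 : (-1) ^+ 2 = 1 :> R by rewrite sqrrN expr1n.
  have [mu ml] := weyl_herglotz H_sp Delta_sym Delta_pos sN1 solm.
  by split.
(* With a special solution O2 holds. Without one O1 holds, and the dichotomy it contains contradicts
   O2; both cases together give the equivalence. *)
have [spec|nspec] := pselect (exists w l0 z1, special_solution w l0 z1).
  split; [by right; exact: special_no_ED | | exact: any].
  by split=> [_|]; [exact: spec | exact: special_no_ED].
have hO1 := no_special_O1 nspec.
split; [by left | | exact: any].
split=> [hO2|spec]; last by case: nspec.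
by have [[l0 hl0] _] := hO1; case: (hO2 l0).
Qed.
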